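(* Let $T\colon R^{p,0}_\omega\to R^{p,0}_\omega$ be a bounded linear operator with $\inf_{(n,I)\in\mathcal D_\omega}\big||I|^{-1}\langle h^n_I,Th^n_I\rangle\big|\ge\delta>0$. Then for every $0<\epsilon<1$, $T$ is a $\frac{2(p^*-1)^4}{\delta(1-\epsilon)}\big(\frac{p^*}{2}\big)^{3/2}$-factor of the identity on $R^{p,0}_\omega$, i.e. there exist bounded operators $A,B$ on $R^{p,0}_\omega$ with $ATB=I$ and $\|A\|\|B\|\le\frac{2(p^*-1)^4}{\delta(1-\epsilon)}\big(\frac{p^*}{2}\big)^{3/2}$.
   Context: Fix $1<p<\infty$, $q=p/(p-1)$, $p^*=\max\{p,q\}$. All $L_r$ spaces are over $[0,1]$ with Lebesgue measure and $\langle g,f\rangle=\int_0^1gf$. A dyadic interval is $[(i-1)2^{-n},i2^{-n})$, $n\ge0$, $1\le i\le2^n$; $\mathcal D^n$ is the set of those of length $2^{-n}$ and $\mathcal D_n=\bigcup_{k=0}^n\mathcal D^k$. For a dyadic interval $I$, $I^+,I^-$ are its left and right halves and $h_I=\chi_{I^+}-\chi_{I^-}$. For each $n\in\mathbb N$ a family $(h^n_I)_{I\in\mathcal D_{n-1}}$ in $L_p$ is fixed with the same joint distribution as $(h_I)_{I\in\mathcal D_{n-1}}$, such that the $\sigma$-algebras $\sigma(h^n_I:I\in\mathcal D_{n-1})$, $n\in\mathbb N$, are independent. Let $\mathcal D_\omega=\{(n,I):n\in\mathbb N,I\in\mathcal D_{n-1}\}$. $R^{p,0}_\omega$ is the closed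 linear span of $\{h^n_I:(n,I)\in\mathcal D_\omega\}$ in $L_p$ (a distributional copy of the mean-zero hyperplane of the Bourgain–Rosenthal–Schechtman space $R^p_\omega$); $(h^n_I)$ is an unconditional basis of it. *)

(* Defs.v *)
From HB Require Import structures.
From mathcomp Require Import all_boot all_order all_algebra.
From mathcomp Require Import all_classical all_reals all_analysis.

Set Implicit Arguments.
Unset Strict Implicit.
Unset Printing Implicit Defensive.
Import Order.TTheory GRing.Theory Num.Theory.
Import numFieldNormedType.Exports.

Local Open Scope classical_set_scope.
Local Open Scope ring_scope.

(* Dyadic intervals are indexed by (k, j) with k = level (length 2^-k) and
   j < 2^k (0-based position): I_{k,j} = [j 2^-k, (j+1) 2^-k).
   The paper's index i (1 <= i <= 2^k) is j + 1. *)

Definition haar (R : realType) (k j : nat) (t : R) : R :=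
  let a := j%:R / 2 ^+ k in
  let m := (j%:R + 2^-1) / 2 ^+ k in
  let b := j.+1%:R / 2 ^+ k in
  (if (a <= t) && (t < m) then 1 else 0) - (if (m <= t) && (t < b) then 1 else 0).

(** Index set D_omega: (n, I) with n >= 1 and I in D_{n-1}, i.e. level k <= n-1. *)
Definition Dw (n k j : nat) : Prop := (0 < n)%N /\ (k < n)%N /\ (j < 2 ^ k)%N.

Definition sigma_n d (Omega : measurableType d) (R : realType)
  (h : nat -> nat -> nat -> Omega -> R) (n : nat) : set (set Omega) :=
  <<s [set A | exists k j (B : set R),
          [/\ (k < n)%N, (j < 2 ^ k)%N, measurable B & A = h n k j @^-1` B]] >>.

(** (h n k j) is a family as in the context: each h^n_I is measurable;
    for every n, (h^n_I)_{I in D_{n-1}} has the same joint distribution as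
    (h_I)_{I in D_{n-1}} on [0,1] with Lebesgue measure (equality of the joint
    laws on all measurable rectangles of R^{D_{n-1}}); and the sigma-algebras
    sigma(h^n_I : I in D_{n-1}), n in N, are (mutually) independent. *)
Definition BRS_copy d (Omega : measurableType d) (R : realType)
  (P : probability Omega R) (h : nat -> nat -> nat -> Omega -> R) : Prop :=
  [/\ (forall n k j, measurable_fun [set: Omega] (h n k j)),
      (forall (n : nat) (B : nat -> nat -> set R),
         (forall k j, measurable (B k j)) ->
         P [set w | forall k j, (k < n)%N -> (j < 2 ^ k)%N -> B k j (h n k j w)]
         = (@lebesgue_measure R)
             ([set t : R | 0 <= t <= 1] `&`
              [set t : R | forall k j, (k < n)%N -> (j < 2 ^ k)%N -> B k j (haar k j t)]))
    & (forall (S : seq nat) (A : nat -> set Omega),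
         uniq S -> (forall n, n \in S -> sigma_n h n (A n)) ->
         P (\bigcap_(n in [set` S]) A n) = (\prod_(n <- S) P (A n))%E)].

Definition Lpnorm d (Omega : measurableType d) (R : realType)
  (P : probability Omega R) (p : R) (f : Omega -> R) : \bar R :=
  'N[P]_(p%:E)[EFin \o f].

Definition haar_span d (Omega : measurableType d) (R : realType)
  (h : nat -> nat -> nat -> Omega -> R) (g : Omega -> R) : Prop :=
  exists (s : seq (nat * nat * nat)) (c : nat * nat * nat -> R),
    (forall t, t \in s -> Dw t.1.1 t.1.2 t.2) /\
    g = (fun w => \sum_(t <- s) c t * h t.1.1 t.1.2 t.2 w).

(** R^{p,0}_omega: the closed linear span in L_p of {h^n_I : (n,I) in D_omega}
    (as a set of representatives; functions are identified when equal a.e.). *)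
Definition Rp0w d (Omega : measurableType d) (R : realType)
  (P : probability Omega R) (p : R) (h : nat -> nat -> nat -> Omega -> R) :
  set (Omega -> R) :=
  [set f : Omega -> R | [/\ measurable_fun [set: Omega] f,
              (Lpnorm P p f < +oo)%E &
              forall e : R, 0 < e -> exists g, haar_span h g /\
                 (Lpnorm P p (fun w => (f w - g w)%R) < e%:E)%E]].

(** T is a bounded linear operator on the subspace X of L_p with
    ||T f||_p <= C ||f||_p (operators act on a.e.-classes: linearity is
    required a.e.; well-definedness on classes follows). *)
Definition bounded_op d (Omega : measurableType d) (R : realType)
  (P : probability Omega R) (p : R) (X : set (Omega -> R))
  (T : (Omega -> R) -> (Omega -> R)) (C : R) : Prop :=
  [/\ 0 <= C,
      (forall f, X f -> X (T f)),
      (forall (a : R) f g, X f -> X g ->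
         T (fun w => a * f w + g w) = (fun w => a * T f w + T g w) %[ae P])
    & (forall f, X f -> (Lpnorm P p (T f) <= C%:E * Lpnorm P p f)%E)].

Definition conj_exp (R : realType) (p : R) : R := p / (p - 1).
Definition pstar (R : realType) (p : R) : R := Num.max p (conj_exp p).

Definition dlen (R : realType) (k : nat) : R := (2 ^+ k)^-1.

(* Main.v *)
Require Import Defs.
From HB Require Import structures.
From mathcomp Require Import all_boot all_order all_algebra.
From mathcomp Require Import all_classical all_reals all_analysis.
From mathcomp Require Import zify ring lra measurable_realfun.
Import Order.TTheory GRing.Theory Num.Theory.
Import numFieldNormedType.Exports.
Local Open Scope classical_set_scope.
Local Open Scope ring_scope.

Set Implicit Arguments.
Unset Strict Implicit.
Unset Printing Implicit Defensive.

(** Multiplying [T] by the Haar multiplier [M] that corrects the signs of the diagonal of [T],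
    we get [T' = T M] with diagonal entries at least [delta |I|].  Inside a sufficiently deep
    tree [mu n] one chooses, node by node, blocks [b^n_I], each a signed sum of Haar functions
    of a single level, supported where the block of the parent node has the right sign; the
    family [b] then has the same joint law as [h].  A greedy choice of signs keeps
    [<b, T' b> >= delta |I|], and since the norm of a sum of [N] levels is [o(N)], among [N]
    consecutive levels there is one for which all new off-diagonal entries are small.
    The map [B : h |-> b] is isometric, and conditional expectation on [b] followed by [B^-1]
    is a contraction [A0].  Then [A0 T' B] is diagonal up to a small perturbation; the diagonal
    is inverted by another Haar multiplier and the rest by a Neumann series.  Multipliers with
    entries in [[-1, 1]] have norm at most [sqrt 2 * (p* - 1)^2] by Burkholder's
    zigzag-concave function; two of them give the factor [2 (p* - 1)^4]. *)

(** * Binary words, dyadic averages and Haar sums *)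

(** All norm estimates are reduced to finite averages. The law of the family enters through one
    identity: the integral of a function of a finite Haar sum is an iterated average over binary
    trees. Isometry of [B], contractivity of [A0] and the multiplier bound are inequalities between
    such averages. The obstacle is that the diagonal says nothing about the rest of the matrix,
    while the blocks must have exactly the law of the Haar functions: their supports are dictated by
    the earlier blocks, and only levels and signs are free. Blocks of a single level take only the
    values 0, 1, -1, which yields the law. The level is found by pigeonhole: a sum of N levels is at
    most N pointwise and sqrt N in L_2, hence o(N) in L_p and in L_q. With both exponents, rows and
    columns are controlled without an adjoint. The depth of a tree is fixed before its blocks are
    chosen, so N may depend only on the tolerance and on the number of constraints. The multiplier
    constant is not sharp, but it makes the scalar majorization elementary; since p* >= 2, the power
    of p* / 2 in the bound is at least 1. *)

Section Words.
Variable R : realType.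
Implicit Types (f g c d : seq bool -> R) (m n k : nat) (w x J : seq bool).

(* Nodes and leaves of a dyadic tree are binary words; [false] is the left half. *)
Definition sgnb (b : bool) : R := if b then -1 else 1.

Fixpoint avg m f : R :=
  if m is m'.+1 then
    (avg m' (fun s => f (false :: s)) + avg m' (fun s => f (true :: s))) / 2
  else f [::].

(* The value at the leaf [x] of the Haar sum with coefficients [c]: only the prefixes of [x]
   contribute. *)
Definition Mt m c x : R := \sum_(k < m) c (take k x) * sgnb (nth false x k).

Definition Hw w x : R :=
  if take (size w) x == w then sgnb (nth false x (size w)) else 0.

(** By orthogonality of the Haar functions, this is the L_2 inner product of [Mt m c] and [Mt m d]
    ([avg_MtM0]). *)
Definition ipt m c d : R := \sum_(k < m) avg k (fun w => c w * d w).

Fixpoint words k : seq (seq bool) :=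
  if k is k'.+1 then
    [seq false :: w | w <- words k'] ++ [seq true :: w | w <- words k']
  else [:: [::]].

(** The nodes of tree [n], that is D_{n-1}, listed level by level, so that parents precede their
    children. *)
Definition W n : seq (seq bool) := flatten [seq words k | k <- iota 0 n].

Lemma normr_sgnb b : `|sgnb b| = 1.
Proof. by case: b; rewrite /sgnb ?normrN normr1. Qed.

Lemma sgnb_neq0 b : sgnb b != 0.
Proof. by rewrite -normr_gt0 normr_sgnb ltr01. Qed.

Lemma sgnb_inj b b' : (sgnb b == sgnb b') = (b == b').
Proof. by case: b; case: b'; rewrite /sgnb ?eqxx //=; apply/negbTE/eqP => E; lra. Qed.

Lemma mem_words k w : (w \in words k) = (size w == k).
Proof.
elim: k w => [|k IH] w; first by rewrite inE; case: w.
rewrite mem_cat; apply/orP/idP.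
  by case=> /mapP[v]; rewrite IH => /eqP <- ->.
case: w => // b w; rewrite /= eqSS -IH => wk.
by case: b; [right|left]; apply: map_f.
Qed.

Lemma uniq_words k : uniq (words k).
Proof.
elim: k => //= k IH; rewrite cat_uniq !map_inj_uniq ?IH => [|? ? []//|? ? []//].
rewrite andbT /=; apply/hasPn => _ /mapP[v _ ->].
by apply/negP => /mapP[u _].
Qed.

Lemma size_words k : size (words k) = (2 ^ k)%N.
Proof. by elim: k => //= k IH; rewrite size_cat !size_map IH expnS; lia. Qed.

Lemma W_S n : W n.+1 = W n ++ words n.
Proof. by rewrite /W -addn1 iotaD map_cat flatten_cat /= cats0 add0n. Qed.

Lemma mem_W n w : (w \in W n) = (size w < n)%N.
Proof.
elim: n => [|n IH]; first by rewrite /W.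
by rewrite W_S mem_cat IH mem_words ltnS [RHS]leq_eqVlt orbC.
Qed.

Lemma uniq_W n : uniq (W n).
Proof.
elim: n => // n IH; rewrite W_S cat_uniq IH uniq_words andbT /=.
by apply/hasPn => w; rewrite mem_words mem_W => /eqP ->; rewrite ltnn.
Qed.

Lemma size_W n : (size (W n)).+1 = (2 ^ n)%N.
Proof. by elim: n => // n IH; rewrite W_S size_cat size_words -addSn IH expnS; lia. Qed.

Lemma big_W n (F : seq bool -> R) :
  \sum_(w <- W n) F w = \sum_(k < n) \sum_(w <- words k) F w.
Proof.
elim: n => [|n IH]; first by rewrite /W big_nil big_ord0.
by rewrite W_S big_cat IH big_ord_recr.
Qed.

Lemma avgE m f : avg m f = 2 ^- m * \sum_(w <- words m) f w.
Proof.
elim: m f => [|m IH] f; first by rewrite /= big_seq1 expr0 invr1 mul1r.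
rewrite /= !IH big_cat /= !big_map exprS invfM; ring.
Qed.

Lemma eq_avg m f g : (forall x, size x = m -> f x = g x) -> avg m f = avg m g.
Proof.
by move=> fg; rewrite !avgE; congr (_ * _); apply: eq_big_seq => x;
  rewrite mem_words => /eqP /fg.
Qed.

Lemma le_avg m f g : (forall x, size x = m -> f x <= g x) -> avg m f <= avg m g.
Proof.
move=> fg; rewrite !avgE ler_wpM2l ?invr_ge0 ?exprn_ge0//.
by rewrite big_seq [leRHS]big_seq; apply: ler_sum => x; rewrite mem_words => /eqP /fg.
Qed.

Lemma avgD m f g : avg m (fun x => f x + g x) = avg m f + avg m g.
Proof. by rewrite !avgE big_split mulrDr. Qed.

Lemma avgZ m (z : R) f : avg m (fun x => z * f x) = z * avg m f.
Proof. by rewrite !avgE -mulr_sumr; ring. Qed.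

Lemma avgB m f g : avg m (fun x => f x - g x) = avg m f - avg m g.
Proof.
by rewrite avgD -[- avg m g]mulN1r -avgZ; congr (_ + _); apply: eq_avg => x _; rewrite mulN1r.
Qed.

Lemma avgZr m (z : R) f : avg m (fun x => f x * z) = avg m f * z.
Proof. by rewrite mulrC -avgZ; apply: eq_avg => x _; rewrite mulrC. Qed.

Lemma avg_cst m (z : R) : avg m (fun=> z) = z.
Proof. elim: m => //= m ->; lra. Qed.

Lemma avg_sum (I : Type) (s : seq I) m (F : I -> seq bool -> R) :
  avg m (fun x => \sum_(i <- s) F i x) = \sum_(i <- s) avg m (F i).
Proof.
rewrite avgE exchange_big /= mulr_sumr; apply: eq_bigr => i _; by rewrite avgE.
Qed.

Lemma avg_step m k f : (k < m)%N ->
  avg m (fun x => f (take k x) * sgnb (nth false x k)) = 0.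
Proof.
elim: m k f => [|m IH] [|k] f //= km.
  rewrite !avg_cst /sgnb; lra.
by rewrite !(IH k (fun s => f (_ :: s)))// addr0 mul0r.
Qed.

Lemma avg_Mt m c : avg m (Mt m c) = 0.
Proof.
rewrite /Mt; under eq_avg do rewrite -(big_mkord xpredT
  (fun k => c (take k _) * sgnb (nth false _ k))).
rewrite avg_sum big_nat big1// => k /andP[_ km]; exact: avg_step.
Qed.

Lemma MtS m c b x : Mt m.+1 c (b :: x) =
  c [::] * sgnb b + Mt m (fun s => c (b :: s)) x.
Proof. by rewrite /Mt big_ord_recl. Qed.

Lemma eq_Mt m c d x : (forall k, (k < m)%N -> c (take k x) = d (take k x)) ->
  Mt m c x = Mt m d x.
Proof. by move=> cd; apply: eq_bigr => k _; rewrite cd. Qed.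

Lemma sum_Hw m c x : (m <= size x)%N -> \sum_(w <- W m) c w * Hw w x = Mt m c x.
Proof.
move=> mx; rewrite big_W; apply: eq_bigr => k _.
have kx : size (take k x) = k by rewrite size_takel// (leq_trans (ltnW (ltn_ord k)) mx).
rewrite (big_rem (take k x)) /=; last by rewrite mem_words kx.
rewrite /Hw kx eqxx big_seq big1 ?addr0// => w.
rewrite mem_rem_uniq ?uniq_words// inE mem_words => /andP[wx /eqP ->].
by rewrite eq_sym (negbTE wx) mulr0.
Qed.

Lemma ipt_S m c d : ipt m.+1 c d = c [::] * d [::] +
  (ipt m (fun s => c (false :: s)) (fun s => d (false :: s))
   + ipt m (fun s => c (true :: s)) (fun s => d (true :: s))) / 2.
Proof. by rewrite /ipt big_ord_recl -big_split mulr_suml. Qed.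

(** The starting values [z], [z'] carry the induction: after the first letter, the same situation
    recurs on each half with shifted values. *)
Lemma avg_MtM m c d (z z' : R) :
  avg m (fun x => (z + Mt m c x) * (z' + Mt m d x)) = z * z' + ipt m c d.
Proof.
elim: m c d z z' => [|m IH] c d z z'.
  by rewrite /= /Mt /ipt !big_ord0 !addr0.
have E b : avg m (fun s => (z + Mt m.+1 c (b :: s)) * (z' + Mt m.+1 d (b :: s))) =
  (z + c [::] * sgnb b) * (z' + d [::] * sgnb b) +
  ipt m (fun s => c (b :: s)) (fun s => d (b :: s)).
  by rewrite -IH; apply: eq_avg => s _; rewrite !MtS !addrA.
rewrite [LHS]/= !E ipt_S /sgnb; by field.
Qed.

Lemma avg_MtM0 m c d : avg m (fun x => Mt m c x * Mt m d x) = ipt m c d.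
Proof.
rewrite -[RHS]add0r -(mul0r 0) -avg_MtM; apply: eq_avg => x _; by rewrite !add0r.
Qed.

Lemma iptE m c d : ipt m c d = \sum_(w <- W m) 2 ^- size w * (c w * d w).
Proof.
rewrite big_W; apply: eq_bigr => k _; rewrite avgE mulr_sumr.
by apply: eq_big_seq => w; rewrite mem_words => /eqP ->.
Qed.

(** Serves to identify the conditional expectation [KY] through its Haar coefficients. *)
Lemma haar_expansion n f x : size x = n ->
  f x = avg n f + Mt n (fun w => 2 ^+ size w * avg n (fun y => f y * Hw w y)) x.
Proof.
elim: n f x => [|n IH] f [|b x] // xn; first by rewrite /Mt big_ord0 addr0.
case: xn => xn /=.
rewrite (IH (fun s => f (b :: s)) x xn) MtS.
rewrite (@eq_Mt n _ (fun w => 2 ^+ size w * avg n (fun s => f (b :: s) * Hw w s)) x); last first.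
  move=> k kn /=; rewrite exprS.
  have E b' : avg n (fun s => f (b' :: s) * Hw (b :: take k x) (b' :: s)) =
     if b' == b then avg n (fun s => f (b :: s) * Hw (take k x) s) else 0.
    case: eqP => [->|bb]; first by apply: eq_avg => s _; rewrite /Hw /= eqseq_cons eqxx.
    rewrite -(avg_cst n 0); apply: eq_avg => s _.
    by rewrite /Hw /= eqseq_cons; case: eqP => //=; rewrite mulr0.
  by rewrite !E; case: b {E} => /=; field.
rewrite addrA; congr (_ + _); rewrite /= expr0 mul1r.
have E b' : avg n (fun s => f (b' :: s) * Hw [::] (b' :: s)) =
  avg n (fun s => f (b' :: s)) * sgnb b'.
  by rewrite -avgZr; apply: eq_avg => s _; rewrite /Hw /= .
by rewrite !E; case: b => /=; rewrite /sgnb; field.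
Qed.

(* Existence of supporting lines: the form of convexity that passes to averages. *)
Definition supline (Psi : R -> R) : Prop :=
  forall x0 : R, exists s, forall x : R, Psi x0 + s * (x - x0) <= Psi x.

Lemma supline_avg (Psi : R -> R) n f : supline Psi ->
  supline (fun z => avg n (fun x => Psi (z + f x))).
Proof.
move=> sPsi z0.
have [s sP] := choice (fun x => sPsi (z0 + f x)).
exists (avg n s) => z; rewrite -avgZr -avgD; apply: le_avg => x _.
by have := sP x (z + f x); rewrite opprD addrACA subrr addr0.
Qed.

Lemma jensen_avg (Psi : R -> R) n f : supline Psi ->
  Psi (avg n f) <= avg n (fun x => Psi (f x)).
Proof.
move=> /(_ (avg n f))[s sP].
rewrite (le_trans _ (le_avg (fun x _ => sP (f x))))//.
by rewrite avgD avgZ avgD !avg_cst subrr mulr0 addr0.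
Qed.

(* The expectation of [Phi (z + \sum_(n <- l) F n X_n)] for independent uniform leaves [X_n]. *)
Fixpoint iterL (F : nat -> seq bool -> R) (l : seq nat) (Phi : R -> R) (z : R) : R :=
  if l is n :: l' then avg n (fun x => iterL F l' Phi (z + F n x)) else Phi z.

Lemma supline_iterL F l (Phi : R -> R) : supline Phi -> supline (iterL F l Phi).
Proof. by move=> sPhi; elim: l => //= n l IH; exact: supline_avg. Qed.

Lemma iterL_cat F l l' Phi z :
  iterL F (l ++ l') Phi z = iterL F l (iterL F l' Phi) z.
Proof. by elim: l z => //= n l IH z; apply: eq_avg => x _. Qed.

(** Variances of independent mean-zero trees add up. *)
Lemma iterL_sqr (c : nat -> seq bool -> R) l z :
  iterL (fun n => Mt n (c n)) l (fun t => t ^+ 2) z =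
  z ^+ 2 + \sum_(n <- l) ipt n (c n) (c n).
Proof.
elim: l z => [|n l IH] z /=; first by rewrite big_nil addr0.
rewrite big_cons; under eq_avg do rewrite IH.
rewrite avgD avg_cst addrA; congr (_ + _).
under eq_avg do rewrite expr2.
by rewrite avg_MtM.
Qed.

End Words.

(** * Burkholder's function and Haar multipliers *)

Section Power.
Variable R : realType.
Implicit Types (x y r p s : R).

(** Young's inequality for the product of [x] and 1 with exponent [r], rearranged. *)
Lemma bernoulli_ge1 x r : 0 <= x -> 1 <= r -> 1 + r * (x - 1) <= x `^ r.
Proof.
move=> x0; rewrite le_eqVlt => /predU1P[<-|r1]; first by rewrite powRr1//; lra.
have r0 : 0 < r by lra.
have q0 : 0 < r / (r - 1) by apply: divr_gt0; lra.
have := @conjugate_powR R x 1 r (r / (r - 1)) x0 ler01 r0 q0.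
rewrite powR1 mulr1 => /(_ _)/wrap[].
  by field; apply/andP; split; apply/eqP; lra.
have -> : 1 / (r / (r - 1)) = 1 - r^-1 by field; apply/andP; split; apply/eqP; lra.
rewrite -(ler_pM2l r0) => h.
have E : r * (x `^ r / r + (1 - r^-1)) = x `^ r + r - 1 by field; apply/eqP; lra.
by lra.
Qed.

Lemma bernoulli_le1 x r : 0 <= x -> 0 <= r <= 1 -> x `^ r <= 1 + r * (x - 1).
Proof.
move=> x0 /andP[]; rewrite le_eqVlt => /predU1P[<- _|r0 r1].
  by rewrite powRr0 mul0r addr0.
have ir : 1 <= r^-1 by rewrite invf_ge1.
have := bernoulli_ge1 (powR_ge0 x r) ir.
rewrite -powRrM mulfV ?gt_eqF// powRr1// -(ler_pM2l r0) => h.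
have E : r * (1 + r^-1 * (x `^ r - 1)) = r + (x `^ r - 1) by field; apply/eqP; lra.
by lra.
Qed.

(** The line is the tangent at [x0]; it stays below by Bernoulli's inequality at |x| / |x0|. *)
Lemma supline_powR p : 1 < p -> supline (fun x : R => `|x| `^ p).
Proof.
move=> p1 x0; pose a := `|x0|.
exists (p * Num.sg x0 * a `^ (p - 1)) => x.
have [->|x0n] := eqVneq x0 0.
  by rewrite sgr0 normr0 powR0 ?gt_eqF ?mulr0 ?mul0r ?addr0 ?powR_ge0//; lra.
have a0 : 0 < a by rewrite normr_gt0.
have := bernoulli_ge1 (divr_ge0 (normr_ge0 x) (ltW a0)) (ltW p1).
rewrite powRM ?invr_ge0 ?(ltW a0)// => h.
have ap : 0 < a `^ p by rewrite powR_gt0.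
have E2 : `|x| `^ p * a^-1 `^ p * a `^ p = `|x| `^ p.
  by rewrite -mulrA -powRM ?invr_ge0 ?(ltW a0)// mulVf ?gt_eqF// powR1 mulr1.
move: h; rewrite -(ler_pM2r ap) E2.
have E : a `^ p = a * a `^ (p - 1) by rewrite mulr_powRB1 ?(ltW a0)//; lra.
have -> : (1 + p * (`|x| / a - 1)) * a `^ p = a `^ p + p * (`|x| - a) * a `^ (p - 1).
  by rewrite E; field; rewrite gt_eqF.
move=> h; apply: le_trans h; rewrite lerD2l.
have -> : p * Num.sg x0 * a `^ (p - 1) * (x - x0) =
  p * (Num.sg x0 * x - a) * a `^ (p - 1) by rewrite /a normrEsg; ring.
rewrite ler_wpM2r ?powR_ge0// ler_pM2l; last lra.
rewrite lerD2r (le_trans (ler_norm _))// normrM normr_sg x0n mul1r//.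
Qed.

(** Combinations of two powers cover both [Fe] and its derivative [dFe]. *)
Lemma pow2_is_derive (A B al be s : R) : 0 < s ->
  is_derive s 1 (fun t : R => A * t `^ al + B * t `^ be)
    (A * al * s `^ (al - 1) + B * be * s `^ (be - 1)).
Proof.
move=> s0.
have D c : is_derive s 1 (fun t : R => t `^ c) (c * s `^ (c - 1)).
  have sI : s \in `]0, +oo[ by rewrite in_itv/= s0.
  apply: DeriveDef; first exact: derivable_powR.
  by rewrite -derive1E powR_derive1.
have := is_deriveD (is_deriveZ A (D al)) (is_deriveZ B (D be)).
by rewrite /GRing.scale /= !mulrA.
Qed.

Lemma pow2_MVT (A B al be s t : R) : 0 < s < t -> exists2 z, s < z < t &
  (A * t `^ al + B * t `^ be) - (A * s `^ al + B * s `^ be) =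
  (A * al * z `^ (al - 1) + B * be * z `^ (be - 1)) * (t - s).
Proof.
move=> /andP[s0 st].
have [||z] := @MVT R (fun t : R => A * t `^ al + B * t `^ be)
  (fun z => A * al * z `^ (al - 1) + B * be * z `^ (be - 1)) s t st.
- by move=> z; rewrite in_itv /= => /andP[sz _]; apply: pow2_is_derive; exact: lt_trans sz.
- apply: derivable_within_continuous => z; rewrite in_itv /= => /andP[sz _].
  have z0 : 0 < z by exact: lt_le_trans sz.
  exact: (@ex_derive _ _ _ _ _ _ _ (pow2_is_derive A B al be z0)).
by rewrite in_itv /= => zI ->; exists z.
Qed.

End Power.

(** * Zigzag concavity of Burkholder's function *)

Section Burkholder.
Variables (R : realType) (p a : R).
Hypotheses (p1 : 1 < p) (a1 : 1 <= a) (hpa : (1 + a) * `|p - 2| <= (a - 1) * p).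

(* In the coordinates [u = x + y], [v = x - y = 1], Burkholder's function is, up to a factor,
   [Fe (-1) u] for [u >= 1], [Fe 1 (- u)] for [u <= -1] and affine in between; [hpa] says
   exactly that the pieces are concave and that the slopes decrease at [1] and [-1]. *)
Definition Fe (e s : R) : R := (1 - a) * s `^ p + e * (1 + a) * s `^ (p - 1).
Definition dFe (e s : R) : R :=
  (1 - a) * p * s `^ (p - 1) + e * (1 + a) * (p - 1) * s `^ (p - 1 - 1).

(** The derivative of [dFe e] at z is (p - 1) z^(p - 3) times (1 - a) p z + e (1 + a)(p - 2), and
    [hpa] makes the second factor nonpositive for z >= 1. *)
Lemma dFe_le e s t : `|e| <= 1 -> 1 <= s <= t -> dFe e t <= dFe e s.
Proof.
move: (p1) (a1) (hpa) => p1' a1' hpa'.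
move=> e1 /andP[s1]; rewrite le_eqVlt => /predU1P[->//|st].
have [|z /andP[sz _]] := @pow2_MVT R ((1 - a) * p) (e * (1 + a) * (p - 1)) (p - 1) (p - 1 - 1) s t.
  by apply/andP; split=> //; lra.
rewrite -/(dFe e t) -/(dFe e s) => E; rewrite -subr_le0 E.
rewrite pmulr_lle0; last lra.
have z1 : 1 < z by lra.
have z0 : 0 < z by lra.
have -> : z `^ (p - 1 - 1) = z * z `^ (p - 1 - 1 - 1).
  rewrite -[X in _ = X * _](powRr1 (ltW z0)) -powRD; first by congr (_ `^ _); ring.
  by rewrite (gt_eqF z0) implybT.
set Z := z `^ (p - 1 - 1 - 1).
have -> : (1 - a) * p * (p - 1) * (z * Z) + e * (1 + a) * (p - 1) * (p - 1 - 1) * Z =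
  (p - 1) * Z * ((1 - a) * p * z + e * (1 + a) * (p - 2)) by ring.
have Z0 : 0 <= (p - 1) * Z by apply: mulr_ge0; [rewrite subr_ge0; exact: ltW|exact: powR_ge0].
apply: mulr_ge0_le0 => //.
have h1 : e * (1 + a) * (p - 2) <= (1 + a) * `|p - 2|.
  rewrite -mulrA mulrCA ler_pM2l; last lra.
  rewrite (le_trans (ler_norm _))// normrM -[leRHS]mul1r ler_wpM2r//.
have h2 : (a - 1) * p <= (a - 1) * p * z.
  by rewrite -[leLHS]mulr1 ler_wpM2l ?(ltW z1)// mulr_ge0//; lra.
have -> : (1 - a) * p * z = - ((a - 1) * p * z) by ring.
lra.
Qed.

Lemma Fe_tangent e s t : `|e| <= 1 -> 1 <= s -> 1 <= t ->
  Fe e t <= Fe e s + dFe e s * (t - s).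
Proof.
move: (p1) (a1) (hpa) => p1' a1' hpa'.
move=> e1 s1 t1.
have [st|ts|->] := ltgtP s t; last by rewrite subrr mulr0 addr0.
  have [|z /andP[sz zt]] := @pow2_MVT R (1 - a) (e * (1 + a)) p (p - 1) s t.
    by apply/andP; split=> //; lra.
  rewrite -/(Fe e t) -/(Fe e s) -/(dFe e z) => E.
  rewrite -lerBlDl E ler_pM2r ?subr_gt0//.
  by apply: dFe_le => //; rewrite s1 ltW.
have [|z /andP[tz zs]] := @pow2_MVT R (1 - a) (e * (1 + a)) p (p - 1) t s.
  by apply/andP; split=> //; lra.
rewrite -/(Fe e t) -/(Fe e s) -/(dFe e z) => E.
have -> : dFe e s * (t - s) = - (dFe e s * (s - t)) by ring.
suff : dFe e s * (s - t) <= dFe e z * (s - t) by lra.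
rewrite ler_pM2r ?subr_gt0//; apply: dFe_le => //; apply/andP; split; lra.
Qed.

(** Burkholder's function for martingale transforms, with [a] in the role of p* - 1. *)
Definition BU (x y : R) : R := (`|y| - a * `|x|) * (`|x| + `|y|) `^ (p - 1).

Lemma BU_scale z x y : BU (z * x) (z * y) = `|z| `^ p * BU x y.
Proof.
move: (p1) (a1) (hpa) => p1' a1' hpa'.
rewrite /BU !normrM -mulrDr powRM ?addr_ge0//.
rewrite -(@mulr_powRB1 _ `|z| p)//; last lra.
ring.
Qed.

Lemma BU_opp x y : BU x (- y) = BU x y.
Proof. by rewrite /BU normrN. Qed.

(** Twice the restriction of [BU] to the line x - y = 1, parametrized by u = x + y. By homogeneity
    it governs every line x - y = v with v nonzero. *)
Let g (u : R) : R := 2 * BU ((u + 1) / 2) ((u - 1) / 2).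

Let g_mid u : -1 <= u <= 1 -> g u = (1 - a) - (1 + a) * u.
Proof.
move: (p1) (a1) (hpa) => p1' a1' hpa'.
move=> /andP[u1 u2]; rewrite /g /BU.
rewrite (ger0_norm (_ : 0 <= (u + 1) / 2)); last lra.
rewrite (ler0_norm (_ : (u - 1) / 2 <= 0)); last lra.
rewrite (_ : (u + 1) / 2 + - ((u - 1) / 2) = 1); last by field.
by rewrite powR1; field.
Qed.

Let g_right u : 1 <= u -> g u = Fe (-1) u.
Proof.
move: (p1) (a1) (hpa) => p1' a1' hpa'.
move=> u1; rewrite /g /BU.
rewrite (ger0_norm (_ : 0 <= (u + 1) / 2)); last lra.
rewrite (ger0_norm (_ : 0 <= (u - 1) / 2)); last lra.
rewrite (_ : (u + 1) / 2 + (u - 1) / 2 = u); last by field.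
rewrite /Fe -(@mulr_powRB1 _ u p); [by field|lra|lra].
Qed.

Let g_left u : u <= -1 -> g u = Fe 1 (- u).
Proof.
move: (p1) (a1) (hpa) => p1' a1' hpa'.
move=> u1; rewrite /g /BU.
rewrite (ler0_norm (_ : (u + 1) / 2 <= 0)); last lra.
rewrite (ler0_norm (_ : (u - 1) / 2 <= 0)); last lra.
rewrite (_ : - ((u + 1) / 2) + - ((u - 1) / 2) = - u); last by field.
rewrite /Fe -(@mulr_powRB1 _ (- u) p); [by field|lra|lra].
Qed.

Let dm : dFe (-1) 1 <= - (1 + a).
Proof.
move: (p1) (a1) (hpa) => p1' a1' hpa'.
rewrite /dFe !powR1 !mulr1.
have := ler_norm (p - 2); have := ler_norm (2 - p); rewrite distrC.
by nra.
Qed.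

Let dp : dFe 1 1 <= 1 + a.
Proof.
move: (p1) (a1) (hpa) => p1' a1' hpa'.
rewrite /dFe !powR1 !mulr1.
have := ler_norm (p - 2); have := ler_norm (2 - p); rewrite distrC.
by nra.
Qed.

Let N1 : `|(-1 : R)| <= 1. Proof. by rewrite normrN1. Qed.
Let P1 : `|(1 : R)| <= 1. Proof. by rewrite normr1. Qed.

Let g_line u : g u <= (1 - a) - (1 + a) * u.
Proof.
move: (p1) (a1) (hpa) => p1' a1' hpa'.
have [u1|u1] := leP u (-1).
  rewrite g_left//; have := @Fe_tangent 1 1 (- u) P1 (lexx _).
  rewrite /Fe !powR1 => /(_ _)/wrap[]; first lra.
  by have := dp; nra.
have [u2|u2] := leP u 1; first by rewrite g_mid// (ltW u1).
rewrite g_right ?(ltW u2)//; have := @Fe_tangent (-1) 1 u N1 (lexx _) (ltW u2).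
by rewrite /Fe !powR1; have := dm; nra.
Qed.

(** Concavity as a line from above at every [u0]. On an outer piece the line is the tangent; beyond
    the joint it is compared with the middle line through [g_line], the slopes being ordered by
    [dFe_le] and [dm] or [dp]. *)
Let g_conc u0 : exists m, forall u, g u <= g u0 + m * (u - u0).
Proof.
move: (p1) (a1) (hpa) => p1' a1' hpa'.
have [u1|u1] := leP u0 (-1).
  exists (- dFe 1 (- u0)) => u.
  have n1 : 1 <= - u0 by lra.
  have le_d : dFe 1 (- u0) <= dFe 1 1 by apply: dFe_le; rewrite ?lexx//; exact: P1.
  have t1 := @Fe_tangent 1 (- u0) 1 P1 n1 (lexx _).
  rewrite (g_left u1).
  have [v1|v1] := leP u (-1).
    rewrite (g_left v1); have := @Fe_tangent 1 (- u0) (- u) P1 n1.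
    by move=> /(_ _)/wrap[]; lra.
  apply: le_trans (g_line u) _; have := dp.
  by move: t1; rewrite {1}/Fe !powR1; nra.
have [u2|u2] := leP u0 1.
  exists (- (1 + a)) => u; rewrite (g_mid (u:=u0)) ?(ltW u1)//.
  by have := g_line u; lra.
exists (dFe (-1) u0) => u.
have le_d : dFe (-1) u0 <= dFe (-1) 1.
  by apply: dFe_le; [exact: N1|rewrite lexx ltW].
have t1 := @Fe_tangent (-1) u0 1 N1 (ltW u2) (lexx _).
rewrite (g_right (ltW u2)).
have [v1|v1] := leP 1 u.
  rewrite (g_right v1); have := @Fe_tangent (-1) u0 u N1 (ltW u2) v1; lra.
apply: le_trans (g_line u) _; have := dm.
by move: t1; rewrite {1}/Fe !powR1; nra.
Qed.

(** If x = y, the function along the diagonal is (1 - a) 2^(p - 1) |t|^p, concave because a >= 1.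
    Otherwise scaling by v = x - y, which the direction (s, s) preserves, reduces the claim to the
    concavity of [g]. *)
Lemma BU_zigzag x y s : BU (x + s) (y + s) + BU (x - s) (y - s) <= 2 * BU x y.
Proof.
move: (p1) (a1) (hpa) => p1' a1' hpa'.
have [<-|xy] := eqVneq x y.
  have E t : BU t t = (1 - a) * 2 `^ (p - 1) * `|t| `^ p.
    rewrite /BU (_ : `|t| + `|t| = 2 * `|t|); last ring.
    rewrite powRM// -(@mulr_powRB1 _ `|t| p)//; last lra.
    ring.
  rewrite !E; have [m mP] := supline_powR p1 x.
  have := mP (x + s); have := mP (x - s).
  have -> : x - s - x = - s by ring.
  have -> : x + s - x = s by ring.
  move=> h1 h2.
  have h : 2 * `|x| `^ p <= `|x + s| `^ p + `|x - s| `^ p by lra.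
  have c0 : (1 - a) * 2 `^ (p - 1) <= 0.
    by rewrite mulr_le0_ge0 ?powR_ge0//; lra.
  rewrite -mulrDr mulrCA; exact: ler_wnM2l.
pose v := x - y.
have v0 : v != 0 by rewrite subr_eq0.
pose u := (x + y) / v; pose t := 2 * s / v.
have E z : BU (x + z * s) (y + z * s) = `|v| `^ p / 2 * g (u + z * t).
  rewrite /g mulrA divfK ?pnatr_eq0// -BU_scale /u /t /v.
  congr BU; field; exact: v0.
have := E 1; have := E (-1); have := E 0.
rewrite !mul0r !addr0 !mul1r !mulN1r => -> -> ->.
have c0 : 0 <= `|v| `^ p / 2 by rewrite divr_ge0 ?powR_ge0.
rewrite -mulrDr mulrCA ler_wpM2l//.
have [m mP] := g_conc u.
by have := mP (u + t); have := mP (u - t); lra.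
Qed.

Lemma BU_zigzag_sign x y s s' : `|s'| = `|s| ->
  BU (x + s) (y + s') + BU (x - s) (y - s') <= 2 * BU x y.
Proof.
move=> /eqP; rewrite eqr_norm2 => /orP[/eqP->|/eqP->]; first exact: BU_zigzag.
by have := BU_zigzag x (- y) s; rewrite BU_opp -!(BU_opp _ (- y + _)) !opprD !opprK.
Qed.

(** Each letter moves (x, y) by plus or minus (s, s') with |s'| = |s|, so [BU] along the pair of
    Haar sums is a supermartingale. *)
Lemma BU_avg n (c d : seq bool -> R) x y :
  (forall w, (size w < n)%N -> `|d w| = `|c w|) ->
  avg n (fun s => BU (x + Mt n c s) (y + Mt n d s)) <= BU x y.
Proof.
elim: n c d x y => [|n IH] c d x y cd; first by rewrite /= /Mt !big_ord0 !addr0.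
have E b : avg n (fun s => BU (x + Mt n.+1 c (b :: s)) (y + Mt n.+1 d (b :: s))) <=
    BU (x + c [::] * sgnb R b) (y + d [::] * sgnb R b).
  apply: le_trans (IH (fun s => c (b :: s)) (fun s => d (b :: s)) _ _ _).
    by rewrite le_eqVlt; apply/orP; left; apply/eqP; apply: eq_avg => s _; rewrite !MtS !addrA.
  by move=> w wn; apply: cd.
rewrite /= ler_pdivrMr// mulrC.
apply: le_trans (lerD (E false) (E true)) _.
rewrite /sgnb !mulr1 !mulrN1; apply: BU_zigzag_sign; exact: cd.
Qed.

End Burkholder.

(** * Majorization of t^p - c^p by Burkholder's function, c = sqrt 2 times the square of p* - 1 *)

Section Majorant.
Variable R : realType.
Implicit Types (p a t x y : R).

Lemma sqrt2_sqr : Num.sqrt 2 ^+ 2 = 2 :> R.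
Proof. by rewrite sqr_sqrtr. Qed.

(** For t >= a, Bernoulli reduces the claim to t^(a - 1) (2 a^2 - t^2) <= c^p: trivial when t^2 >= 2
    a^2, and otherwise t <= c because c^2 = 2 a^4. For t < a both powers are bounded by their values
    at 1 + a, and (1 + a)^(a - 1) <= a^2 c^(a - 1) remains. *)
Lemma majorant_ge2 p t : 2 <= p -> 0 <= t ->
  t `^ p - (Num.sqrt 2 * (p - 1) ^+ 2) `^ p <= 2 * ((t - (p - 1)) * (1 + t) `^ (p - 1)).
Proof.
move=> p2 t0; set a := p - 1; set c := Num.sqrt 2 * a ^+ 2.
have a1 : 1 <= a by rewrite /a; lra.
have s2 := sqrt2_sqr; have s0 : 0 <= Num.sqrt 2 :> R by exact: sqrtr_ge0.
have s1 : 1 <= Num.sqrt 2 :> R by nra.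
have aa : a <= a ^+ 2 by nra.
have c0 : 0 < c by rewrite mulr_gt0 ?exprn_gt0//; lra.
have ppow z : 0 <= z -> z `^ p = z `^ (a - 1) * z ^+ 2.
  move=> z0; rewrite -[z ^+ 2](powR_mulrn 2 z0) -powRD; last first.
    by apply/implyP => /eqP E; exfalso; rewrite /a in E; lra.
  by congr (_ `^ _); rewrite /a; ring.
have apow z : 0 <= z -> z `^ a = z `^ (a - 1) * z.
  by move=> z0; rewrite mulrC mulr_powRB1//; lra.
have csq : c ^+ 2 = 2 * a ^+ 4 by rewrite exprMn s2; ring.
have c1pos : 0 <= c `^ (a - 1) by exact: powR_ge0.
have a4 : 1 <= a ^+ 4 by rewrite exprn_ege1.
have a2 : 1 <= a ^+ 2 by rewrite exprn_ege1.
have a24 : a ^+ 2 <= a ^+ 4 by rewrite ler_weXn2l.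
have [ta|ta] := leP a t.
  have t1 : 1 <= t by lra.
  have tp : 0 < t by lra.
  (* Write (1 + t)^a = t^a (1 + 1/t)^a and bound the last factor below by 1 + a/t. *)
  have Bn : t `^ (a - 1) * (t + a) <= (1 + t) `^ a.
    have E : 1 + t = t * (1 + t^-1) by field; rewrite gt_eqF.
    rewrite E powRM ?(ltW tp)//; last by rewrite addr_ge0// invr_ge0 ltW.
    rewrite (apow _ (ltW tp)) -mulrA ler_wpM2l ?powR_ge0//.
    have := @bernoulli_ge1 R (1 + t^-1) a; move=> /(_ _ a1)/wrap[].
      by rewrite addr_ge0// invr_ge0 ltW.
    move=> h; have E' : t * (1 + a * (1 + t^-1 - 1)) = t + a by field; rewrite gt_eqF.
    by rewrite -E' ler_pM2l.
  have Bm : (t - a) * (t `^ (a - 1) * (t + a)) <= (t - a) * (1 + t) `^ a.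
    by rewrite ler_wpM2l//; lra.
  suff : t `^ (a - 1) * (2 * a ^+ 2 - t ^+ 2) <= c `^ p.
    move=> h; rewrite ppow//; move: Bm h.
    have -> : (t - a) * (t `^ (a - 1) * (t + a)) = t `^ (a - 1) * (t ^+ 2 - a ^+ 2) by ring.
    by set X := t `^ (a - 1); lra.
  have [tt|tt] := leP (2 * a ^+ 2) (t ^+ 2).
    apply: le_trans (powR_ge0 _ _); apply: mulr_ge0_le0; [exact: powR_ge0|lra].
  have tc : t <= c.
    rewrite -(@ler_pXn2r _ 2)// ?nnegrE ?(ltW tp) ?(ltW c0)// csq.
    lra.
  rewrite ppow ?(ltW c0)//; apply: ler_pM; [exact: powR_ge0|lra| |].
    by apply: ge0_ler_powR; rewrite ?nnegrE ?(ltW tp) ?(ltW c0)//; lra.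
  by rewrite csq; have := sqr_ge0 t; lra.
suff : 2 * (a - t) * (1 + t) `^ a + t `^ p <= c `^ p by nra.
have le1 : (1 + t) `^ (a - 1) <= (1 + a) `^ (a - 1).
  by apply: ge0_ler_powR; rewrite ?nnegrE; lra.
have le2 : t `^ (a - 1) <= (1 + a) `^ (a - 1).
  by apply: ge0_ler_powR; rewrite ?nnegrE; lra.
have st1 : 2 * (a - t) * (1 + t) `^ a + t `^ p <= (1 + a) `^ (a - 1) * (2 * a ^+ 2).
  rewrite apow ?ppow//; last lra.
  apply: (@le_trans _ _ ((1 + a) `^ (a - 1) * (2 * (a - t) * (1 + t) + t ^+ 2))).
    rewrite [leRHS]mulrDr; apply: lerD.
      have -> : 2 * (a - t) * ((1 + t) `^ (a - 1) * (1 + t)) =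
        (1 + t) `^ (a - 1) * (2 * (a - t) * (1 + t)) by ring.
      rewrite ler_wpM2r//; apply: mulr_ge0; lra.
    by rewrite ler_wpM2r ?sqr_ge0.
  rewrite ler_wpM2l ?powR_ge0//.
  have : 0 <= (a - t) * (a - 1) by apply: mulr_ge0; lra.
  by have := sqr_ge0 t; nra.
apply: le_trans st1 _; rewrite ppow ?(ltW c0)// csq.
suff : (1 + a) `^ (a - 1) <= a ^+ 2 * c `^ (a - 1).
  move=> h; have -> : c `^ (a - 1) * (2 * a ^+ 4) = (a ^+ 2 * c `^ (a - 1)) * (2 * a ^+ 2).
    by ring.
  by rewrite ler_wpM2r//; lra.
(* Here 1 + a <= 2 a, and 2 a is sqrt 2 / a times c. *)
have le3 : (1 + a) `^ (a - 1) <= (Num.sqrt 2 / a * c) `^ (a - 1).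
  have E : Num.sqrt 2 / a * c = 2 * a.
    rewrite /c -{3}s2; field; rewrite gt_eqF//; lra.
  by rewrite E; apply: ge0_ler_powR; rewrite ?nnegrE; lra.
apply: le_trans le3 _; rewrite powRM ?(ltW c0) ?divr_ge0//; last lra.
rewrite ler_wpM2r//.
have sa0 : 0 <= Num.sqrt 2 / a by rewrite divr_ge0//; lra.
(* It remains to see that (sqrt 2 / a)^(a - 1) <= a^2. For a >= 2 the base is at most 1; for a < 2
   it is at most 2, and 2^(a - 1) <= a by Bernoulli. *)
have [a2'|a2'] := leP 2 a.
  apply: (@le_trans _ _ 1) => //.
  rewrite [leRHS](_ : 1 = 1 `^ (a - 1)); last by rewrite powR1.
  apply: ge0_ler_powR; rewrite ?nnegrE//; first lra.
  by rewrite ler_pdivrMr; nra.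
apply: (@le_trans _ _ (2 `^ (a - 1))).
  apply: ge0_ler_powR; rewrite ?nnegrE//; first lra.
  by rewrite ler_pdivrMr; nra.
have h : 0 <= a - 1 <= 1 by apply/andP; split; lra.
by have := @bernoulli_le1 R 2 (a - 1) (ler0n _ 2) h; nra.
Qed.

End Majorant.

(** * The majorization for p < 2 and the transform inequality *)

Section Multiplier.
Variable R : realType.
Implicit Types (p a t x y : R).

(** For t >= a, replacing 1 + t by t leaves t^(p - 1) (2 a - t) <= t (2 a - t) <= a^2 <= c <= c^p.
    For t < a, Bernoulli makes the left side at most 3 a - 1, which is then compared with c^p. *)
Lemma majorant_lt2 p t (a := (p - 1)^-1) : 1 < p < 2 -> 0 <= t ->
  t `^ p - (Num.sqrt 2 * a ^+ 2) `^ p <= 2 * ((t - a) * (1 + t) `^ (p - 1)).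
Proof.
move=> /andP[p1 p2] t0; have aE : a = (p - 1)^-1 by [].
clearbody a; set c := Num.sqrt 2 * a ^+ 2.
have pa : p - 1 = a^-1 by rewrite aE invrK.
have pm : 0 < p - 1 by lra.
have a1 : 1 < a by rewrite aE invf_gt1//; lra.
have a0 : 0 < a by lra.
have an : a != 0 by rewrite gt_eqF.
have pE : p = 1 + a^-1 by rewrite -pa; ring.
have s2 := sqrt2_sqr R; have s0 : 0 <= Num.sqrt 2 :> R by exact: sqrtr_ge0.
have s1 : 1 <= Num.sqrt 2 :> R by nra.
have a2 : 1 <= a ^+ 2 by rewrite exprn_ege1// ltW.
have c1 : 1 <= c by rewrite /c -[leLHS]mulr1 ler_pM.
have [ta|ta] := leP a t.
  have t1 : 1 <= t by lra.
  have le1 : t `^ (p - 1) <= (1 + t) `^ (p - 1).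
    by apply: ge0_ler_powR; rewrite ?nnegrE; lra.
  suff : t `^ (p - 1) * (2 * a - t) <= c `^ p.
    move=> h; rewrite -(@mulr_powRB1 _ t p)//; last lra.
    have ta' : 0 <= t - a by lra.
    have := ler_wpM2l ta' le1; move: h; set X := t `^ (p - 1); set Y := (1 + t) `^ _; lra.
  have [tt|tt] := leP (2 * a) t.
    apply: le_trans (powR_ge0 _ _); apply: mulr_ge0_le0; [exact: powR_ge0|lra].
  have t2 : t `^ (p - 1) <= t by apply: ler1_powR => //; lra.
  apply: (@le_trans _ _ (t * (2 * a - t))); first by rewrite ler_wpM2r//; lra.
  apply: (@le_trans _ _ c); last by apply: le1r_powR => //; lra.
  apply: (@le_trans _ _ (a ^+ 2)); last by rewrite /c; nra.
  by have := sqr_ge0 (a - t); nra.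
suff : 2 * (a - t) * (1 + t) `^ (p - 1) + t `^ p <= c `^ p by nra.
have le1 : (1 + t) `^ (p - 1) <= 1 + (p - 1) * t.
  have h : 0 <= p - 1 <= 1 by apply/andP; split; lra.
  have h' : 0 <= 1 + t by lra.
  have := bernoulli_le1 h' h.
  by have -> : 1 + t - 1 = t by ring.
have st1 : 2 * (a - t) * (1 + t) `^ (p - 1) <= 2 * a - 2 * t ^+ 2 / a.
  apply: (@le_trans _ _ (2 * (a - t) * (1 + (p - 1) * t))).
    by rewrite ler_wpM2l//; lra.
  rewrite pa le_eqVlt; apply/orP; left; apply/eqP; by field.
(* With z = t / a: a^p <= 2 a and z^p <= z^2 + 1 - p/2, both by Bernoulli, and 2 a (1 - p/2) = a -
   1. The quadratic term is the one that cancels against [st1]. *)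
have st2 : t `^ p <= 2 * t ^+ 2 / a + (a - 1).
  pose z := t / a.
  have z0 : 0 <= z by rewrite divr_ge0// ltW.
  have -> : t = a * z by rewrite /z mulrC divfK.
  rewrite powRM ?(ltW a0)//.
  have ap : a `^ p <= 2 * a.
    rewrite -(@mulr_powRB1 _ a p) ?(ltW a0)//; last lra.
    rewrite mulrC ler_pM2r//.
    have := @bernoulli_le1 R a (p - 1) (ltW a0); move=> /(_ _)/wrap[].
      by apply/andP; split; lra.
    move=> h; apply: le_trans h _.
    have -> : 1 + (p - 1) * (a - 1) = 2 - a^-1 by rewrite pa; field.
    by rewrite lerBlDr lerDl invr_ge0 ltW.
  have zp : z `^ p <= z ^+ 2 + (1 - p / 2).
    have -> : z `^ p = (z ^+ 2) `^ (p / 2).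
      by rewrite -(powR_mulrn 2 z0) -powRrM; congr (_ `^ _); field.
    have := @bernoulli_le1 R (z ^+ 2) (p / 2) (sqr_ge0 _); move=> /(_ _)/wrap[].
      by apply/andP; split; lra.
    by have := sqr_ge0 z; nra.
  apply: (@le_trans _ _ (2 * a * (z ^+ 2 + (1 - p / 2)))).
    by apply: ler_pM => //; exact: powR_ge0.
  rewrite le_eqVlt; apply/orP; left; apply/eqP; rewrite pE; by field.
suff : 3 * a - 1 <= c `^ p by lra.
have cE : c `^ p = 2 `^ (p / 2) * a `^ (2 * p).
  rewrite /c powRM ?sqr_ge0// -(powR12_sqrt (_ : 0 <= 2))// -powRrM -(powR_mulrn 2 (ltW a0)) -powRrM.
  by congr (_ `^ _ * _); ring.
pose b := 1 - p / 2.
have bE : b = (a - 1) / (2 * a) by rewrite /b pE; field.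
have b0 : 0 <= b <= 1 by rewrite /b; apply/andP; split; lra.
(* Divide 2 by 2^b <= 1 + b, where b = 1 - p/2 = (a - 1) / (2 a). *)
have tw : 4 * a / (3 * a - 1) <= 2 `^ (p / 2).
  have h := @bernoulli_le1 R 2 b (ler0n _ 2) b0.
  have E : 2 `^ (p / 2) * 2 `^ b = 2.
    rewrite -powRD ?pnatr_eq0 ?implybT//.
    by rewrite (_ : p / 2 + b = 1) ?powRr1// /b; ring.
  have E2 : 2 = 4 * a / (3 * a - 1) * (1 + b) :> R.
    by rewrite bE; field; apply/andP; split; rewrite gt_eqF//; lra.
  have P0 : 0 < 2 `^ b :> R by exact: powR_gt0.
  rewrite -(ler_pM2r P0) E {2}E2 ler_wpM2l//; last lra.
  by rewrite divr_ge0//; lra.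
rewrite cE.
apply: (@le_trans _ _ (4 * a / (3 * a - 1) * a `^ (2 * p))); last first.
  by rewrite ler_wpM2r ?powR_ge0.
rewrite -mulrA (mulrC (3 * a - 1)^-1) mulrA ler_pdivlMr; last lra.
(* The claim is now (3 a - 1)^2 <= 4 a a^(2 p). For a <= 3, Bernoulli leaves (a - 1)(9 - a) >= 0;
   for a > 3, a^(2 p) >= a^2 is enough. *)
have [a3|a3] := leP a 3.
  have := @bernoulli_ge1 R a (2 * p) (ltW a0); move=> /(_ _)/wrap[]; first lra.
  move=> h; apply: (@le_trans _ _ (4 * a * (1 + 2 * p * (a - 1)))); last first.
    by rewrite ler_wpM2l//; lra.
  have -> : 4 * a * (1 + 2 * p * (a - 1)) = 4 * a + 8 * (a ^+ 2 - 1) by rewrite pE; field.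
  nra.
apply: (@le_trans _ _ (4 * a * a ^+ 2)).
  have h : 0 <= a * a * (a - 3) by apply: mulr_ge0; [apply: mulr_ge0; lra|lra].
  by nra.
rewrite ler_wpM2l//; first lra.
rewrite -(powR_mulrn 2 (ltW a0)); apply: ler_powR; lra.
Qed.

Lemma pstar_ge2 p : 2 <= p -> pstar p = p.
Proof.
move=> p2; rewrite /pstar /conj_exp; apply/max_idPl.
by rewrite ler_pdivrMr; nra.
Qed.

Lemma pstar_lt2 p : 1 < p < 2 -> pstar p - 1 = (p - 1)^-1.
Proof.
move=> /andP[p1 p2]; rewrite /pstar /conj_exp.
rewrite (max_idPr _); last by rewrite ler_pdivlMr; nra.
by field; rewrite gt_eqF//; lra.
Qed.

(* Not the sharp constant [pstar p - 1], but its square is the [2 (p* - 1)^4] of the theorem. *)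
Definition cmul p : R := Num.sqrt 2 * (pstar p - 1) ^+ 2.

Lemma pstar_ge p : 1 < p -> 2 <= pstar p.
Proof.
move=> p1; have [p2|p2] := leP 2 p; first by rewrite pstar_ge2.
have h : 1 < p < 2 by apply/andP.
have := pstar_lt2 h; have : 1 <= (p - 1)^-1 by rewrite invf_ge1; lra.
lra.
Qed.

Lemma cmul_ge1 p : 1 < p -> 1 <= cmul p.
Proof.
move=> /pstar_ge h; have s2 := sqrt2_sqr R; have s0 : 0 <= Num.sqrt 2 :> R by exact: sqrtr_ge0.
have s1 : 1 <= Num.sqrt 2 :> R by nra.
have a2 : 1 <= (pstar p - 1) ^+ 2 by rewrite exprn_ege1//; lra.
rewrite /cmul; nra.
Qed.

(** By homogeneity this is the one-variable inequality in t = |y| / |x|; the case x = 0 says |y|^p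
    <= 2 |y|^p. *)
Lemma BU_majorant p x y : 1 < p ->
  `|y| `^ p - (cmul p) `^ p * `|x| `^ p <= 2 * BU p (pstar p - 1) x y.
Proof.
move=> p1.
have core t : 0 <= t -> t `^ p - cmul p `^ p <=
    2 * ((t - (pstar p - 1)) * (1 + t) `^ (p - 1)).
  move=> t0; have [p2|p2] := leP 2 p.
    by rewrite /cmul pstar_ge2//; exact: majorant_ge2.
  have h : 1 < p < 2 by apply/andP.
  by rewrite /cmul (pstar_lt2 h); exact: majorant_lt2.
have [->|x0] := eqVneq x 0.
  rewrite /BU normr0 powR0 ?gt_eqF//; last lra.
  rewrite !mulr0 subr0 add0r subr0 mulr_powRB1//; last lra.
  by have := powR_ge0 `|y| p; lra.
have xp : 0 < `|x| by rewrite normr_gt0.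
have E : BU p (pstar p - 1) x y = `|x| `^ p *
   ((`|y| / `|x| - (pstar p - 1)) * (1 + `|y| / `|x|) `^ (p - 1)).
  rewrite /BU (_ : `|x| + `|y| = `|x| * (1 + `|y| / `|x|)); last by field; rewrite gt_eqF.
  rewrite powRM; [|exact: ltW|by rewrite addr_ge0// divr_ge0].
  rewrite -(@mulr_powRB1 _ `|x| p)//; last lra.
  by field; rewrite gt_eqF.
have E2 : `|y| `^ p = `|x| `^ p * (`|y| / `|x|) `^ p.
  by rewrite -powRM ?divr_ge0// mulrC divfK// gt_eqF.
rewrite E E2 (mulrC (cmul p `^ p)) -mulrBr mulrCA ler_wpM2l ?powR_ge0//.
by apply: core; rewrite divr_ge0.
Qed.

(** Burkholder's method: majorize under the innermost average, then let [BU] decrease tree by tree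
    down to its value 0 at the origin. *)
Lemma iterL_transform p (c d : nat -> seq bool -> R) l : 1 < p ->
  (forall n w, `|d n w| = `|c n w|) ->
  iterL (fun n => Mt n (d n)) l (fun x => `|x| `^ p) 0 <=
  cmul p `^ p * iterL (fun n => Mt n (c n)) l (fun x => `|x| `^ p) 0.
Proof.
move=> p1 cd; set a := pstar p - 1.
have a1 : 1 <= a by have := pstar_ge p1; rewrite /a; lra.
(* Equality holds: p* - 1 is the least [a] satisfying [hpa]. *)
have hpa : (1 + a) * `|p - 2| <= (a - 1) * p.
  have [p2|p2] := leP 2 p.
    by rewrite /a pstar_ge2// ger0_norm; lra.
  have h : 1 < p < 2 by apply/andP.
  rewrite /a (pstar_lt2 h) ler0_norm; last lra.
  by rewrite le_eqVlt; apply/orP; left; apply/eqP; field; rewrite gt_eqF//; lra.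
suff H x y : iterL (fun n => Mt n (d n)) l (fun x => `|x| `^ p) y -
    cmul p `^ p * iterL (fun n => Mt n (c n)) l (fun x => `|x| `^ p) x
    <= 2 * BU p a x y.
  have := H 0 0; rewrite /BU normr0 mulr0 subrr mul0r mulr0; lra.
elim: l x y => [|n l IH] x y /=; first exact: BU_majorant.
rewrite -avgZ -avgB.
apply: (@le_trans _ _ (avg n (fun s => 2 * BU p a (x + Mt n (c n) s) (y + Mt n (d n) s)))).
  by apply: le_avg => s _; exact: IH.
rewrite avgZ ler_wpM2l//; apply: BU_avg => // w _; exact: cd.
Qed.

End Multiplier.

(** * Block systems *)

Section Blocks.
Variable R : realType.
Variables (beta : seq bool -> seq bool -> R) (kap : seq bool -> nat).
Implicit Types (w x y J : seq bool) (m n k : nat).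

Definition par w := take (size w).-1 w.

(* [J] lies in the support prescribed for the block of [w]: the set where the block of the
   parent of [w] takes the sign of the last bit of [w]. *)
Definition act w J : bool :=
  (w == [::]) || (Mt (size J) (beta (par w)) J == sgnb R (last false w)).

(** The last clause makes the block a signed sum over the nodes of level [kap w] in the prescribed
    support. As the parent's level is smaller, that support is a union of intervals of level
    [kap w]. *)
Definition bok m w : Prop :=
  [/\ (kap w < m)%N, w != [::] -> (kap (par w) < kap w)%N &
      forall J, `|beta w J| = ((size J == kap w) && act w J)%:R].

Lemma par_rcons w b : par (rcons w b) = w.
Proof. by rewrite /par size_rcons -cats1 take_size_cat. Qed.

Lemma Mt_level k M (c : seq bool -> R) x : (forall J, size J != k -> c J = 0) ->
  (M <= size x)%N -> (k < M)%N -> Mt M c x = c (take k x) * sgnb R (nth false x k).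
Proof.
move=> c0 Mx kM; rewrite /Mt (bigD1 (Ordinal kM))//= big1 ?addr0// => i ik.
rewrite c0 ?mul0r// size_takel ?(leq_trans (ltnW (ltn_ord i)))//.
Qed.

Lemma bok0 m w J : bok m w -> size J != kap w -> beta w J = 0.
Proof.
by move=> [_ _ bw] /negbTE Jk; apply/normr0_eq0; rewrite bw Jk.
Qed.

(** A branch meets the block of [w] in one node, [take (kap w) x], and this node already determines
    the value of the parent's block, hence [act w x]. *)
Lemma Mt_norm m w x : size x = m -> (forall k, (k <= size w)%N -> bok m (take k w)) ->
  `|Mt m (beta w) x| = (act w x)%:R.
Proof.
move=> xm bw; have := bw _ (leqnn _); rewrite take_size => okw.
rewrite (Mt_level (fun J => @bok0 m w J okw)) ?xm//; last by case: okw.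
have [km kp kb] := okw.
rewrite normrM normr_sgnb mulr1 kb size_takel ?xm 1?ltnW// eqxx /=.
rewrite /act; case: eqP => //= /eqP w0; congr ((_ == _) : nat)%:R.
have okp : bok m (par w) by apply: bw; exact: leq_pred.
have := kp w0 => kpw.
rewrite size_takel ?xm 1?ltnW//.
have Lp := Mt_level (fun J => @bok0 m _ J okp).
have kx : (kap w <= size (take (kap w) x))%N by rewrite size_takel ?xm// ltnW.
rewrite (Lp _ _ kx kpw) (Lp m x) ?xm//; last exact: ltn_trans km.
by rewrite take_takel ?nth_take// ltnW.
Qed.

Lemma act_rcons w b x :
  act (rcons w b) x = (Mt (size x) (beta w) x == sgnb R b).
Proof. by rewrite /act par_rcons last_rcons; case: w. Qed.

Lemma sgnb_eqN1 (r : R) : `|r| = 1 -> sgnb R (r == -1) = r.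
Proof.
move=> r1; have /orP[/eqP->|/eqP->] : (r == 1) || (r == -1).
- by rewrite -eqr_norm2 r1 normr1.
- by rewrite (_ : _ == _ = false) //; apply/negbTE/eqP => E; lra.
- by rewrite eqxx.
Qed.

(** For signs r and s, the indicator of r = s is (1 + s r) / 2. This is linear in the block, so its
    mean can be computed. *)
Lemma act_half w b x : `|Mt (size x) (beta w) x| = (act w x)%:R ->
  (act (rcons w b) x)%:R =
  ((act w x)%:R + sgnb R b * Mt (size x) (beta w) x) / 2 :> R.
Proof.
rewrite act_rcons; set r := Mt _ _ _; case: (act w x) => /= r1; last first.
  rewrite (normr0_eq0 r1) mulr0 addr0 mul0r.
  by case: eqP => // /esym/eqP; rewrite (negbTE (sgnb_neq0 _ _)).
rewrite -(sgnb_eqN1 r1); set b' := r == -1.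
rewrite sgnb_inj; case: b'; case: b; rewrite /sgnb /=; lra.
Qed.

(** A block has mean zero, so it passes exactly half of its support to each child. *)
Lemma avg_act m w : (forall k, (k < size w)%N -> bok m (take k w)) ->
  avg m (fun x => (act w x)%:R) = 2 ^- size w :> R.
Proof.
elim/last_ind: w => [|w b IH] bw; first by rewrite avg_cst /= expr0 invr1.
have bw' k : (k <= size w)%N -> bok m (take k w).
  move=> kw; have := bw k; rewrite size_rcons ltnS -cats1 takel_cat//; exact.
transitivity (avg m (fun x => ((act w x)%:R + sgnb R b * Mt m (beta w) x) / 2)).
  by apply: eq_avg => x xm; rewrite act_half ?xm// (Mt_norm xm).
rewrite avgZr avgD avgZ avg_Mt mulr0 addr0 IH => [|k kw]; last exact/bw'/ltnW.
by rewrite size_rcons exprS invfM mulrC.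
Qed.

Variables (n m : nat).
Hypothesis sys : forall w, (size w < n)%N -> bok m w.

Let sys_take w k : (size w < n)%N -> (k <= size w)%N -> bok m (take k w).
Proof.
move=> wn kw; apply: sys; rewrite size_takel//; exact: leq_ltn_trans wn.
Qed.

(* The measure-preserving map of trees with [Mt m (beta w) = Hw w \o Yk n]. *)
Fixpoint Yk k x : seq bool :=
  if k is k'.+1 then rcons (Yk k' x) (Mt m (beta (Yk k' x)) x == -1) else [::].

Lemma size_Yk k x : size (Yk k x) = k.
Proof. by elim: k => //= k IH; rewrite size_rcons IH. Qed.

Lemma take_Yk k j x : (k <= j)%N -> take k (Yk j x) = Yk k x.
Proof.
elim: j => [|j IH]; first by rewrite leqn0 => /eqP ->.
rewrite leq_eqVlt => /predU1P[->|kj]; first by rewrite take_oversize// size_Yk.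
by rewrite /= -cats1 takel_cat ?size_Yk// IH.
Qed.

Lemma nth_Yk k j x : (k < j)%N ->
  nth false (Yk j x) k = (Mt m (beta (Yk k x)) x == -1).
Proof.
elim: j => // j IH; rewrite ltnS leq_eqVlt => /predU1P[->|kj].
  by rewrite /= nth_rcons size_Yk ltnn eqxx.
by rewrite /= nth_rcons size_Yk kj IH.
Qed.

Lemma Yk_act w x : (size w <= n)%N -> size x = m -> (Yk (size w) x == w) = act w x.
Proof.
elim/last_ind: w => // w b IH; rewrite size_rcons => wn xm.
have Nw := Mt_norm xm (fun k => @sys_take w k wn).
rewrite act_rcons xm /= eqseq_rcons IH 1?ltnW//.
move: Nw; case Aw: (act w x) => /= Nw.
  have /eqP -> : Yk (size w) x == w by rewrite IH 1?ltnW.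
  by rewrite -{2}(sgnb_eqN1 Nw) sgnb_inj.
move/eqP: Nw; rewrite normr_eq0 => /eqP ->.
by rewrite eq_sym (negbTE (sgnb_neq0 _ _)).
Qed.

Lemma Hw_Yk w x : (size w < n)%N -> size x = m -> Hw R w (Yk n x) = Mt m (beta w) x.
Proof.
move=> wn xm; rewrite /Hw take_Yk 1?ltnW// Yk_act 1?ltnW//.
have Nw := Mt_norm xm (fun k => @sys_take w k wn).
move: Nw; case Aw: (act w x) => /= Nw; last by apply/esym/normr0_eq0.
rewrite nth_Yk//; have /eqP -> : Yk (size w) x == w by rewrite Yk_act// ltnW.
exact: sgnb_eqN1.
Qed.

Lemma avg_Yk_eq y : size y = n -> avg m (fun x => (Yk n x == y)%:R) = 2 ^- n :> R.
Proof.
move=> yn; rewrite -{2}yn -(@avg_act m y); last first.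
  by move=> k; rewrite yn => kn; apply: sys; rewrite size_takel// yn ltnW.
by apply: eq_avg => x xm; rewrite -Yk_act ?yn.
Qed.

Lemma sum_Yk (G : seq bool -> R) x :
  \sum_(y <- words n) (Yk n x == y)%:R * G y = G (Yk n x).
Proof.
rewrite (big_rem (Yk n x)) /=; last by rewrite mem_words size_Yk.
rewrite eqxx mul1r big_seq big1 ?addr0// => y.
by rewrite mem_rem_uniq ?uniq_words// inE eq_sym => /andP[/negbTE-> _]; rewrite mul0r.
Qed.

Lemma avg_Yk (G : seq bool -> R) : avg m (fun x => G (Yk n x)) = avg n G.
Proof.
under eq_avg do rewrite -(sum_Yk G).
rewrite avg_sum [RHS]avgE mulr_sumr; apply: eq_big_seq => y.
by rewrite mem_words => /eqP yn; rewrite avgZr avg_Yk_eq.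
Qed.

(* Conditional expectation on the fibres of [Yk n]. *)
Definition KY (f : seq bool -> R) y : R := 2 ^+ n * avg m (fun x => (Yk n x == y)%:R * f x).

Lemma KY_dual f (G : seq bool -> R) :
  avg n (fun y => KY f y * G y) = avg m (fun x => f x * G (Yk n x)).
Proof.
rewrite avgE; under [RHS]eq_avg do rewrite -(sum_Yk G) mulr_sumr.
rewrite avg_sum mulr_sumr; apply: eq_bigr => y _.
rewrite /KY -mulrA mulKf ?expf_neq0// -avgZr; apply: eq_avg => x _; ring.
Qed.

(** By [KY_dual], pairing [KY f] with [Hw w] means pairing [f] with [Hw w] composed with [Yk n],
    which is the block of [w]. *)
Lemma KYE f y : size y = n -> KY f y =
  avg m f + Mt n (fun w => 2 ^+ size w * avg m (fun x => f x * Mt m (beta w) x)) y.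
Proof.
move=> yn; rewrite (haar_expansion (KY f) yn).
have -> : avg n (KY f) = avg m f.
  transitivity (avg n (fun y => KY f y * 1)); first by apply: eq_avg => z _; rewrite mulr1.
  by rewrite (KY_dual f (fun=> 1)); apply: eq_avg => z _; rewrite mulr1.
congr (_ + _); apply: eq_Mt => k kn; congr (_ * _).
rewrite (KY_dual f (Hw R (take k y))); apply: eq_avg => x xm.
by rewrite Hw_Yk// size_takel// yn ltnW.
Qed.

(** Conditional Jensen: the supporting line at [KY f y] is averaged over the fibre of [y], which has
    mass 2^-n. *)
Lemma jensen_KY (Psi : R -> R) f : supline Psi ->
  avg n (fun y => Psi (KY f y)) <= avg m (fun x => Psi (f x)).
Proof.
move=> sPsi.
apply: (@le_trans _ _ (avg n (KY (fun x => Psi (f x))))); last first.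
  rewrite -(@eq_avg _ n (fun y => KY (fun x => Psi (f x)) y * 1)); last by move=> *; rewrite mulr1.
  by rewrite (KY_dual (fun x => Psi (f x)) (fun=> 1)); under eq_avg do rewrite mulr1.
apply: le_avg => y yn; have [s sP] := sPsi (KY f y).
have n0 : 0 <= 2 ^+ n :> R by rewrite exprn_ge0.
apply: (@le_trans _ _ (2 ^+ n * avg m (fun x => (Yk n x == y)%:R * (Psi (KY f y) + s * (f x - KY f y))))).
  rewrite (@eq_avg _ m _ (fun x => (Yk n x == y)%:R * (Psi (KY f y) - s * KY f y) + s * ((Yk n x == y)%:R * f x))); last by move=> x _; ring.
  rewrite avgD avgZr avgZ avg_Yk_eq// mulrDr mulrA mulfV ?expf_neq0// mul1r mulrCA -/(KY f y).
  by rewrite subrK.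
rewrite ler_wpM2l//; apply: le_avg => x _; by rewrite ler_wpM2l// sP.
Qed.

(** The block sum is the Haar sum composed with the measure-preserving [Yk n]. [Psi] is arbitrary so
    that it can later be the iterated average over the remaining trees. *)
Lemma block_isometry (Psi : R -> R) c :
  avg m (fun x => Psi (Mt m (fun J => \sum_(w <- W n) c w * beta w J) x)) =
  avg n (fun y => Psi (Mt n c y)).
Proof.
rewrite -avg_Yk; apply: eq_avg => x xm; congr Psi.
rewrite -[RHS]sum_Hw ?size_Yk// {1}/Mt.
transitivity (\sum_(w <- W n) c w * Mt m (beta w) x).
  under eq_bigr do rewrite mulr_suml.
  rewrite exchange_big /=; apply: eq_bigr => w _; rewrite /Mt mulr_sumr.
  by apply: eq_bigr => k _; rewrite mulrA.
by apply: eq_big_seq => w; rewrite mem_W => wn; rewrite Hw_Yk.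
Qed.

(** The left-hand Haar sum is [KY] of [Mt m c], read on the small tree; its mean vanishes, and
    conditional Jensen applies. *)
Lemma block_projection (Psi : R -> R) c : supline Psi ->
  avg n (fun y => Psi (Mt n (fun w => 2 ^+ size w * ipt m c (beta w)) y)) <=
  avg m (fun x => Psi (Mt m c x)).
Proof.
move=> sPsi; rewrite (le_trans _ (jensen_KY (Mt m c) sPsi))//.
rewrite le_eqVlt; apply/orP; left; apply/eqP; apply: eq_avg => y yn.
congr Psi; rewrite KYE// avg_Mt add0r; apply: eq_Mt => k _.
by rewrite avg_MtM0.
Qed.

End Blocks.

(** * Selection of almost diagonalizing blocks *)

Section Selection.
Variables (R : realType) (q : nat -> seq bool -> nat -> seq bool -> R) (delta : R).
Implicit Types (w x y J : seq bool) (m n k : nat) (b c : seq bool -> R).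

(** The bilinear form of the matrix [q] on coefficient vectors in the trees [m] and [m']; for the
    matrix of an operator it is a pairing ([QE]). *)
Definition Q m b m' c : R :=
  \sum_(J <- W m) \sum_(J' <- W m') b J * c J' * q m J m' J'.

Definition unit_block b : Prop :=
  (forall J, `|b J| <= 1) /\ exists k, forall J, size J != k -> b J = 0.

(** A block paired with N consecutive levels gives o(N), in either argument. [N0] depends on [e]
    alone, which lets the window length be fixed before the tree. *)
Definition tame : Prop := forall e : R, 0 < e -> exists N0, forall m' b',
  unit_block b' -> forall m c lo N, (N0 <= N)%N -> (forall J, `|c J| <= 1) ->
  (forall J, ~~ (lo <= size J < lo + N)%N -> c J = 0) ->
  `|Q m' b' m c| <= e * N%:R /\ `|Q m c m' b'| <= e * N%:R.

Hypothesis q_tame : tame.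
Hypothesis q_diag : forall m J, (size J < m)%N -> delta * 2 ^- size J <= q m J m J.

Lemma Q_sumr (I : Type) (s : seq I) m b m' (F : I -> seq bool -> R) (a : I -> R) :
  Q m b m' (fun J => \sum_(i <- s) a i * F i J) = \sum_(i <- s) a i * Q m b m' (F i).
Proof.
rewrite /Q; under [RHS]eq_bigr do rewrite mulr_sumr.
rewrite [RHS]exchange_big /=; apply: eq_bigr => J _.
under [RHS]eq_bigr do rewrite mulr_sumr.
rewrite [RHS]exchange_big /=; apply: eq_bigr => J' _.
rewrite mulr_sumr mulr_suml; apply: eq_bigr => i _; ring.
Qed.

Lemma Q_suml (I : Type) (s : seq I) m b m' (F : I -> seq bool -> R) (a : I -> R) :
  Q m' (fun J => \sum_(i <- s) a i * F i J) m b = \sum_(i <- s) a i * Q m' (F i) m b.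
Proof.
rewrite /Q; under [RHS]eq_bigr do rewrite mulr_sumr.
rewrite [RHS]exchange_big /=; apply: eq_bigr => J _.
under [RHS]eq_bigr do rewrite mulr_sumr.
rewrite [RHS]exchange_big /=; apply: eq_bigr => J' _.
rewrite 2!mulr_suml; apply: eq_bigr => i _; ring.
Qed.

(** A new index contributes its diagonal term plus [sg * X], where [X] gathers the cross terms with
    the signs already chosen; [sg] is the sign of [X]. *)
Lemma greedy_signs (T : eqType) (s : seq T) (f : T -> T -> R) : uniq s ->
  exists th : T -> R, (forall t, `|th t| = 1) /\
    \sum_(t <- s) f t t <= \sum_(t <- s) \sum_(t' <- s) th t * th t' * f t t'.
Proof.
elim: s => [|t s IH] /=; first by exists (fun=> 1); split=> [?|]; rewrite ?normr1// !big_nil.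
move=> /andP[ts us]; have [th [th1 thP]] := IH us.
pose X := \sum_(t' <- s) (th t' * f t t' + th t' * f t' t).
pose sg : R := if 0 <= X then 1 else -1.
exists (fun t' => if t' == t then sg else th t'); split.
  by move=> t'; case: eqP => // _; rewrite /sg; case: ifP; rewrite ?normrN normr1.
have sg2 : sg * sg = 1 by rewrite /sg; case: ifP => _; ring.
have sgX : 0 <= sg * X.
  by rewrite /sg; case: ifPn => [h|]; rewrite ?mul1r// -ltNge => /ltW h; lra.
have E t' : t' \in s -> (t' == t) = false.
  by move=> t's; apply/negbTE; apply: contraNneq ts => <-.
rewrite !big_cons !eqxx sg2 mul1r -addrA lerD2l.
have E1 : \sum_(t' <- s) sg * (if t' == t then sg else th t') * f t t' =
    \sum_(t' <- s) sg * (th t' * f t t').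
  by apply: eq_big_seq => t' t's; rewrite E// mulrA.
have E2 : \sum_(t1 <- s) \sum_(t' <- t :: s) (if t1 == t then sg else th t1) *
     (if t' == t then sg else th t') * f t1 t' =
   \sum_(t1 <- s) (sg * (th t1 * f t1 t) + \sum_(t' <- s) th t1 * th t' * f t1 t').
  apply: eq_big_seq => t1 t1s; rewrite big_cons eqxx E//; congr (_ + _); first ring.
  by apply: eq_big_seq => t' t's; rewrite E.
have E3 : \sum_(t' <- s) sg * (th t' * f t t') + \sum_(t' <- s) sg * (th t' * f t' t) = sg * X.
  by rewrite -big_split /= /X mulr_sumr; apply: eq_bigr => t' _; rewrite -mulrDr.
by rewrite E1 E2 big_split /= addrA E3; lra.
Qed.

(** Greedy signs over the nodes of level [k] in [A]: each diagonal entry is at least delta 2^-k, and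
    their number times 2^-k is the measure of [A]. *)
Lemma level_signs m k (A : seq bool -> bool) : (k < m)%N -> exists b,
  (forall J, `|b J| = ((size J == k) && A J)%:R) /\
  delta * avg k (fun J => (A J)%:R) <= Q m b m b.
Proof.
move=> km; pose s := [seq J <- words k | A J].
have [th [th1 thP]] := @greedy_signs _ s (fun J J' => q m J m J') (filter_uniq _ (uniq_words k)).
pose b J := ((size J == k) && A J)%:R * th J.
exists b; split; first by move=> J; rewrite /b normrM th1 mulr1 ger0_norm.
have red (F : seq bool -> R) :
    \sum_(J <- W m) ((size J == k) && A J)%:R * F J = \sum_(J <- s) F J.
  rewrite big_filter [RHS]big_mkcond /= big_W (bigD1 (Ordinal km))//= [X in _ + X]big1 ?addr0.
    apply: eq_big_seq => J; rewrite mem_words => /eqP ->; rewrite eqxx /=.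
    by case: (A J); rewrite ?mul1r ?mul0r.
  move=> i ik; rewrite big_seq big1// => J; rewrite mem_words => /eqP ->.
  by rewrite (_ : _ == _ = false) ?mul0r//; apply/negbTE.
have -> : Q m b m b = \sum_(J <- s) \sum_(J' <- s) th J * th J' * q m J m J'.
  rewrite -red; apply: eq_bigr => J _; rewrite -red mulr_sumr.
  by apply: eq_bigr => J' _; rewrite /b; ring.
apply: le_trans thP; rewrite avgE.
have -> : \sum_(w <- words k) (A w)%:R = \sum_(w <- s) 1 :> R.
  by rewrite big_filter [RHS]big_mkcond; apply: eq_bigr => J _; case: (A J).
rewrite mulrA mulr_sumr big_seq [leRHS]big_seq; apply: ler_sum => J.
rewrite mem_filter mem_words => /andP[_ /eqP Jk].
by rewrite mulr1; have := @q_diag m J; rewrite Jk; exact.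
Qed.

(** Pigeonhole: the candidates of the N levels are added with signs that turn each pairing into its
    modulus. Tameness bounds every such sum by a small multiple of N, so the total is at most e N
    and some level has total at most [e]. *)
Lemma one_block (e : R) r : 0 < e -> exists N, (0 < N)%N /\
  forall (gm : nat -> nat) (gb : nat -> seq bool -> R),
  (forall i, (i < r)%N -> unit_block (gb i)) ->
  forall m lo (A : seq bool -> bool), (lo + N <= m)%N -> exists k b,
  [/\ (lo <= k < lo + N)%N, forall J, `|b J| = ((size J == k) && A J)%:R,
      delta * avg k (fun J => (A J)%:R) <= Q m b m b &
      forall i, (i < r)%N -> `|Q (gm i) (gb i) m b| <= e /\ `|Q m b (gm i) (gb i)| <= e].
Proof.
(* There are [r] constraints, each with a row and a column; [r.+1] keeps the denominator nonzero. *)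
move=> e0; pose e' := e / (2 * r.+1%:R).
have r0 : 0 < 2 * r.+1%:R :> R by rewrite mulr_gt0.
have e'0 : 0 < e' by rewrite divr_gt0.
have [N0 N0P] := q_tame e'0.
have [N [N0N Npos]] : exists N, (N0 <= N)%N /\ (0 < N)%N by exists N0.+1.
exists N; split=> // gm gb ub m lo A loN.
have /choice[b bP] : forall k, exists b, (lo <= k < lo + N)%N ->
    (forall J, `|b J| = ((size J == k) && A J)%:R) /\
    delta * avg k (fun J => (A J)%:R) <= Q m b m b.
  move=> k; have [/andP[k1 k2]|] := boolP (lo <= k < lo + N)%N; last by exists (fun=> 0).
  by have [b bP] := @level_signs m k A (leq_trans k2 loN); exists b.
have b0 k J : (lo <= k < lo + N)%N -> size J != k -> b k J = 0.
  by move=> /bP[h _] /negbTE Jk; apply/normr0_eq0; rewrite h Jk.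
(* The candidates live on distinct levels, so a combination with coefficients in [-1, 1] still has
   all its Haar coefficients in [-1, 1]. *)
have comb (a : nat -> R) (c := fun J => \sum_(i <- iota lo N) a i * b i J) :
   (forall i, `|a i| <= 1) -> (forall J, `|c J| <= 1) /\
   (forall J, ~~ (lo <= size J < lo + N)%N -> c J = 0).
  move=> a1; have cE J : (lo <= size J < lo + N)%N -> c J = a (size J) * b (size J) J.
    move=> Jr; rewrite /c (big_rem (size J)) ?mem_iota//= big_seq big1 ?addr0// => i.
    rewrite mem_rem_uniq ?iota_uniq// inE mem_iota => /andP[iJ ir].
    by rewrite b0 ?mulr0// eq_sym.
  have c0 J : ~~ (lo <= size J < lo + N)%N -> c J = 0.
    move=> Jr; rewrite /c big_seq big1// => i; rewrite mem_iota => ir.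
    by rewrite b0 ?mulr0//; apply: contraNneq Jr => ->.
  split=> // J; have [Jr|Jr] := boolP (lo <= size J < lo + N)%N; last by rewrite c0 ?normr0.
  rewrite cE// normrM -[leRHS]mulr1 ler_pM//.
  by have [-> _] := bP _ Jr; case: (_ && _).
pose sg (z : R) : R := if 0 <= z then 1 else -1.
have sg1 z : `|sg z| <= 1 by rewrite /sg; case: ifP; rewrite ?normrN normr1.
have sgM z : sg z * z = `|z|.
  rewrite /sg; case: ifPn => [h|]; first by rewrite mul1r ger0_norm.
  by rewrite -ltNge => h; rewrite ltr0_norm// mulN1r.
pose S k := \sum_(i < r) (`|Q (gm i) (gb i) m (b k)| + `|Q m (b k) (gm i) (gb i)|).
have sumS : \sum_(k <- iota lo N) S k <= e * N%:R.
  rewrite /S exchange_big /=.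
  apply: (@le_trans _ _ (\sum_(i < r) (2 * e' * N%:R))); last first.
    rewrite sumr_const card_ord -[leLHS]mulr_natl mulrA ler_wpM2r//.
    rewrite /e'; have -> : r%:R * (2 * (e / (2 * r.+1%:R))) = e * (r%:R / r.+1%:R) :> R.
      by field; rewrite nat1r pnatr_eq0.
    by rewrite -[leRHS]mulr1 ler_pM2l// ler_pdivrMr// mul1r ler_nat.
  apply: ler_sum => i _; rewrite big_split /= -mulrA mulrDl mul1r.
  have [c1 c0] := comb (fun k => sg (Q (gm i) (gb i) m (b k))) (fun=> sg1 _).
  have [d1 d0] := comb (fun k => sg (Q m (b k) (gm i) (gb i))) (fun=> sg1 _).
  apply: lerD.
    have [+ _] := N0P (gm i) _ (ub i (ltn_ord i)) m _ lo N N0N c1 c0.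
    rewrite (Q_sumr (iota lo N) (gm i) (gb i) m b) /=.
    rewrite (eq_bigr (fun k => `|Q (gm i) (gb i) m (b k)|)) => [|k _]; last exact: sgM.
    by rewrite ger0_norm// sumr_ge0.
  have [_ +] := N0P (gm i) _ (ub i (ltn_ord i)) m _ lo N N0N d1 d0.
  rewrite (Q_suml (iota lo N) (gm i) (gb i) m b) /=.
  rewrite (eq_bigr (fun k => `|Q m (b k) (gm i) (gb i)|)) => [|k _]; last exact: sgM.
  by rewrite ger0_norm// sumr_ge0.
have [k kr Sk] : exists2 k, k \in iota lo N & S k <= e.
  apply: contrapT => noS.
  have : \sum_(k <- iota lo N) e < \sum_(k <- iota lo N) S k.
    have loI : lo \in iota lo N by rewrite mem_iota leqnn -[X in (X < _)%N]addn0 ltn_add2l.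
    rewrite (big_rem lo)//= [ltRHS](big_rem lo)//=; apply: ltr_leD.
      by rewrite ltNge; apply/negP => h; apply: noS; exists lo.
    rewrite big_seq [leRHS]big_seq; apply: ler_sum => k kI.
    rewrite leNgt; apply/negP => h; apply: noS; exists k; last exact: ltW.
    exact: mem_rem kI.
  rewrite big_const_seq count_predT size_iota iter_addr_0 => h.
  by have := lt_le_trans h sumS; rewrite mulr_natr ltxx.
move: kr; rewrite mem_iota => kr; have [bn bQ] := bP _ kr.
exists k, (b k); split=> // i ir.
have : `|Q (gm i) (gb i) m (b k)| + `|Q m (b k) (gm i) (gb i)| <= e.
  apply: le_trans Sk; rewrite /S (bigD1 (Ordinal ir))//= lerDl.
  by apply: sumr_ge0 => j _; rewrite addr_ge0.
by move=> h; split; apply: le_trans h; rewrite ?lerDl ?lerDr.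
Qed.

Lemma size_nth_W n i j : (i <= j)%N -> (j < size (W n))%N ->
  (size (nth [::] (W n) i) <= size (nth [::] (W n) j))%N.
Proof.
elim: n => [|n IH]; first by rewrite /W.
move=> ij; rewrite W_S size_cat !nth_cat => js.
have [jn|jn] := ltnP j (size (W n)).
  by rewrite (leq_ltn_trans ij jn); apply: IH.
have /eqP -> : size (nth [::] (words n) (j - size (W n))) == n.
  by rewrite -mem_words mem_nth// ltn_subLR.
have [iW|iW] := ltnP i (size (W n)).
  by apply: ltnW; rewrite -mem_W mem_nth.
have /eqP -> // : size (nth [::] (words n) (i - size (W n))) == n.
by rewrite -mem_words mem_nth// ltn_subLR// (leq_ltn_trans ij).
Qed.

Lemma size_par w : w != [::] -> (size (par w) < size w)%N.
Proof. by move=> w0; rewrite /par size_take; case: w w0 => //= b w _; rewrite ltnSn. Qed.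

Lemma unit_block_bok (beta : seq bool -> seq bool -> R) kap m w :
  bok beta kap m w -> unit_block (beta w).
Proof.
move=> okw; split; last by exists (kap w) => J; exact: bok0 okw.
by move=> J; have [_ _ ->] := okw; case: (_ && _).
Qed.

(** The node at position j of the enumeration gets the window of levels from j N to (j + 1) N.
    Parents are enumerated first, so levels increase from parent to child. *)
Lemma one_tree (e : R) n r m0 (gm : nat -> nat) (gb : nat -> seq bool -> R) : 0 < e ->
  (forall i, (i < r)%N -> unit_block (gb i)) ->
  exists m beta kap, (m0 <= m)%N /\ forall w, (size w < n)%N ->
    [/\ bok beta kap m w, delta * 2 ^- size w <= Q m (beta w) m (beta w),
      (forall i, (i < r)%N -> `|Q (gm i) (gb i) m (beta w)| <= e /\
                            `|Q m (beta w) (gm i) (gb i)| <= e) &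
      forall w', (size w' < n)%N -> w' != w -> `|Q m (beta w') m (beta w)| <= e].
Proof.
move=> e0 ub; pose nd := nth [::] (W n); pose s := size (W n).
(* At most [r + s] constraints ever occur: [r] external ones and the earlier blocks of the same
   tree. Hence one [N] serves all nodes and determines the depth [m]. *)
have [N [N0 NP]] := @one_block e (r + s) e0; pose m := (m0 + s * N)%N.
have ndW i : (i < s)%N -> nd i \in W n by move=> ?; exact: mem_nth.
have nd_inj i j : (i < s)%N -> (j < s)%N -> nd i = nd j -> i = j.
  by move=> si sj /eqP; rewrite nth_uniq ?uniq_W// => /eqP.
suff [beta [kap H]] : exists beta kap, forall j, (j < s)%N ->
  [/\ (j * N <= kap (nd j) < j.+1 * N)%N, bok beta kap m (nd j),
     delta * 2 ^- size (nd j) <= Q m (beta (nd j)) m (beta (nd j)),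
     (forall i, (i < r)%N -> `|Q (gm i) (gb i) m (beta (nd j))| <= e /\
                            `|Q m (beta (nd j)) (gm i) (gb i)| <= e) &
     forall i, (i < j)%N -> `|Q m (beta (nd i)) m (beta (nd j))| <= e /\
                           `|Q m (beta (nd j)) m (beta (nd i))| <= e].
  exists m, beta, kap; split; first exact: leq_addr.
  move=> w; rewrite -mem_W => wW.
  have ws : (index w (W n) < s)%N by rewrite index_mem.
  have [] := H _ ws; rewrite /nd nth_index// => _ H1 H2 H3 H4; split=> // w'.
  rewrite -mem_W => w'W w'w.
  have w's : (index w' (W n) < s)%N by rewrite index_mem.
  have [ii|ii|ii] := ltngtP (index w (W n)) (index w' (W n)).
  - by have [_ _ _ _ /(_ _ ii)] := H _ w's; rewrite /nd !nth_index// => -[].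
  - by have := H4 _ ii; rewrite /nd nth_index// => -[].
  - by move: w'w; rewrite -[w'](nth_index [::] w'W) -ii nth_index// eqxx.
suff : forall i, (i <= s)%N -> exists beta kap, forall j, (j < i)%N ->
  [/\ (j * N <= kap (nd j) < j.+1 * N)%N, bok beta kap m (nd j),
     delta * 2 ^- size (nd j) <= Q m (beta (nd j)) m (beta (nd j)),
     (forall i, (i < r)%N -> `|Q (gm i) (gb i) m (beta (nd j))| <= e /\
                            `|Q m (beta (nd j)) (gm i) (gb i)| <= e) &
     forall i, (i < j)%N -> `|Q m (beta (nd i)) m (beta (nd j))| <= e /\
                           `|Q m (beta (nd j)) m (beta (nd i))| <= e].
  by apply.
elim=> [_|i IH si]; first by exists (fun _ _ => 0), (fun=> 0%N).
have [beta [kap H]] := IH (ltnW si).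
pose gm' t := if (t < r)%N then gm t else m.
pose gb' t := if (t < r)%N then gb t else beta (nd (t - r)%N).
(* Slots beyond [r + i], whose blocks are not chosen yet, hold the zero block. *)
have [||k [b [kI bn bQ bG]]] := NP gm' (fun t => if (t < r + i)%N then gb' t else fun=> 0) _
   m (i * N)%N (act beta (nd i)).
- move=> t _; case: ifP => [tri|_]; last first.
    by split; [move=> J; rewrite normr0|exists 0%N].
  rewrite /gb'; case: ltnP => tr; first exact: ub.
  have ti : (t - r < i)%N by rewrite ltn_subLR.
  by have [_ okt _ _ _] := H _ ti; exact: unit_block_bok okt.
- by rewrite -mulSnr (leq_trans _ (leq_addl _ _))// leq_mul2r si orbT.
pose wi := nd i.
have prev w : (size w < size wi)%N -> exists2 j, (j < i)%N & nd j = w.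
  move=> wwi; have wW : w \in W n.
    by rewrite mem_W (ltn_trans wwi)// -mem_W ndW.
  exists (index w (W n)); last by rewrite /nd nth_index.
  rewrite ltnNge; apply/negP => ii.
  have := @size_nth_W n i (index w (W n)) ii; rewrite index_mem => /(_ wW).
  by rewrite nth_index// leqNgt -/(nd i) -/wi wwi.
pose beta' w := if w == wi then b else beta w.
pose kap' w := if w == wi then k else kap w.
have ne j : (j < i)%N -> (nd j == wi) = false.
  move=> ji; apply/eqP => /(nd_inj _ _ (ltn_trans ji si) si) E.
  by move: ji; rewrite E ltnn.
(* Redefining the block at [wi] leaves the supports of the nodes up to position [i] unchanged: their
   parents are strictly shorter than [wi]. *)
have par_ne j : (j <= i)%N -> nd j != [::] -> (par (nd j) == wi) = false.
  move=> ji j0; apply/eqP => E; have := size_par j0; rewrite E ltnNge.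
  by rewrite /wi size_nth_W.
have act' j J : (j <= i)%N -> act beta' (nd j) J = act beta (nd j) J.
  by move=> ji; rewrite /act /beta'; case: eqP => //= /eqP j0; rewrite par_ne.
exists beta', kap' => j; rewrite ltnS leq_eqVlt => /predU1P[->|ji]; last first.
  have [h1 [a1 a2 a3] h3 h4 h5] := H _ ji.
  have Ej : beta' (nd j) = beta (nd j) by rewrite /beta' ne.
  have Kj : kap' (nd j) = kap (nd j) by rewrite /kap' ne.
  rewrite Ej Kj; split=> //.
    split; rewrite ?Kj//; last by move=> J; rewrite Ej a3 act'// ltnW.
    by move=> j0; rewrite /kap' (par_ne _ (ltnW ji) j0); exact: a2.
  by move=> l lj; rewrite /beta' ne ?(ltn_trans lj)//; exact: h5.
have Ei : beta' (nd i) = b by rewrite /beta' eqxx.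
have Ki : kap' (nd i) = k by rewrite /kap' eqxx.
have /andP[k1 k2] := kI.
have kap_lt w : (size w < size wi)%N -> (kap w < k)%N.
  move=> /prev[l li <-]; have [/andP[_ lk] _ _ _ _] := H _ li.
  apply: leq_trans k1; apply: leq_trans lk _; by rewrite leq_mul2r li orbT.
rewrite Ei Ki; split.
- by rewrite k1 mulSnr.
- split; rewrite ?Ki.
  + apply: leq_trans k2 _; rewrite -mulSnr (leq_trans _ (leq_addl _ _))//.
    by rewrite leq_mul2r si orbT.
  + move=> i0; rewrite /kap' (par_ne _ (leqnn _) i0); apply: kap_lt; exact: size_par.
  + by move=> J; rewrite Ei bn act'.
- apply: le_trans bQ; rewrite (@avg_act _ beta kap)// => l lw.
  have tw : (size (take l (nd i)) < size wi)%N by rewrite size_takel// ltnW.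
  have [t ti tE] := prev _ tw; have [_ [a1 a2 a3] _ _ _] := H _ ti.
  by rewrite -tE; split=> //; rewrite tE; exact: kap_lt.
- move=> t tr; have := bG t (leq_trans tr (leq_addr _ _)).
  by rewrite (leq_trans tr (leq_addr _ _)) /gb' /gm' tr.
- move=> t ti; have := bG (r + t)%N; rewrite ltn_add2l (ltn_trans ti si) => /(_ isT).
  rewrite ltn_add2l ti /gb' /gm' ltnNge leq_addr /= addKn /beta' ne//.
Qed.

End Selection.

(** Dependent choice on the whole history; the second hypothesis says that [P n] looks at [f] only
    below [n]. *)
Lemma history_choice (S : Type) (s0 : S) (P : nat -> (nat -> S) -> S -> Prop) :
  (forall n f, exists s, P n f s) ->
  (forall n f g s, (forall j, (j < n)%N -> f j = g j) -> P n f s -> P n g s) ->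
  exists f, forall n, P n f (f n).
Proof.
move=> ex ext; have [c cP] : exists c, forall n f, P n f (c n f).
  have /choice[c cP] : forall nf : nat * (nat -> S), exists s, P nf.1 nf.2 s by case.
  by exists (fun n f => c (n, f)) => n f; exact: (cP (n, f)).
pose F := fix F n := if n is n'.+1 then rcons (F n') (c n' (nth s0 (F n'))) else [::].
have sF n : size (F n) = n by elim: n => //= n IH; rewrite size_rcons IH.
pose f n := nth s0 (F n.+1) n.
have fE n j : (j < n)%N -> nth s0 (F n) j = f j.
  elim: n => // n IH; rewrite ltnS leq_eqVlt => /predU1P[->//|jn].
  by rewrite /= nth_rcons sF jn IH.
exists f => n; apply: (ext n (nth s0 (F n))); first by move=> j; exact: fE.
by rewrite /f /= nth_rcons sF ltnn eqxx; exact: cP.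
Qed.

(** Tree [n] is built against the finitely many blocks of the earlier trees, in a tree deeper than
    all of them. The later tree secures the bound, whence the maximum in [tol (maxn n n')]. *)
Lemma block_selection (R : realType) (q : nat -> seq bool -> nat -> seq bool -> R)
    (delta : R) (tol : nat -> R) :
  tame q -> (forall m J, (size J < m)%N -> delta * 2 ^- size J <= q m J m J) ->
  (forall n, 0 < tol n) ->
  exists (mu : nat -> nat) (beta : nat -> seq bool -> seq bool -> R)
         (kap : nat -> seq bool -> nat),
    [/\ (forall n n', (n < n')%N -> (mu n < mu n')%N),
      forall n w, (size w < n)%N -> bok (beta n) (kap n) (mu n) w,
      forall n w, (size w < n)%N ->
        delta * 2 ^- size w <= Q q (mu n) (beta n w) (mu n) (beta n w) &
      forall n w n' w', (size w < n)%N -> (size w' < n')%N -> (n, w) != (n', w') ->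
        `|Q q (mu n) (beta n w) (mu n') (beta n' w')| <= tol (maxn n n')].
Proof.
move=> tq dq tol0.
pose Sy := (nat * (seq bool -> seq bool -> R) * (seq bool -> nat))%type.
pose Good n (s : Sy) := forall w, (size w < n)%N ->
  [/\ bok s.1.2 s.2 s.1.1 w,
    delta * 2 ^- size w <= Q q s.1.1 (s.1.2 w) s.1.1 (s.1.2 w) &
    forall w', (size w' < n)%N -> w' != w ->
      `|Q q s.1.1 (s.1.2 w') s.1.1 (s.1.2 w)| <= tol n].
pose P n (f : nat -> Sy) (s : Sy) := (forall j, (j < n)%N -> Good j (f j)) ->
  [/\ Good n s, forall j, (j < n)%N -> ((f j).1.1 < s.1.1)%N &
    forall j w w', (j < n)%N -> (size w' < j)%N -> (size w < n)%N ->
    `|Q q (f j).1.1 ((f j).1.2 w') s.1.1 (s.1.2 w)| <= tol n /\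
    `|Q q s.1.1 (s.1.2 w) (f j).1.1 ((f j).1.2 w')| <= tol n].
have [||f fP] := @history_choice Sy (0%N, fun _ _ => 0, fun=> 0%N) P.
- move=> n f; have [gf|ngf] := pselect (forall j, (j < n)%N -> Good j (f j)); last first.
    by exists (0%N, fun _ _ => 0, fun=> 0%N) => /ngf.
  pose L := [seq (j, w) | j <- iota 0 n, w <- W j].
  pose el i := nth (0%N, [::]) L i.
  have elL i : (i < size L)%N -> ((el i).1 < n)%N /\ (size (el i).2 < (el i).1)%N.
    move=> iL; have : el i \in L by exact: mem_nth.
    by case/allpairsPdep => j [w []]; rewrite mem_iota mem_W => jn wj ->.
  pose m0 := (\max_(j < n) (f j).1.1).+1.
  have [i iL|m [beta [kap [m0m H]]]] := @one_tree R q delta tq dq (tol n) n (size L) m0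
    (fun i => (f (el i).1).1.1) (fun i => (f (el i).1).1.2 (el i).2) (tol0 n).
    have [h1 h2] := elL _ iL; have [h _ _] := gf _ h1 _ h2.
    exact: unit_block_bok h.
  exists (m, beta, kap) => _; split=> /=.
  + by move=> w wn; have [h1 h2 _ h4] := H _ wn; split.
  + by move=> j jn; apply: leq_trans m0m; rewrite ltnS (bigD1 (Ordinal jn))//= leq_maxl.
  + move=> j w w' jn w'j wn; have [_ _ h _] := H _ wn.
    have jL : (j, w') \in L.
      by apply/allpairsPdep; exists j, w'; rewrite mem_iota mem_W.
    have := h (index (j, w') L); rewrite index_mem => /(_ jL).
    by rewrite /el nth_index.
- move=> n f g s fg Pf gg; have [|h1 h2 h3] := Pf; first by move=> j jn; rewrite fg//; exact: gg.
  split=> // [j jn|j w w' jn]; first by rewrite -fg//; exact: h2.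
  by rewrite -fg//; exact: h3.
have G n : Good n (f n).
  have [k] := ubnP n; elim: k n => // k IH n nk.
  by have [] := fP n => // j jn; apply: IH; exact: leq_trans jn nk.
have H n := fP n (fun j _ => G j).
exists (fun n => (f n).1.1), (fun n => (f n).1.2), (fun n => (f n).2); split.
- by move=> n n' nn'; have [_ + _] := H n'; apply.
- by move=> n w wn; have [] := G n w wn.
- by move=> n w wn; have [] := G n w wn.
move=> n w n' w' wn wn' ne; have [nn|nn|nn] := ltngtP n n'.
- by have [_ _ /(_ n w' w nn wn wn')[]] := H n'.
- by have [_ _ /(_ n' w w' nn wn' wn)[]] := H n.
rewrite -nn in wn' ne *.
have [_ _ /(_ w wn)] := G n w' wn'; apply; apply: contraNneq ne => ->; exact: eqxx.
Qed.

(** * Completeness of L_p and operators on closed spans *)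

Section Lp.
Context (d : measure_display) (Omega : measurableType d) (R : realType).
Variable P : probability Omega R.
Implicit Types (f g : Omega -> R) (p q : R).

Definition memLp p f : Prop :=
  measurable_fun [set: Omega] f /\ (Lpnorm P p f < +oo)%E.

(** [fine] sends an infinite norm to 0, so [nrm] is meaningful only together with [memLp]. *)
Definition nrm p f : R := fine (Lpnorm P p f).

Definition pairing g f : R := Rintegral P [set: Omega] (fun w => g w * f w).

Lemma nrm_ge0 p f : 0 <= nrm p f.
Proof. by rewrite /nrm fine_ge0// Lnorm_ge0. Qed.

Lemma nrmE p f : memLp p f -> Lpnorm P p f = (nrm p f)%:E.
Proof. by move=> [_ ff]; rewrite /nrm fineK// ge0_fin_numE// Lnorm_ge0. Qed.

Lemma measurable_norm_powR p f : measurable_fun [set: Omega] f ->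
  measurable_fun [set: Omega] (fun w => (`|f w| `^ p)%:E).
Proof.
move=> mf; apply/measurable_EFinP.
apply: (@measurableT_comp _ _ _ _ _ _ (@powR R ^~ p)) => //.
exact: measurableT_comp.
Qed.

Lemma Lpnorm_powR p f : p != 0 ->
  (Lpnorm P p f `^ p = \int[P]_w (`|f w| `^ p)%:E)%E.
Proof. by move=> p0; rewrite /Lpnorm poweR_Lnorm. Qed.

Lemma Lpnorm_le p f (K : R) : 0 < p -> 0 <= K ->
  (\int[P]_w (`|f w| `^ p)%:E <= (K `^ p)%:E)%E -> (Lpnorm P p f <= K%:E)%E.
Proof.
move=> p0 K0; rewrite -Lpnorm_powR ?gt_eqF// => h.
have p'0 : 0 <= p^-1 by rewrite invr_ge0 ltW.
have h1 : (Lpnorm P p f `^ p)%E \in `[0%E, +oo%E] by rewrite in_itv/= leey andbT poweR_ge0.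
have h2 : (K `^ p)%:E \in `[0%E, +oo%E] by rewrite in_itv/= leey andbT lee_fin powR_ge0.
have := gt0_ler_poweR p'0 h1 h2 h.
by rewrite -poweRrM mulfV ?gt_eqF// poweRe1 ?Lnorm_ge0//= -powRrM mulfV ?gt_eqF// powRr1.
Qed.

Lemma memLp_powR p f : 0 < p -> memLp p f ->
  (\int[P]_w (`|f w| `^ p)%:E)%E = (nrm p f `^ p)%:E.
Proof. by move=> p0 mf; rewrite -Lpnorm_powR ?gt_eqF// nrmE. Qed.

Lemma nrm_le p f (K : R) : 0 < p -> 0 <= K -> memLp p f ->
  (\int[P]_w (`|f w| `^ p)%:E <= (K `^ p)%:E)%E -> nrm p f <= K.
Proof. by move=> p0 K0 mf /(Lpnorm_le p0 K0); rewrite nrmE. Qed.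

Lemma memLp_bounded p f (K : R) : 0 < p -> 0 <= K -> measurable_fun [set: Omega] f ->
  (forall w, `|f w| <= K) -> memLp p f /\ nrm p f <= K.
Proof.
move=> p0 K0 mf fK; have h : (Lpnorm P p f <= K%:E)%E.
  apply: Lpnorm_le => //.
  apply: (@le_trans _ _ (\int[P]_w (cst (K `^ p)%:E w)))%E; last first.
    rewrite integral_cst// [X in (_ * X)%E](_ : _ = 1%E) ?mule1//.
    exact: probability_setT.
  apply: ge0_le_integral => [//|w _|||w _].
  - by rewrite lee_fin powR_ge0.
  - exact: measurable_norm_powR.
  - exact: measurable_cst.
  - by rewrite lee_fin ge0_ler_powR ?nnegrE// ltW.
have mLp : memLp p f by split=> //; apply: le_lt_trans h (ltry _).
by split=> //; move: h; rewrite nrmE.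
Qed.

Section Norm.
Variable p : R.
Hypothesis p1 : 1 <= p.
Let p0 : 0 < p. Proof. exact: lt_le_trans ltr01 p1. Qed.

Lemma memLpZ a f : memLp p f ->
  memLp p (fun w => a * f w) /\ nrm p (fun w => a * f w) = `|a| * nrm p f.
Proof.
move=> mf; have E : Lpnorm P p (fun w => a * f w) = (`|a| * nrm p f)%:E.
  have fL : f \in Lfun P p%:E.
    by rewrite inE; apply/andP; split; rewrite inE /=; case: mf.
  have p1' : (1 <= p%:E)%E by rewrite lee_fin.
  have := @LnormZ _ _ _ P p%:E p1' (Lfun_Sub p1' fL) a.
  rewrite Lfun_valP -/(Lpnorm P p f) nrmE// -EFinM => <-.
split; last by rewrite /nrm E.
split; first by apply: measurable_funM => //; case: mf.
by rewrite E ltry.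
Qed.

Lemma memLpD f g : memLp p f -> memLp p g ->
  memLp p (fun w => f w + g w) /\
  nrm p (fun w => f w + g w) <= nrm p f + nrm p g.
Proof.
move=> mf mg.
have h : (Lpnorm P p (fun w => (f w + g w)%R) <= (nrm p f + nrm p g)%:E)%E.
  by rewrite EFinD -!nrmE//; apply: minkowski => //; [case: mf|case: mg].
have mm : memLp p (fun w => f w + g w).
  split; first by apply: measurable_funD; [case: mf|case: mg].
  exact: le_lt_trans h (ltry _).
by split=> //; move: h; rewrite nrmE.
Qed.

Lemma memLpB f g : memLp p f -> memLp p g ->
  memLp p (fun w => f w - g w) /\
  nrm p (fun w => f w - g w) <= nrm p f + nrm p g.
Proof.
move=> mf mg; have [mg' E] := memLpZ (-1) mg.
have EE : (fun w => f w - g w) = (fun w => f w + -1 * g w).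
  by apply/funext => w; rewrite mulN1r.
by have [h1 h2] := memLpD mf mg'; rewrite EE; move: h2; rewrite E normrN1 mul1r.
Qed.

Lemma nrm_distC f g : nrm p (fun w => f w - g w) = nrm p (fun w => g w - f w).
Proof.
rewrite /nrm /Lpnorm -oppe_Lnorm; congr fine; apply: eq_Lnorm => w /=.
by rewrite opprB.
Qed.

Lemma nrm_triangle g f h : memLp p f -> memLp p g -> memLp p h ->
  nrm p (fun w => f w - h w) <= nrm p (fun w => f w - g w) + nrm p (fun w => g w - h w).
Proof.
move=> mf mg mh; have [m1 _] := memLpB mf mg; have [m2 _] := memLpB mg mh.
have [_] := memLpD m1 m2; congr (_ <= _); congr nrm; apply/funext => w; ring.
Qed.

Lemma nrm_eq0_ae f : memLp p f -> nrm p f = 0 -> f = (fun=> 0) %[ae P].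
Proof.
move=> mf n0; have : Lpnorm P p f = 0%E by rewrite nrmE// n0.
have mf' : measurable_fun [set: Omega] (EFin \o f) by apply/measurable_EFinP; case: mf.
have p0' : (0 < p%:E)%E by rewrite lte_fin.
move=> /(Lnorm_eq0_eq0 mf' p0').
by apply: filterS => w /= h _; have := h I; case.
Qed.

Lemma ae_Lpnorm f g : measurable_fun [set: Omega] f -> measurable_fun [set: Omega] g ->
  f = g %[ae P] -> Lpnorm P p f = Lpnorm P p g.
Proof.
move=> mf mg fg; rewrite /Lpnorm unlock; congr (_ `^ _)%E.
apply: ge0_ae_eq_integral => [//|||||].
- exact: (measurable_norm_powR p mf).
- exact: (measurable_norm_powR p mg).
- by move=> w _; exact: poweR_ge0.
- by move=> w _; exact: poweR_ge0.
- by apply: filterS fg => w /= h _; rewrite h.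
Qed.

Lemma nrm_sub_ae f g : memLp p f -> memLp p g -> nrm p (fun w => f w - g w) = 0 ->
  f = g %[ae P].
Proof.
move=> mf mg /(nrm_eq0_ae (proj1 (memLpB mf mg))).
by apply: filterS => w /= h _; apply/eqP; rewrite -subr_eq0; apply/eqP; exact: h.
Qed.

Lemma ae_nrm_sub f g : memLp p f -> memLp p g -> f = g %[ae P] ->
  nrm p (fun w => f w - g w) = 0.
Proof.
move=> mf mg fg; rewrite /nrm.
have -> : Lpnorm P p (fun w => f w - g w) = Lpnorm P p (cst 0).
  apply: ae_Lpnorm; [by have [[]] := memLpB mf mg|exact: measurable_cst|].
  by apply: filterS fg => w /= h _; rewrite h// subrr.
by rewrite /Lpnorm Lnorm0// gt_eqF// lte_fin.
Qed.

Lemma L1_le_Lp f : memLp p f -> (\int[P]_w `|f w|%:E <= (nrm p f)%:E)%E.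
Proof.
move: p1; rewrite le_eqVlt => /predU1P[pe mf|p1' mf].
  by rewrite -nrmE// /Lpnorm -pe Lnorm1.
have q0 : 0 < p / (p - 1) by rewrite divr_gt0// subr_gt0.
have pq : p^-1 + (p / (p - 1))^-1 = 1.
  by rewrite invf_div -{1}(div1r p) -mulrDl subrKC mulfV// gt_eqF.
have := @hoelder _ _ _ P f (cst 1) p (p / (p - 1)) (proj1 mf) (measurable_cst _) p0 q0 pq.
rewrite Lnorm1.
have -> : EFin \o cst 1 = cst 1%E :> (Omega -> \bar R) by [].
rewrite Lnorm_cst1 [X in (X `^ _)%E](_ : _ = 1%E); last exact: probability_setT.
rewrite poweR1r mule1 -/(Lpnorm P p f) nrmE//.
by move=> h; apply: le_trans h; under eq_integral do rewrite /= mulr1.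
Qed.

End Norm.

Lemma cvg_powR p (u : nat -> R) (l : R) : 0 < p -> (forall n, 0 <= u n) ->
  u @ \oo --> l -> (fun n => u n `^ p) @ \oo --> l `^ p.
Proof.
move=> p0 u0 ul.
have l0 : 0 <= l by rewrite -(cvg_lim _ ul)//; apply: limr_ge; [apply/cvg_ex; exists l|exact: nearW].
move: l0; rewrite le_eqVlt => /predU1P[l0|l0].
  rewrite -l0 in ul *; rewrite powR0 ?gt_eqF//.
  apply/cvgrPdist_lt => e e0.
  have e'0 : 0 < e `^ p^-1 by rewrite powR_gt0.
  have /cvgrPdist_lt/(_ _ e'0) := ul.
  apply: filterS => n; rewrite !sub0r !normrN !ger0_norm ?powR_ge0// => h.
  have := gt0_ltr_powR p0 _ _ h; rewrite !nnegrE powR_ge0 u0 -powRrM mulVf ?gt_eqF//.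
  by rewrite powRr1 ?(ltW e0)//; exact.
have lI : l \in `]0, +oo[ by rewrite in_itv/= l0.
have /derivable1_diffP/differentiable_continuous cont := @derivable_powR R 1 p l lI.
exact: (cvg_comp _ _ ul cont).
Qed.

(** The sum of the |f_{k+1} - f_k| has finite integral, hence is finite almost everywhere and forces
    pointwise convergence there. Fatou's lemma passes the Cauchy estimate to the limit. *)
Lemma riesz_fischer p (f : nat -> Omega -> R) : 1 <= p -> (forall k, memLp p (f k)) ->
  (forall k, nrm p (fun w => f k.+1 w - f k w) <= 2 ^- k) ->
  exists2 g, memLp p g & forall k, nrm p (fun w => g w - f k w) <= 2 * 2 ^- k.
Proof.
move=> p1 mf df; have p0 : 0 < p by exact: lt_le_trans ltr01 p1.
have mmf k : measurable_fun [set: Omega] (f k) by case: (mf k).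
have mdf k : memLp p (fun w => f k.+1 w - f k w) by case: (memLpB p1 (mf k.+1) (mf k)).
have cauchy k n : nrm p (fun w => f (k + n)%N w - f k w) <= 2 * 2 ^- k.
  suff : nrm p (fun w => f (k + n)%N w - f k w) <= 2 * 2 ^- k - 2 * 2 ^- (k + n).
    by move=> /le_trans; apply; rewrite gerBl mulr_ge0// invr_ge0 exprn_ge0.
  elim: n => [|n IH].
    rewrite addn0 subrr; have -> : (fun w => f k w - f k w) = cst 0.
      by apply/funext => w; rewrite subrr.
    by rewrite /nrm /Lpnorm Lnorm0 ?gt_eqF.
  apply: le_trans (nrm_triangle p1 (g := f (k + n)%N) (mf _) (mf _) (mf _)) _.
  rewrite addnS; have := df (k + n)%N; move: IH.
  have -> : 2 ^- (k + n).+1 = 2 ^- (k + n) / 2 :> R by rewrite exprS invfM mulrC.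
  by lra.
pose D k w : \bar R := `|f k.+1 w - f k w|%:E.
have mD k : measurable_fun [set: Omega] (D k).
  by apply/measurable_EFinP; apply: measurableT_comp => //; exact: measurable_funB.
have D0 k w : [set: Omega] w -> (0 <= D k w)%E by rewrite lee_fin.
pose G w := (\sum_(0 <= k <oo) D k w)%E.
have mG : measurable_fun [set: Omega] G.
  by apply: ge0_emeasurable_sum => // k w _ _; exact: D0.
have G0 w : (0 <= G w)%E by apply: nneseries_ge0 => k _ _; exact: D0.
have iG : (\int[P]_w G w < +oo)%E.
  rewrite /G integral_nneseries//.
  apply: (@le_lt_trans _ _ (\sum_(0 <= k <oo) (2 ^- k)%:E)%E); last first.
    have E : (fun n => (\sum_(0 <= k < n) (2 ^- k)%:E)%E) =
        EFin \o series (geometric 1 (2^-1 : R)).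
      apply/funext => n /=; rewrite /series /= sumEFin; congr EFin.
      by apply: eq_bigr => k _; rewrite /geometric /= mul1r exprVn.
    rewrite E; have h := @cvg_geometric_series R 1 2^-1.
    have {}h : series (geometric 1 (2^-1 : R)) @ \oo --> (1 / (1 - 2^-1) : R).
      by apply: h; rewrite ger0_norm ?invr_ge0// invf_lt1// ltr1n.
    by rewrite EFin_lim ?ltry//; apply/cvg_ex; exists (1 / (1 - 2^-1)).
  apply: lee_nneseries => k; first by move=> _ _; apply: integral_ge0 => w _; exact: D0.
  move=> _; apply: le_trans (L1_le_Lp p1 (mdf k)) _; by rewrite lee_fin.
have aeG : {ae P, forall w, G w \is a fin_num}.
  have : {ae P, forall w, [set: Omega] w -> G w \is a fin_num}.
    apply: integrable_ae => //; apply/integrableP; split=> //.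
    by under eq_integral do rewrite gee0_abs//.
  by apply: filterS => w; apply.
have cvgf w : G w \is a fin_num -> cvgn (f ^~ w).
  move=> Gw; have cs : cvgn (series (telescope (f ^~ w))).
    apply: normed_cvg; apply: nondecreasing_is_cvgn.
      by apply: nondecreasing_series => k _ _ /=.
    exists (fine (G w)) => _ [n _ <-]; rewrite -lee_fin fineK//.
    rewrite /series /= -sumEFin; apply: nneseries_lim_ge => k _ _; exact: D0.
  have E : f ^~ w = (fun n => f 0%N w + series (telescope (f ^~ w)) n).
    by apply/funext => n; exact: eq_sum_telescope.
  by rewrite E; apply: is_cvgD => //; exact: is_cvg_cst.
(* The upper limit is measurable and defined everywhere; it is the limit wherever [G] is finite. *)
pose F w := limn_esup (fun k => (f k w)%:E).
have mF : measurable_fun [set: Omega] F.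
  by apply: measurable_fun_limn_esup => k; exact/measurable_EFinP.
pose g w := fine (F w).
have mg : measurable_fun [set: Omega] g.
  by apply: measurableT_comp => //; exact: fine_measurable.
have cvgg w : G w \is a fin_num -> f ^~ w @ \oo --> g w.
  move=> /cvgf/cvg_ex[l fl]; have fl' : (fun k => (f k w)%:E) @ \oo --> l%:E.
    by apply: cvg_EFin => //; exact: nearW.
  by rewrite /g /F (cvg_limn_einf_sup fl').2 /=.
have bound k : (Lpnorm P p (fun w => (g w - f k w)%R) <= (2 * 2 ^- k)%:E)%E.
  apply: Lpnorm_le => //.
  pose H n w : \bar R := (`|f (k + n)%N w - f k w| `^ p)%:E.
  have mH n : measurable_fun [set: Omega] (H n).
    by apply: measurable_norm_powR; exact: measurable_funB.
  have H0 n w : [set: Omega] w -> (0 <= H n w)%E by rewrite lee_fin powR_ge0.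
  have -> : (\int[P]_w (`|g w - f k w| `^ p)%:E = \int[P]_w limn_einf (H ^~ w))%E.
    apply: ae_eq_integral => //.
    - by apply: measurable_norm_powR; exact: measurable_funB.
    - rewrite (_ : (fun w => _) = (fun w => - limn_esup (fun n => - H n w))%E); last first.
        apply/funext => w; rewrite -limn_einfN; congr limn_einf.
        by apply/funext => n /=; rewrite opprK.
      apply: measurableT_comp => //; apply: measurable_fun_limn_esup => n.
      exact: measurableT_comp.
    apply: filterS aeG => w Gw _; apply/esym.
    apply: (cvg_limn_einf_sup _).1; apply: cvg_EFin; first exact: nearW.
    have c1 : (fun n => f (k + n)%N w) @ \oo --> g w.
      have := cvgg w Gw; rewrite -(cvg_shiftn k); apply: cvg_trans.
      by apply: near_eq_cvg; near=> n; rewrite addnC.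
    have c2 : (fun n => `|f (k + n)%N w - f k w|) @ \oo --> `|g w - f k w|.
      by apply: cvg_norm; apply: cvgB => //; exact: cvg_cst.
    exact: (cvg_powR p0 _ c2).
  apply: le_trans (fatou P measurableT mH H0) _.
  rewrite limn_einf_lim; apply: lime_le; first exact: is_cvg_einfs.
  apply: nearW => n; apply: (@le_trans _ _ (\int[P]_w H n w)%E).
    by apply: ereal_inf_lbound; exists n => /=.
  have mm : memLp p (fun w => f (k + n)%N w - f k w) by case: (memLpB p1 (mf (k + n)%N) (mf k)).
  rewrite /H memLp_powR// lee_fin ge0_ler_powR ?nnegrE ?nrm_ge0 ?cauchy ?(ltW p0)//.
have mgk k : memLp p (fun w => g w - f k w).
  by split; [exact: measurable_funB|exact: le_lt_trans (bound k) (ltry _)].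
exists g; last by move=> k; have := bound k; rewrite nrmE.
have [h _] := memLpD p1 (mgk 0%N) (mf 0%N).
by rewrite (_ : g = fun w => g w - f 0%N w + f 0%N w)//; apply/funext => w; rewrite subrK.
Unshelve. all: by end_near.
Qed.

End Lp.

(** * Bounded operators on the closed span of a family *)

Section ClosedSpan.
Context (d : measure_display) (Omega : measurableType d) (R : realType).
Variables (P : probability Omega R) (p : R).
Hypothesis p1 : 1 <= p.
Implicit Types (f g u v : Omega -> R) (e y : nat -> seq bool -> Omega -> R)
  (c : nat -> seq bool -> R) (N n : nat).

Local Notation nrm := (nrm P p).
Local Notation mem := (memLp P p).

(** The family is a parameter, so that [sp e N c] and [sp y N c] are a vector and its image under
    [e] to [y]. *)
Definition sp e N c : Omega -> R :=
  fun om => \sum_(n < N) \sum_(w <- W n) c n w * e n w om.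

Definition cspan e : set (Omega -> R) := [set f | mem f /\
  forall eps, 0 < eps -> exists N c, nrm (fun w => f w - sp e N c w) < eps].

Lemma mem0 : mem (fun=> 0) /\ nrm (fun=> 0) = 0.
Proof.
have p0 : 0 < p by apply: lt_le_trans p1.
have [h h'] : mem (fun=> 0) /\ nrm (fun=> 0) <= 0.
  by apply: memLp_bounded => // w; rewrite normr0.
by split=> //; apply/eqP; rewrite eq_le h' nrm_ge0.
Qed.

Lemma mem_lin a f g : mem f -> mem g -> mem (fun w => a * f w + g w).
Proof. by move=> mf mg; have [h _] := memLpZ p1 a mf; have [] := memLpD p1 h mg. Qed.

Lemma nrm_lin a f g : mem f -> mem g ->
  nrm (fun w => a * f w + g w) <= `|a| * nrm f + nrm g.
Proof.
by move=> mf mg; have [h <-] := memLpZ p1 a mf; have [_] := memLpD p1 h mg.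
Qed.

Lemma nrm_lin_sub a f g f' g' : mem f -> mem g -> mem f' -> mem g' ->
  nrm (fun w => (a * f w + g w) - (a * f' w + g' w)) <=
  `|a| * nrm (fun w => f w - f' w) + nrm (fun w => g w - g' w).
Proof.
move=> mf mg mf' mg'.
have [m1 _] := memLpB p1 mf mf'; have [m2 _] := memLpB p1 mg mg'.
have := nrm_lin a m1 m2; congr (_ <= _); congr nrm; apply/funext => w; ring.
Qed.

Lemma nrm_le_sub f g : mem f -> mem g -> nrm f <= nrm (fun w => f w - g w) + nrm g.
Proof.
move=> mf mg; have [m1 _] := memLpB p1 mf mg; have [_] := memLpD p1 m1 mg.
by congr (_ <= _); congr nrm; apply/funext => w; rewrite subrK.
Qed.

Lemma nrm_subself f : nrm (fun w => f w - f w) = 0.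
Proof.
by have [_ h] := mem0; rewrite -[RHS]h; congr nrm; apply/funext => w; rewrite subrr.
Qed.

Lemma sp_widen N c M e : (N <= M)%N ->
  sp e N c = sp e M (fun n w => (n < N)%N%:R * c n w).
Proof.
move=> NM; apply/funext => om; rewrite /sp (big_ord_widen M (fun n => \sum_(w <- W n) c n w * e n w om) NM).
rewrite big_mkcond /=; apply: eq_bigr => n _; case: ifP => _.
  by apply: eq_bigr => w _; rewrite mul1r.
by rewrite big1// => w _; rewrite !mul0r.
Qed.

Lemma sp_lin_ex a N c N' c' : exists M c'', forall e,
  (fun w => a * sp e N c w + sp e N' c' w) = sp e M c''.
Proof.
exists (maxn N N'), (fun n w => a * ((n < N)%N%:R * c n w) + (n < N')%N%:R * c' n w) => e.
rewrite (sp_widen c e (leq_maxl N N')) (sp_widen c' e (leq_maxr N N')).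
apply/funext => om; rewrite /sp mulr_sumr -big_split; apply: eq_bigr => n _ /=.
rewrite mulr_sumr -big_split; apply: eq_bigr => w _ /=; ring.
Qed.

Lemma sp_sub_ex N c N' c' : exists M c'', forall e,
  (fun w => sp e N c w - sp e N' c' w) = sp e M c''.
Proof.
have [M [c'' H]] := sp_lin_ex (-1) N' c' N c; exists M, c'' => e.
by rewrite -H; apply/funext => w; ring.
Qed.

Lemma sp_mem e N c : (forall n w, (size w < n)%N -> mem (e n w)) -> mem (sp e N c).
Proof.
move=> me; have [z _] := mem0.
have H (s : seq (seq bool)) n : all (fun w => size w < n)%N s ->
    mem (fun om => \sum_(w <- s) c n w * e n w om).
  elim: s => [_|w s IH /= /andP[wn sn]].
    by rewrite (_ : (fun _ => _) = fun=> 0)//; apply/funext => om; rewrite big_nil.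
  rewrite (_ : (fun _ => _) = fun om => c n w * e n w om + \sum_(w <- s) c n w * e n w om).
    by apply: mem_lin; [exact: me|exact: IH].
  by apply/funext => om; rewrite big_cons.
elim: N => [|N IH]; rewrite /sp.
  by rewrite (_ : (fun _ => _) = fun=> 0)//; apply/funext => om; rewrite big_ord0.
rewrite (_ : (fun _ => _) = fun om => 1 * sp e N c om + \sum_(w <- W N) c N w * e N w om).
  apply: mem_lin => //; apply: H; apply/allP => w; by rewrite mem_W.
by apply/funext => om; rewrite big_ord_recr mul1r.
Qed.

Lemma sp_single e n w (a : R) : (size w < n)%N ->
  (fun om => a * e n w om) = sp e n.+1 (fun n' w' => ((n' == n) && (w' == w))%:R * a).
Proof.
move=> wn; apply/funext => om; rewrite /sp big_ord_recr /= big1 ?add0r.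
  rewrite (big_rem w) ?mem_W//= !eqxx mul1r big_seq big1 ?addr0// => w'.
  by rewrite mem_rem_uniq ?uniq_W// inE => /andP[/negbTE-> _]; rewrite !mul0r.
by move=> i _; rewrite big1// => w' _; rewrite (ltn_eqF (ltn_ord i)) !mul0r.
Qed.

Variable e : nat -> seq bool -> Omega -> R.
Hypothesis me : forall n w, (size w < n)%N -> mem (e n w).
Local Notation X := (cspan e).

Let ms N c := @sp_mem e N c me.

Lemma cspan_mem f : X f -> mem f. Proof. by case. Qed.

Lemma cspan_sp N c : X (sp e N c).
Proof. by split; [exact: ms|move=> eps e0; exists N, c; rewrite nrm_subself]. Qed.

Lemma cspan_e n w : (size w < n)%N -> X (e n w).
Proof.
move=> wn; have := cspan_sp n.+1 (fun n' w' => ((n' == n) && (w' == w))%:R * 1).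
by rewrite -sp_single//; congr cspan; apply/funext => om; rewrite mul1r.
Qed.

Lemma cspan_lin a f g : X f -> X g -> X (fun w => a * f w + g w).
Proof.
move=> [mf af] [mg ag]; split; first exact: mem_lin.
move=> eps e0; pose e1 := eps / (2 * (`|a| + 1)).
have a0 : 0 < `|a| + 1 by rewrite ltr_wpDl.
have e10 : 0 < e1 by rewrite divr_gt0// mulr_gt0.
have [N [c H]] := af _ e10; have [N' [c' H']] := ag (eps / 2) (divr_gt0 e0 (ltr0n _ 2)).
have [M [c'' E]] := sp_lin_ex a N c N' c'; exists M, c''; rewrite -E.
apply: le_lt_trans (nrm_lin_sub a mf mg (ms N c) (ms N' c')) _.
have h1 : `|a| * nrm (fun w => f w - sp e N c w) <= eps / 2.
  have -> : eps / 2 = (`|a| + 1) * e1 by rewrite /e1; field; rewrite gt_eqF.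
  by apply: ler_pM => //; [exact: nrm_ge0|rewrite lerDl|exact: ltW].
lra.
Qed.

Lemma cspan_sub f g : X f -> X g -> X (fun w => f w - g w).
Proof.
move=> Xf Xg; have := cspan_lin (-1) Xg Xf; congr cspan.
by apply/funext => w; ring.
Qed.

Lemma cspan0 : X (fun=> 0).
Proof.
have := cspan_sp 0 (fun _ _ => 0); congr cspan.
by apply/funext => w; rewrite /sp big_ord0.
Qed.

Lemma cspan_closed g : mem g ->
  (forall eps, 0 < eps -> exists2 f, X f & nrm (fun w => g w - f w) < eps) -> X g.
Proof.
move=> mg H; split=> // eps e0; have e2 : 0 < eps / 2 by lra.
have [f [mf af] gf] := H _ e2; have [N [c fc]] := af _ e2; exists N, c.
apply: le_lt_trans (nrm_triangle p1 (g := f) mg mf (ms N c)) _; lra.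
Qed.

Lemma half_pow_lt (eps : R) : 0 < eps -> exists k : nat, 2 * 2 ^- k < eps.
Proof.
move=> e0; have e2 : 0 < eps / 2 by lra.
have [k kP] := ltr_add_invr e2; exists k.
have h : 2 ^- k <= k.+1%:R^-1 :> R.
  by rewrite lef_pV2 ?posrE ?exprn_gt0// -natrX ler_nat ltn_expl.
by rewrite add0r in kP; have := le_lt_trans h kP; lra.
Qed.

Lemma cspan_complete (u : nat -> Omega -> R) : (forall k, X (u k)) ->
  (forall k, nrm (fun w => u k.+1 w - u k w) <= 2 ^- k) ->
  exists2 g, X g & forall k, nrm (fun w => g w - u k w) <= 2 * 2 ^- k.
Proof.
move=> Xu du; have [g mg gu] := riesz_fischer p1 (fun k => cspan_mem (Xu k)) du.
exists g => //; apply: cspan_closed => // eps /half_pow_lt[k kP].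
by exists (u k) => //; exact: le_lt_trans (gu k) kP.
Qed.

Section Operator.
Variables (T : (Omega -> R) -> Omega -> R) (C : R).
Hypothesis bT : bounded_op P p X T C.

Lemma op_C0 : 0 <= C. Proof. by case: bT. Qed.

Lemma op_X f : X f -> X (T f). Proof. by case: bT => _ + _ _; apply. Qed.

Lemma op_bound f : X f -> nrm (T f) <= C * nrm f.
Proof.
move=> Xf; case: bT => _ _ _ /(_ f Xf).
by rewrite (nrmE (cspan_mem Xf)) (nrmE (cspan_mem (op_X Xf))) -EFinM lee_fin.
Qed.

(** Almost-everywhere linearity as a vanishing norm, the form that combines with triangle
    inequalities. *)
Lemma op_lin a f g : X f -> X g ->
  nrm (fun w => T (fun w => a * f w + g w) w - (a * T f w + T g w)) = 0.
Proof.
move=> Xf Xg; apply: ae_nrm_sub => //.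
- exact/cspan_mem/op_X/cspan_lin.
- by apply: mem_lin; exact/cspan_mem/op_X.
- by case: bT => _ _ /(_ a f g Xf Xg).
Qed.

Lemma op_sub f g : X f -> X g -> nrm (fun w => T f w - T g w) <= C * nrm (fun w => f w - g w).
Proof.
move=> Xf Xg; have := op_lin (-1) Xg Xf => E.
have EE : (fun w => -1 * g w + f w) = (fun w => f w - g w).
  by apply/funext => w; ring.
rewrite EE in E; have b := op_bound (cspan_sub Xf Xg).
have E2 : (fun w => T f w - T g w) = (fun w => -1 * T g w + T f w).
  by apply/funext => w; ring.
rewrite E2; have m1 := cspan_mem (op_X (cspan_sub Xf Xg)).
have m2 := cspan_mem (cspan_lin (-1) (op_X Xg) (op_X Xf)).
have := nrm_le_sub m2 m1; rewrite nrm_distC E; lra.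
Qed.

Lemma op_eq0 f g : X f -> X g -> nrm (fun w => f w - g w) = 0 ->
  nrm (fun w => T f w - T g w) = 0.
Proof.
move=> Xf Xg E; apply/eqP; rewrite eq_le nrm_ge0 andbT.
by have := op_sub Xf Xg; rewrite E mulr0.
Qed.

Lemma op_lin_approx a f g u v : X f -> X g -> X u -> X v ->
  nrm (fun w => T f w - u w) = 0 -> nrm (fun w => T g w - v w) = 0 ->
  nrm (fun w => T (fun w => a * f w + g w) w - (a * u w + v w)) = 0.
Proof.
move=> Xf Xg Xu Xv E1 E2; apply/eqP; rewrite eq_le nrm_ge0 andbT.
have mTf := cspan_mem (op_X Xf); have mTg := cspan_mem (op_X Xg).
have mL := cspan_mem (op_X (cspan_lin a Xf Xg)).
have mu := cspan_mem Xu; have mv := cspan_mem Xv.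
apply: le_trans (nrm_triangle p1 (g := fun w => a * T f w + T g w) mL _ _) _.
- exact: mem_lin.
- exact: mem_lin.
rewrite op_lin// add0r; apply: le_trans (nrm_lin_sub a mTf mTg mu mv) _.
by rewrite E1 E2 mulr0 addr0.
Qed.

Lemma op_sp (y : nat -> seq bool -> Omega -> R) N c :
  (forall n w, (size w < n)%N -> X (y n w)) ->
  (forall n w, (size w < n)%N -> nrm (fun om => T (e n w) om - y n w om) = 0) ->
  X (sp y N c) /\ nrm (fun om => T (sp e N c) om - sp y N c om) = 0.
Proof.
move=> Xy Ty.
have T0 : nrm (fun w => T (fun=> 0) w - 0) = 0.
  have h : nrm (T (fun=> 0)) <= 0.
    by have := op_bound cspan0; rewrite (proj2 mem0) mulr0.
  apply/eqP; rewrite eq_le nrm_ge0 andbT; apply: le_trans h.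
  by rewrite le_eqVlt; apply/orP; left; apply/eqP; congr nrm; apply/funext => w; rewrite subr0.
have H (s : seq (seq bool)) n : all (fun w => size w < n)%N s ->
    [/\ X (fun om => \sum_(w <- s) c n w * e n w om),
     X (fun om => \sum_(w <- s) c n w * y n w om) &
     nrm (fun om => T (fun om => \sum_(w <- s) c n w * e n w om) om -
                   \sum_(w <- s) c n w * y n w om) = 0].
  elim: s => [_|w s IH /= /andP[wn sn]].
    have E e' : (fun om => \sum_(w <- [::]) c n w * e' n w om) = fun=> 0 :> R.
      by apply/funext => om; rewrite big_nil.
    split; rewrite ?E; [exact: cspan0|exact: cspan0|].
    by rewrite -[RHS]T0; congr nrm; apply/funext => om; rewrite big_nil.
  have E e' : (fun om => \sum_(w' <- w :: s) c n w' * e' n w' om) =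
      fun om => c n w * e' n w om + \sum_(w' <- s) c n w' * e' n w' om.
    by apply/funext => om; rewrite big_cons.
  have [h1 h2 h3] := IH sn.
  split; rewrite ?E; [by apply: cspan_lin => //; exact: cspan_e|by apply: cspan_lin => //; exact: Xy|].
  rewrite -[RHS](op_lin_approx (c n w) (cspan_e wn) h1 (Xy _ _ wn) h2 (Ty _ _ wn) h3).
  by congr nrm; apply/funext => om; rewrite big_cons.
elim: N => [|N [IH1 IH2]].
  have E e' : sp e' 0 c = fun=> 0 by apply/funext => om; rewrite /sp big_ord0.
  by rewrite !E; split=> //; exact: cspan0.
have E e' : sp e' N.+1 c = fun om => 1 * sp e' N c om + \sum_(w <- W N) c N w * e' N w om.
  by apply/funext => om; rewrite /sp big_ord_recr mul1r.
have [|h1 h2 h3] := H (W N) N; first by apply/allP => w; rewrite mem_W.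
rewrite !E; split; first exact: cspan_lin.
exact: (op_lin_approx 1 (cspan_sp N c) h1 IH1 h2 IH2 h3).
Qed.

End Operator.

(** Extension by density. Completeness yields a value for each [f]; the bound [K] passes to limits
    and, with linearity, makes the value unique almost everywhere. *)
Lemma extend_op (y : nat -> seq bool -> Omega -> R) (K : R) : 0 <= K ->
  (forall n w, (size w < n)%N -> X (y n w)) ->
  (forall N c, nrm (sp y N c) <= K * nrm (sp e N c)) ->
  exists S, bounded_op P p X S K /\
    forall n w, (size w < n)%N -> nrm (fun om => S (e n w) om - y n w om) = 0.
Proof.
move=> K0 Xy yK.
have my n w (wn : (size w < n)%N) := cspan_mem (Xy n w wn).
have mys N c : mem (sp y N c) by exact: sp_mem.
have Xys N c : X (sp y N c).
  have H (s : seq (seq bool)) n : all (fun w => size w < n)%N s ->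
      X (fun om => \sum_(w <- s) c n w * y n w om).
    elim: s => [_|w s IH /= /andP[wn sn]].
      rewrite (_ : (fun _ => _) = fun=> 0); first exact: cspan0.
      by apply/funext => om; rewrite big_nil.
    rewrite (_ : (fun _ => _) = fun om => c n w * y n w om + \sum_(w <- s) c n w * y n w om).
      by apply: cspan_lin; [exact: Xy|exact: IH].
    by apply/funext => om; rewrite big_cons.
  elim: N => [|N IH].
    rewrite (_ : sp y 0 c = fun=> 0); first exact: cspan0.
    by apply/funext => om; rewrite /sp big_ord0.
  rewrite (_ : sp y N.+1 c = fun om => 1 * sp y N c om + \sum_(w <- W N) c N w * y N w om).
    by apply: cspan_lin => //; apply: H; apply/allP => w; rewrite mem_W.
  by apply/funext => om; rewrite /sp big_ord_recr mul1r.
(* The closure of the graph of [sp e N c] to [sp y N c]. As a relation, it does not presuppose that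
   a sum determines its coefficients. *)
pose Graph f u := X u /\ forall eps, 0 < eps -> exists N c,
  nrm (fun w => f w - sp e N c w) < eps /\ nrm (fun w => u w - sp y N c w) < eps.
have K1 : 0 < K + 1 by lra.
have Gex f : X f -> exists u, Graph f u.
  move=> Xf; have mf := cspan_mem Xf.
  (* Small enough that the images of consecutive approximants differ by at most 2^-k, as
     [cspan_complete] requires. *)
  pose eta k : R := 2 ^- k / (4 * (K + 1)).
  have eta0 k : 0 < eta k by rewrite divr_gt0 ?invr_gt0 ?exprn_gt0// mulr_gt0.
  have /choice[Nc NcP] : forall k, exists Nc : nat * (nat -> seq bool -> R),
      nrm (fun w => f w - sp e Nc.1 Nc.2 w) < eta k.
    by move=> k; have [_ /(_ _ (eta0 k))[N [c H]]] := Xf; exists (N, c).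
  have [||u Xu uP] := @cspan_complete (fun k => sp y (Nc k).1 (Nc k).2).
  - by move=> k; exact: Xys.
  - move=> k; have [M [c'' E]] := sp_sub_ex (Nc k.+1).1 (Nc k.+1).2 (Nc k).1 (Nc k).2.
    rewrite E; apply: le_trans (yK M c'') _; rewrite -E.
    have h : nrm (fun w => sp e (Nc k.+1).1 (Nc k.+1).2 w - sp e (Nc k).1 (Nc k).2 w) <= 2 * eta k.
      apply: le_trans (nrm_triangle p1 (g := f) (ms _ _) mf (ms _ _)) _.
      rewrite nrm_distC; have := NcP k.+1; have := NcP k.
      have : eta k.+1 <= eta k.
        rewrite /eta ler_wpM2r ?invr_ge0 ?mulr_ge0 ?(ltW K1)//.
        by rewrite lef_pV2 ?posrE ?exprn_gt0// ler_weXn2l// ler1n.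
      lra.
    apply: le_trans (ler_wpM2l K0 h) _.
    have -> : K * (2 * eta k) = 2 ^- k * (K / (K + 1) / 2).
      by rewrite /eta; field; rewrite gt_eqF//= expf_neq0.
    rewrite -[leRHS]mulr1 ler_wpM2l ?invr_ge0 ?exprn_ge0//.
    by rewrite -mulrA -invfM ler_pdivrMr ?mulr_gt0//; lra.
  exists u; split=> // eps e0.
  have [k kP] := half_pow_lt e0; exists (Nc k).1, (Nc k).2; split.
    apply: lt_trans (NcP k) _; apply: le_lt_trans kP; rewrite /eta.
    rewrite mulrC ler_wpM2r ?invr_ge0 ?exprn_ge0//.
    have h4 : 1 <= 4 * (K + 1) by lra.
    by apply: (@le_trans _ _ 1); [rewrite invf_le1; lra|lra].
  exact: le_lt_trans (uP k) kP.
have Gb f u : X f -> Graph f u -> nrm u <= K * nrm f.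
  move=> Xf [Xu H]; apply/ler_addgt0Pr => eps e0.
  have e10 : 0 < eps / (K + 1) by rewrite divr_gt0.
  have [N [c [h1 h2]]] := H _ e10.
  have b1 := nrm_le_sub (cspan_mem Xu) (mys N c).
  have b2 := nrm_le_sub (ms N c) (cspan_mem Xf); rewrite nrm_distC in b2.
  have b3 := yK N c.
  have b4 : K * nrm (sp e N c) <= K * (eps / (K + 1) + nrm f).
    by apply: ler_wpM2l => //; lra.
  have E : eps / (K + 1) + K * (eps / (K + 1) + nrm f) = K * nrm f + eps.
    by field; rewrite gt_eqF.
  lra.
have Gl a f g u v : X f -> X g -> Graph f u -> Graph g v ->
    Graph (fun w => a * f w + g w) (fun w => a * u w + v w).
  move=> Xf Xg [Xu Hu] [Xv Hv]; split; first exact: cspan_lin.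
  move=> eps e0; pose e1 := eps / (2 * (`|a| + 1)).
  have a0 : 0 < `|a| + 1 by rewrite ltr_wpDl.
  have e10 : 0 < e1 by rewrite divr_gt0// mulr_gt0.
  have e20 : 0 < eps / 2 by lra.
  have E : eps / 2 = (`|a| + 1) * e1 by rewrite /e1; field; rewrite gt_eqF.
  have [N [c [h1 h2]]] := Hu _ e10; have [N' [c' [h1' h2']]] := Hv _ e20.
  have [M [c'' EE]] := sp_lin_ex a N c N' c'; exists M, c''; rewrite -!EE.
  have A z : 0 <= z -> z < e1 -> `|a| * z <= eps / 2.
    by move=> z0 ze; rewrite E; apply: ler_pM => //; [rewrite lerDl|exact: ltW].
  split.
    apply: le_lt_trans (nrm_lin_sub a (cspan_mem Xf) (cspan_mem Xg) (ms N c) (ms N' c')) _.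
    by have := A _ (nrm_ge0 P p _) h1; lra.
  apply: le_lt_trans (nrm_lin_sub a (cspan_mem Xu) (cspan_mem Xv) (mys N c) (mys N' c')) _.
  by have := A _ (nrm_ge0 P p _) h2; lra.
have Gu f u v : X f -> Graph f u -> Graph f v -> nrm (fun w => u w - v w) = 0.
  move=> Xf Gf Gf'; apply/eqP; rewrite eq_le nrm_ge0 andbT.
  have := Gl (-1) f f v u Xf Xf Gf' Gf => G0.
  have E1 : (fun w => -1 * f w + f w) = fun=> 0 by apply/funext => w; ring.
  have E2 : (fun w => -1 * v w + u w) = fun w => u w - v w by apply/funext => w; ring.
  rewrite E1 E2 in G0; have := Gb _ _ cspan0 G0.
  by rewrite (proj2 mem0) mulr0.
have /choice[S SP] : forall f, exists u, X f -> Graph f u.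
  move=> f; have [Xf|nX] := pselect (X f); last by exists f.
  by have [u Gf] := Gex f Xf; exists u.
exists S; split.
  split=> //.
  - by move=> f Xf; have [] := SP f Xf.
  - move=> a f g Xf Xg.
    have XL := cspan_lin a Xf Xg; have [XSL _] := SP _ XL.
    have [XSf _] := SP _ Xf; have [XSg _] := SP _ Xg.
    apply: (nrm_sub_ae p1 (cspan_mem XSL)); first exact/cspan_mem/cspan_lin.
    exact: Gu XL (SP _ XL) (Gl _ _ _ _ _ Xf Xg (SP _ Xf) (SP _ Xg)).
  - move=> f Xf; have [XSf _] := SP _ Xf.
    rewrite !nrmE; [|exact: cspan_mem|exact: cspan_mem].
    by rewrite -EFinM lee_fin; exact: Gb (SP _ Xf).
move=> n w wn; have Xe := cspan_e wn.
apply: Gu Xe (SP _ Xe) _; split; first exact: Xy.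
move=> eps e0; exists n.+1, (fun n' w' => ((n' == n) && (w' == w))%:R * 1).
have E e' : sp e' n.+1 (fun n' w' => ((n' == n) && (w' == w))%:R * 1) = e' n w.
  by rewrite -sp_single//; apply/funext => om; rewrite mul1r.
by rewrite !E !nrm_subself.
Qed.

Lemma op_comp S T CS CT : bounded_op P p X S CS -> bounded_op P p X T CT ->
  bounded_op P p X (S \o T) (CS * CT).
Proof.
move=> bS bT; have XT f := op_X bT (f := f); have XS f := op_X bS (f := f).
split.
- by rewrite mulr_ge0// (op_C0 bS, op_C0 bT).
- by move=> f Xf /=; apply/XS/XT.
- move=> a f g Xf Xg /=.
  have XTf := XT _ Xf; have XTg := XT _ Xg; have XL := cspan_lin a Xf Xg.
  have XL' := cspan_lin a XTf XTg.
  apply: (nrm_sub_ae p1 (cspan_mem (XS _ (XT _ XL)))).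
    exact: cspan_mem (cspan_lin a (XS _ XTf) (XS _ XTg)).
  apply/eqP; rewrite eq_le nrm_ge0 andbT.
  apply: le_trans (nrm_triangle p1 (g := S (fun w => a * T f w + T g w)) _ _ _) _.
  - exact: cspan_mem (XS _ (XT _ XL)).
  - exact: cspan_mem (XS _ XL').
  - exact: cspan_mem (cspan_lin a (XS _ XTf) (XS _ XTg)).
  rewrite (op_lin bS a XTf XTg) addr0.
  by rewrite (op_eq0 bS (XT _ XL) XL' (op_lin bT a Xf Xg)).
- move=> f Xf /=; rewrite !nrmE; [|exact: cspan_mem|exact: cspan_mem (XS _ (XT _ Xf))].
  rewrite -EFinM lee_fin -mulrA.
  apply: le_trans (op_bound bS (XT _ Xf)) _.
  by apply: ler_wpM2l; [exact: op_C0 bS|exact: op_bound bT _ Xf].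
Qed.

(** Neumann series by successive correction. The lower bound (1 - r) |f| <= |V f| in norm makes
    approximate solutions Cauchy, gives uniqueness, and bounds the inverse. *)
Lemma inverse_op V C (r : R) : bounded_op P p X V C -> 0 <= r < 1 ->
  (forall f, X f -> nrm (fun w => V f w - f w) <= r * nrm f) ->
  exists S, bounded_op P p X S (1 - r)^-1 /\
    forall f, X f -> nrm (fun w => S (V f) w - f w) = 0.
Proof.
move=> bV /andP[r0 r1] Vr.
have XV f := op_X bV (f := f).
have s0 : 0 < 1 - r by lra.
have low f : X f -> (1 - r) * nrm f <= nrm (V f).
  move=> Xf; have := nrm_le_sub (cspan_mem Xf) (cspan_mem (XV _ Xf)).
  by rewrite nrm_distC; have := Vr f Xf; lra.
have low2 f g : X f -> X g -> (1 - r) * nrm (fun w => f w - g w) <= nrm (fun w => V f w - V g w).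
  move=> Xf Xg; have Xfg := cspan_sub Xf Xg; apply: le_trans (low _ Xfg) _.
  have := op_lin bV (-1) Xg Xf.
  have -> : (fun w => -1 * g w + f w) = (fun w => f w - g w) by apply/funext => w; ring.
  have -> : (fun w => V (fun w => f w - g w) w - (-1 * V g w + V f w)) =
     (fun w => V (fun w => f w - g w) w - (V f w - V g w)) by apply/funext => w; ring.
  move=> E; have := nrm_le_sub (cspan_mem (XV _ Xfg)) (cspan_mem (cspan_sub (XV _ Xf) (XV _ Xg))).
  by rewrite E add0r.
have iter g n : X g -> exists2 u, X u & nrm (fun w => g w - V u w) <= r ^+ n * nrm g.
  move=> Xg; elim: n => [|n [u Xu IH]].
    exists (fun=> 0); first exact: cspan0.
    have V0 : nrm (V (fun=> 0)) <= 0.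
      by have := op_bound bV cspan0; rewrite (proj2 mem0) mulr0.
    have [_] := memLpB p1 (cspan_mem Xg) (cspan_mem (XV _ cspan0)).
    by rewrite expr0 mul1r; lra.
  have Xr := cspan_sub Xg (XV _ Xu).
  (* Adding the residual z = g - V u to [u] leaves the residual z - V z, smaller by the factor
     [r]. *)
  exists (fun w => 1 * u w + (g w - V u w)); first exact: cspan_lin.
  have XL := cspan_lin 1 Xu Xr.
  have h := Vr _ Xr; rewrite exprS -mulrA; apply: le_trans (ler_wpM2l r0 IH).
  apply: le_trans h; have XVr := XV _ Xr.
  have E := op_lin bV 1 Xu Xr.
  have := nrm_triangle p1 (g := fun w => 1 * V u w + V (fun w => g w - V u w) w)
    (cspan_mem Xg) (cspan_mem (cspan_lin 1 (XV _ Xu) XVr)) (cspan_mem (XV _ XL)).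
  rewrite [X in _ <= _ + X -> _]nrm_distC E addr0 => /le_trans; apply.
  rewrite [leRHS]nrm_distC le_eqVlt; apply/orP; left; apply/eqP; congr nrm.
  by apply/funext => w; ring.
have rn (eps : R) (z : R) : 0 < eps -> 0 <= z -> exists n, r ^+ n * z <= eps.
  move=> e0 z0; have : (fun n => r ^+ n) @ \oo --> (0 : R).
    by apply: cvg_expr; rewrite ger0_norm.
  move=> /cvgrPdist_lt /(_ (eps / (z + 1))) [|n _ /(_ n (leqnn _)) /=].
    by rewrite divr_gt0//; lra.
  rewrite sub0r normrN ger0_norm ?exprn_ge0// => h; exists n.
  have z1 : 0 < z + 1 by lra.
  have : r ^+ n * (z + 1) <= eps by rewrite -ler_pdivlMr// ltW.
  have : 0 <= r ^+ n by rewrite exprn_ge0.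
  nra.
have solve g : X g -> exists2 u, X u & nrm (fun w => V u w - g w) = 0.
  move=> Xg; have mg := cspan_mem Xg.
  (* The factor 1 - r compensates the division by 1 - r in the lower bound. *)
  have /choice[u uP] : forall k, exists u, X u /\
      nrm (fun w => g w - V u w) <= (1 - r) / 4 * 2 ^- k.
    move=> k; have e0 : 0 < (1 - r) / 4 * 2 ^- k.
      by rewrite mulr_gt0 ?invr_gt0 ?exprn_gt0//; lra.
    have [n nP] := rn _ _ e0 (nrm_ge0 P p g).
    by have [u Xu h] := iter g n Xg; exists u; split=> //; exact: le_trans h nP.
  have Xu k := (uP k).1.
  have [|v Xv vP] := cspan_complete Xu.
    move=> k; rewrite -(ler_pM2l s0); apply: le_trans (low2 _ _ (Xu _) (Xu _)) _.
    apply: le_trans (nrm_triangle p1 (g := g) (cspan_mem (XV _ (Xu _))) mg (cspan_mem (XV _ (Xu _)))) _.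
    rewrite nrm_distC; have := (uP k).2; have := (uP k.+1).2.
    have -> : 2 ^- k.+1 = 2 ^- k / 2 :> R by rewrite exprS invfM mulrC.
    have : 0 <= (1 - r) * 2 ^- k by rewrite mulr_ge0 ?invr_ge0 ?exprn_ge0 ?(ltW s0).
    lra.
  exists v => //; apply/eqP; rewrite eq_le nrm_ge0 andbT.
  apply/ler_addgt0Pr => eps e0; rewrite add0r.
  have C0 := op_C0 bV; have C1 : 0 < C + 1 by lra.
  have [k kP] := half_pow_lt (divr_gt0 e0 C1).
  apply: le_trans (nrm_triangle p1 (g := V (u k)) (cspan_mem (XV _ Xv)) (cspan_mem (XV _ (Xu k))) mg) _.
  have h1 := op_sub bV Xv (Xu k).
  have h2 := ler_wpM2l C0 (vP k).
  rewrite [X in _ + X <= _]nrm_distC; have h3 := (uP k).2.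
  have h4 : (2 * 2 ^- k) * (C + 1) < eps by rewrite -ltr_pdivlMr.
  have : 0 <= 2 ^- k * r by rewrite mulr_ge0 ?invr_ge0 ?exprn_ge0.
  have : 0 <= 2 ^- k :> R by rewrite invr_ge0 exprn_ge0.
  lra.
have uni f g : X f -> X g -> nrm (fun w => V f w - V g w) = 0 -> nrm (fun w => f w - g w) = 0.
  move=> Xf Xg E; apply/eqP; rewrite eq_le nrm_ge0 andbT.
  by have := low2 _ _ Xf Xg; rewrite E pmulr_rle0.
have /choice[S SP] : forall g, exists u, X g -> X u /\ nrm (fun w => V u w - g w) = 0.
  move=> g; have [Xg|nX] := pselect (X g); last by exists g.
  by have [u Xu E] := solve g Xg; exists u.
exists S; split.
  split; first by rewrite invr_ge0 ltW.
  - by move=> f Xf; have [] := SP f Xf.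
  - move=> a f g Xf Xg; have XL := cspan_lin a Xf Xg.
    have [XSL ESL] := SP _ XL; have [XSf ESf] := SP _ Xf; have [XSg ESg] := SP _ Xg.
    have XL' := cspan_lin a XSf XSg.
    apply: (nrm_sub_ae p1 (cspan_mem XSL) (cspan_mem XL')).
    apply: uni => //; have := op_lin_approx bV a XSf XSg Xf Xg ESf ESg => E.
    apply/eqP; rewrite eq_le nrm_ge0 andbT.
    apply: le_trans (nrm_triangle p1 (g := fun w => a * f w + g w) (cspan_mem (XV _ XSL)) (cspan_mem XL) (cspan_mem (XV _ XL'))) _.
    by rewrite ESL add0r nrm_distC E.
  - move=> f Xf; have [XSf ESf] := SP _ Xf.
    rewrite !nrmE; [|exact: cspan_mem|exact: cspan_mem].
    rewrite -EFinM lee_fin -(ler_pM2l s0) mulrA mulfV ?gt_eqF// mul1r.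
    apply: le_trans (low _ XSf) _.
    by have := nrm_le_sub (cspan_mem (XV _ XSf)) (cspan_mem Xf); rewrite ESf add0r.
move=> f Xf; have [XS ES] := SP _ (XV _ Xf); exact: uni XS Xf ES.
Qed.

End ClosedSpan.

(** * The law of the Haar family *)

(** The position of the node in its level, leading bit first: the index j of the statement. *)
Definition code (w : seq bool) : nat := foldl (fun a (b : bool) => 2 * a + b)%N 0%N w.

Lemma code_rcons w b : code (rcons w b) = (2 * code w + b)%N.
Proof. by rewrite /code -cats1 foldl_cat. Qed.

Lemma code_lt w : (code w < 2 ^ size w)%N.
Proof.
elim/last_ind: w => // w b IH; rewrite code_rcons size_rcons expnS.
by case: b; lia.
Qed.

Lemma code_inj w w' : size w = size w' -> code w = code w' -> w = w'.
Proof.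
elim/last_ind: w w' => [|w b IH] w'; first by case: w'.
case/lastP: w' => [|w' b']; first by rewrite size_rcons.
rewrite !size_rcons !code_rcons => -[ss] cc.
have [E1 E2] : code w = code w' /\ b = b' by case: b cc; case: b' => /=; lia.
by rewrite (IH _ ss E1) E2.
Qed.

Lemma decode k j : (j < 2 ^ k)%N -> exists2 w, size w = k & code w = j.
Proof.
elim: k j => [|k IH] j; first by rewrite expn0 ltnS leqn0 => /eqP ->; exists [::].
rewrite expnS => jk; have [|w wk wc] := IH (j./2)%N.
  by rewrite -divn2 ltn_divLR// mulnC.
exists (rcons w (odd j)); first by rewrite size_rcons wk.
by rewrite code_rcons wc -[RHS]odd_double_half addnC mul2n.
Qed.

Section HaarValues.
Variable R : realType.
Implicit Types (w a : seq bool) (t : R).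

(* [t] lies in the dyadic interval coded by [w], with the denominator cleared. *)
Definition in_dy w t : Prop :=
  (code w)%:R <= t * 2 ^+ size w /\ t * 2 ^+ size w < (code w)%:R + 1.

Lemma in_dy_rcons w b t : in_dy (rcons w b) t -> in_dy w t.
Proof.
rewrite /in_dy size_rcons code_rcons exprS mulrCA natrD natrM => -[h1 h2].
have b0 : (0 : R) <= (nat_of_bool b)%:R by exact: ler0n.
have b1 : (nat_of_bool b)%:R <= (1 : R) by rewrite lern1 leq_b1.
by split; lra.
Qed.

Lemma in_dy_take k a t : in_dy a t -> in_dy (take k a) t.
Proof.
elim/last_ind: a => // a b IH at_.
have [ka|ka] := leqP k (size a).
  by rewrite -cats1 takel_cat//; apply: IH; exact: in_dy_rcons at_.
by rewrite take_oversize// size_rcons.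
Qed.

Lemma haar_val w a t : (size w < size a)%N -> in_dy a t ->
  haar (size w) (code w) t = Hw R w a.
Proof.
move=> wa at_; rewrite /haar /Hw; set k := size w; set j := code w.
have k0 : 0 < 2 ^+ k :> R by rewrite exprn_gt0.
rewrite !ler_pdivrMr// !ltr_pdivlMr// -[j.+1%:R]natr1.
have sk : size (take k a) = k by rewrite size_takel// ltnW.
have [h1 h2] := in_dy_take k at_; rewrite sk in h1 h2.
have := in_dy_take k.+1 at_; rewrite (take_nth false)//.
rewrite /in_dy size_rcons sk code_rcons exprS mulrCA natrD natrM.
set T := t * 2 ^+ k in h1 h2 *; move=> [h3 h4].
have [E|ne] := eqVneq (take k a) w.
  rewrite E -/j in h1 h2 h3 h4; case: (nth false a k) h3 h4 => /= h3 h4; rewrite /sgnb.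
    have -> : (T < j%:R + 2^-1) = false by apply/negbTE; rewrite -leNgt; lra.
    have -> : (j%:R + 2^-1 <= T) by lra.
    by rewrite h2 andbF sub0r.
  have -> : (T < j%:R + 2^-1) by lra.
  have -> : (j%:R + 2^-1 <= T) = false by apply/negbTE; rewrite -ltNge; lra.
  by rewrite h1 subr0.
have cj : code (take k a) != j.
  by apply: contraNneq ne => E; apply/eqP; apply: code_inj.
have [lt|lt] : (code (take k a) < j)%N \/ (j < code (take k a))%N.
  by apply/orP; rewrite -neq_ltn.
  have h5 : (code (take k a))%:R + 1 <= j%:R :> R by rewrite natr1 ler_nat.
  have -> : (j%:R <= T) = false by apply/negbTE; rewrite -ltNge; lra.
  have -> : (j%:R + 2^-1 <= T) = false by apply/negbTE; rewrite -ltNge; lra.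
  by rewrite subrr.
have h5 : j%:R + 1 <= (code (take k a))%:R :> R by rewrite natr1 ler_nat.
have -> : (T < j%:R + 2^-1) = false by apply/negbTE; rewrite -leNgt; lra.
have -> : (T < j%:R + 1) = false by apply/negbTE; rewrite -leNgt; lra.
by rewrite !andbF subrr.
Qed.

Lemma measurable_haar k j : measurable_fun [set: R] (@haar R k j).
Proof.
pose a : R := j%:R / 2 ^+ k; pose m : R := (j%:R + 2^-1) / 2 ^+ k.
pose b : R := j.+1%:R / 2 ^+ k.
have -> : @haar R k j = (fun t => \1_(`[a, m[%classic) t - \1_(`[m, b[%classic) t).
  apply/funext => t; rewrite /haar !indicE !mem_setE !in_itv /=.
  by congr (_ - _); case: ifP.
by apply: measurable_funB; apply: measurable_indic; exact: measurable_itv.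
Qed.

(** Once a common prefix is known, the Haar function at that prefix reveals the next bit. *)
Lemma Hw_sep n a a' : size a = n -> size a' = n ->
  (forall w, (size w < n)%N -> Hw R w a = Hw R w a') -> a = a'.
Proof.
move=> an an' H.
suff T k : (k <= n)%N -> take k a = take k a'.
  by have := T n (leqnn n); rewrite !take_oversize ?an ?an'.
elim: k => [|k IH] kn; first by rewrite !take0.
rewrite (take_nth false) ?an// (take_nth false) ?an'// (IH (ltnW kn)); congr rcons.
have sk : size (take k a') = k by rewrite size_takel ?an'// ltnW.
have := H (take k a'); rewrite sk => /(_ kn).
by rewrite /Hw sk (IH (ltnW kn)) eqxx => /eqP; rewrite sgnb_inj => /eqP.
Qed.

End HaarValues.

Lemma measurable_forall2 d' (T : measurableType d') n (E : nat -> nat -> set T) :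
  (forall k j, (k < n)%N -> (j < 2 ^ k)%N -> measurable (E k j)) ->
  measurable [set x | forall k j, (k < n)%N -> (j < 2 ^ k)%N -> E k j x].
Proof.
move=> mE.
have -> : [set x | forall k j, (k < n)%N -> (j < 2 ^ k)%N -> E k j x] =
  \bigcap_k \bigcap_j (if (k < n)%N && (j < 2 ^ k)%N then E k j else setT).
  apply/seteqP; split=> x /= H.
    by move=> k _ j _; case: ifP => // /andP[kn jk]; exact: H.
  by move=> k j kn jk; have := H k I j I; rewrite kn jk.
apply: bigcapT_measurable => k; apply: bigcapT_measurable => j.
by case: ifP => [/andP[]|_]; [exact: mE|exact: measurableT].
Qed.

(** * Integrals of Haar sums as iterated averages *)

Section Transfer.
Context (d : measure_display) (Omega : measurableType d) (R : realType).
Variables (P : probability Omega R) (h : nat -> nat -> nat -> Omega -> R).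
Hypothesis hP : BRS_copy P h.

Definition hh n w := h n (size w) (code w).

(* The event that the tree [n] is at the leaf [a]. *)
Definition Qa n (a : seq bool) : set Omega :=
  [set om | forall k j, (k < n)%N -> (j < 2 ^ k)%N ->
     h n k j om = haar k j ((code a)%:R / 2 ^+ n)].

Let mh n k j : measurable_fun [set: Omega] (h n k j). Proof. by case: hP. Qed.

Lemma measurable_hh n w : measurable_fun [set: Omega] (hh n w).
Proof. exact: mh. Qed.

Lemma measurable_Qa n a : measurable (Qa n a).
Proof.
rewrite /Qa; apply: (@measurable_forall2 _ _ n
  (fun k j => [set om | h n k j om = haar k j ((code a)%:R / 2 ^+ n)])) => k j _ _.
have -> : [set om | h n k j om = haar k j ((code a)%:R / 2 ^+ n)] =
  [set: Omega] `&` h n k j @^-1` [set haar k j ((code a)%:R / 2 ^+ n)] by rewrite setTI.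
exact: (mh n k j).
Qed.

Lemma sigma_Qa n a : sigma_n h n (Qa n a).
Proof.
pose G : set (set Omega) := [set A | exists k j (B : set R),
  [/\ (k < n)%N, (j < 2 ^ k)%N, measurable B & A = h n k j @^-1` B]].
apply: (@measurable_forall2 _ (g_sigma_algebraType G) n
  (fun k j => [set om | h n k j om = haar k j ((code a)%:R / 2 ^+ n)])) => k j kn jk.
apply: sub_sigma_algebra; exists k, j, [set haar k j ((code a)%:R / 2 ^+ n)].
by split.
Qed.

Lemma in_dy_left a : in_dy a ((code a)%:R / 2 ^+ size a : R).
Proof.
rewrite /in_dy divfK; first by split=> //; rewrite ltrDl.
by rewrite expf_neq0.
Qed.

Lemma Qa_hh n a w om : size a = n -> (size w < n)%N -> Qa n a om -> hh n w om = Hw R w a.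
Proof.
move=> an wn /(_ (size w) (code w) wn (code_lt w)); rewrite /hh => ->.
by rewrite -an; apply: haar_val; [rewrite an|exact: in_dy_left].
Qed.

Let trivQ n : trivIset [set` words n] (Qa n).
Proof.
apply/trivIsetP => a a' /=; rewrite !mem_words => /eqP an /eqP an' ne.
apply/seteqP; split=> // om [Q1 Q2]; case/eqP: ne.
apply: (@Hw_sep R n) => // w wn.
by rewrite -(Qa_hh an wn Q1) (Qa_hh an' wn Q2).
Qed.

(** Only containment of the dyadic interval of [a] in the level set is checked; [P_Qa] obtains
    equality by counting. *)
Let PQ_ge n a : size a = n -> ((2 ^- n)%:E <= P (Qa n a))%E.
Proof.
move=> an; have [_ jl _] := hP.
have n0 : 0 < 2 ^+ n :> R by rewrite exprn_gt0.
pose t0 : R := (code a)%:R / 2 ^+ n; pose t1 : R := ((code a)%:R + 1) / 2 ^+ n.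
have := jl n (fun k j => [set haar k j t0]) (fun k j => measurable_set1 _).
rewrite -/(Qa n a) => ->.
have -> : (2 ^- n)%:E = (@lebesgue_measure R) `[t0, t1[%classic.
  rewrite lebesgue_measure_itv /= lte_fin.
  have lt01 : t0 < t1 by rewrite ltr_pM2r ?invr_gt0// ltrDl.
  by rewrite lt01 -EFinB; congr EFin; rewrite /t0 /t1 -mulrBl addrAC subrr add0r mul1r.
apply: le_measure; rewrite ?inE.
- exact: measurable_itv.
- apply: measurableI.
    have -> : [set t : R | 0 <= t <= 1] = `[0, 1]%classic.
      by apply/seteqP; split=> t /=; rewrite in_itv.
    exact: measurable_itv.
  apply: (@measurable_forall2 _ _ n (fun k j => [set t | haar k j t = haar k j t0])) => k j _ _.
  have -> : [set t | haar k j t = haar k j t0] =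
    [set: R] `&` @haar R k j @^-1` [set haar k j t0] by rewrite setTI.
  exact: measurable_haar.
move=> t /=; rewrite in_itv /= => /andP[tt0 tt1].
have ta : in_dy a t.
  by rewrite /in_dy an; split; [rewrite -ler_pdivrMr|rewrite -ltr_pdivlMr].
split.
  apply/andP; split; first by apply: le_trans tt0; rewrite divr_ge0// ltW.
  apply: le_trans (ltW tt1) _; rewrite ler_pdivrMr// mul1r natr1 -natrX ler_nat.
  by rewrite -an code_lt.
move=> k j kn jk; have [w wk wj] := decode jk.
have wa : (size w < size a)%N by rewrite an wk.
rewrite /= -wk -wj (haar_val wa ta) /t0 -an.
by rewrite (haar_val wa (in_dy_left a)).
Qed.

Let U n : set Omega := \big[setU/set0]_(a <- words n) Qa n a.
Let mU n : measurable (U n).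
Proof. by apply: bigsetU_measurable => a _; exact: measurable_Qa. Qed.

Let PQf n a : P (Qa n a) = (fine (P (Qa n a)))%:E.
Proof. by rewrite fineK// fin_num_measure//; exact: measurable_Qa. Qed.

Let PU n : P (U n) = (\sum_(a <- words n) fine (P (Qa n a)))%:E.
Proof.
have E (D : set Omega) : measurable D -> P D = (\int[P]_(x in D) cst 1%E x)%E.
  by move=> mD; rewrite integral_cst// mul1e.
rewrite E//; rewrite ge0_integral_bigsetU//.
- rewrite -sumEFin; apply: eq_bigr => a _; rewrite -PQf E//; exact: measurable_Qa.
- by move=> a; exact: measurable_Qa.
- exact: uniq_words.
Qed.

Let sum_cst n : \sum_(a <- words n) 2 ^- n = 1 :> R.
Proof.
rewrite big_const_seq count_predT size_words iter_addr_0 -[LHS]mulr_natl natrX mulfV//.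
Qed.

(** The 2^n events are disjoint, each of probability at least 2^-n, with total at most 1. *)
Lemma P_Qa n a : size a = n -> P (Qa n a) = (2 ^- n)%:E.
Proof.
move=> an; rewrite PQf; congr EFin.
have ge b : b \in words n -> 2 ^- n <= fine (P (Qa n b)).
  by rewrite mem_words => /eqP bn; have := PQ_ge bn; rewrite PQf lee_fin.
have aw : a \in words n by rewrite mem_words an.
have le1 : \sum_(b <- words n) fine (P (Qa n b)) <= \sum_(b <- words n) 2 ^- n.
  by rewrite sum_cst -lee_fin -PU; exact: probability_le1.
rewrite (big_rem a)// [leRHS](big_rem a)//= in le1.
have le2 : \sum_(b <- rem a (words n)) 2 ^- n <=
    \sum_(b <- rem a (words n)) fine (P (Qa n b)).
  rewrite big_seq [leRHS]big_seq; apply: ler_sum => b br; apply: ge; exact: mem_rem br.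
apply/eqP; rewrite eq_le; apply/andP; split; last exact: ge.
rewrite -(lerD2r (\sum_(b <- rem a (words n)) 2 ^- n)).
apply: le_trans le1; rewrite lerD2l; exact: le2.
Qed.

Let PUC n : P (~` U n) = 0%E.
Proof.
rewrite probability_setC// PU -[1%E]/(1%:E) -EFinB; congr EFin; apply/eqP; rewrite subr_eq0.
apply/eqP; rewrite -[LHS](sum_cst n); apply: eq_big_seq => a.
by rewrite mem_words => /eqP /P_Qa ->.
Qed.

(** Splitting according to the leaf of tree [n] moves [n] from [l], the trees still to be averaged,
    to [S], the trees already fixed. When [l] is exhausted the integrand is constant, and
    independence gives the measure of the event. *)
Lemma transfer (Fr : nat -> Omega -> R) (Fh : nat -> seq bool -> R) (Phi : R -> R)
    (l S : seq nat) (al : nat -> seq bool) (z : R) :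
  (forall n, measurable_fun [set: Omega] (Fr n)) ->
  (forall n a om, size a = n -> Qa n a om -> Fr n om = Fh n a) ->
  measurable_fun [set: R] Phi -> (forall x, 0 <= Phi x) ->
  uniq (l ++ S) -> (forall n, size (al n) = n) ->
  (\int[P]_(om in \bigcap_(n in [set` S]) Qa n (al n))
     (Phi (z + \sum_(n <- l) Fr n om))%:E =
  ((\prod_(n <- S) 2 ^- n) * iterL Fh l Phi z)%:E)%E.
Proof.
move=> mF FQ mPhi Phi0.
have mD (S' : seq nat) (al' : nat -> seq bool) : measurable (\bigcap_(n in [set` S']) Qa n (al' n)).
  by rewrite bigcap_seq; apply: bigsetI_measurable => i _; exact: measurable_Qa.
have mS (l' : seq nat) z' : measurable_fun [set: Omega] (fun om => (Phi (z' + \sum_(n <- l') Fr n om))%:E).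
  apply/measurable_EFinP; apply: measurableT_comp => //.
  apply: measurable_funD => //.
  exact: measurable_sum.
elim: l S al z => [|n l IH] S al z.
  move=> /= uS sal.
  rewrite (eq_integral (cst (Phi z)%:E)); last by move=> om _; rewrite big_nil addr0.
  rewrite integral_cst// mulrC EFinM; congr (_ * _)%E.
  have [_ _ ind] := hP.
  transitivity (\prod_(n <- S) P (Qa n (al n)))%E.
    exact: (ind S (fun n => Qa n (al n)) uS (fun m _ => @sigma_Qa m (al m))).
  elim: S {uS} => [|m S IHS]; rewrite ?big_nil// !big_cons IHS EFinM.
  by rewrite P_Qa.
rewrite cat_cons cons_uniq mem_cat negb_or => /andP[/andP[nl nS] ulS] sal.
set D := \bigcap_(m in _) _.
pose g om := (Phi (z + \sum_(m <- n :: l) Fr m om))%:E.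
have g0 (E : set Omega) om : E om -> (0 <= g om)%E by move=> _; rewrite lee_fin.
have mg (E : set Omega) : measurable_fun E g by apply: measurable_funTS; exact: mS.
(* Discards the null event where tree [n] is at no leaf. *)
have -> : (\int[P]_(om in D) g om = \int[P]_(om in D `\` ~` U n) g om)%E.
  exact: (ge0_negligible_integral (measurableC (mU n)) (mD S al) (mg D) (g0 D) (PUC n)).
have -> : D `\` ~` U n = \big[setU/set0]_(a <- words n) (D `&` Qa n a).
  by rewrite setDE setCK /U -!bigcup_seq setI_bigcupr.
have mDQ a : measurable (D `&` Qa n a).
  by apply: measurableI; [exact: mD|exact: measurable_Qa].
have tDQ : trivIset [set` words n] (fun a => D `&` Qa n a).
  apply/trivIsetP => a a' aw a'w ne; have /trivIsetP T := @trivQ n.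
  by rewrite setIACA setIid (T _ _ aw a'w ne) setI0.
rewrite (ge0_integral_bigsetU P mDQ (uniq_words n) tDQ (mg _) (g0 _)) /g.
rewrite (eq_big_seq (fun a => (((\prod_(m <- n :: S) 2 ^- m) * iterL Fh l Phi (z + Fh n a))%:E))%E); last first.
  move=> a; rewrite mem_words => /eqP an.
  pose al' m := if m == n then a else al m.
  have DE : D `&` Qa n a = \bigcap_(m in [set` n :: S]) Qa m (al' m).
    apply/seteqP; split=> om /=.
      move=> [Dom Qom] m /=; rewrite inE /al' => /predU1P[->|m_S]; first by rewrite eqxx.
      have /negbTE -> : m != n by apply: contraNneq nS => <-.
      exact: Dom.
    move=> H; split; last by have := H n; rewrite /= inE eqxx /al' eqxx; exact.
    move=> m m_S; have := H m; rewrite /= inE (m_S : m \in S) orbT => /(_ isT); rewrite /al'.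
    by have /negbTE -> : m != n by apply: contraNneq nS => <-.
  rewrite DE -(IH (n :: S) al' (z + Fh n a)); last first.
  - by move=> m; rewrite /al'; case: eqP => [->|].
  - by rewrite uniq_catC cons_uniq mem_cat negb_or nS nl uniq_catC.
  rewrite -DE; apply: eq_integral => om; rewrite inE => -[_ Qom].
  by rewrite big_cons (FQ n a)// addrA.
rewrite sumEFin; congr EFin; rewrite /= avgE big_cons.
rewrite -mulr_sumr; ring.
Qed.

Lemma transferT (Fr : nat -> Omega -> R) (Fh : nat -> seq bool -> R) (Phi : R -> R)
    (l : seq nat) (z : R) :
  (forall n, measurable_fun [set: Omega] (Fr n)) ->
  (forall n a om, size a = n -> Qa n a om -> Fr n om = Fh n a) ->
  measurable_fun [set: R] Phi -> (forall x, 0 <= Phi x) -> uniq l ->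
  (\int[P]_om (Phi (z + \sum_(n <- l) Fr n om))%:E = (iterL Fh l Phi z)%:E)%E.
Proof.
move=> mF FQ mPhi Phi0 ul.
have := @transfer Fr Fh Phi l [::] (fun n => nseq n false) z mF FQ mPhi Phi0.
rewrite cats0 big_nil mul1r => /(_ ul (fun n => size_nseq n false)) <-.
by congr integral; apply/seteqP; split.
Qed.

End Transfer.

(** * The pairing between L_q and L_p *)

Section Pairing.
Context (d : measure_display) (Omega : measurableType d) (R : realType).
Variables (P : probability Omega R) (p : R).
Hypothesis p1 : 1 < p.
Implicit Types (f g : Omega -> R).

Local Notation q := (conj_exp p).

Lemma conj_exp_gt1 : 1 < q.
Proof. by move: (p1) => p1'; rewrite /conj_exp ltr_pdivlMr; lra. Qed.

Lemma conj_exp_sum : q^-1 + p^-1 = 1.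
Proof.
move: (p1) => p1'; rewrite /conj_exp invf_div; field.
by rewrite gt_eqF//; lra.
Qed.

Lemma pairing_hoelder g f : memLp P q g -> memLp P p f ->
  P.-integrable [set: Omega] (EFin \o (fun w => g w * f w)) /\
  `|pairing P g f| <= nrm P q g * nrm P p f.
Proof.
move: (p1) => p1' mg mf.
have p0 : 0 < p by lra.
have q0 : 0 < q by have := conj_exp_gt1; lra.
have := @hoelder _ _ _ P g f q p (proj1 mg) (proj1 mf) q0 p0 conj_exp_sum.
rewrite Lnorm1 -/(Lpnorm P q g) -/(Lpnorm P p f) (nrmE mg) (nrmE mf) -EFinM => H.
have mgf : measurable_fun [set: Omega] (fun w => g w * f w).
  by apply: measurable_funM; [case: mg|case: mf].
have I : P.-integrable [set: Omega] (EFin \o (fun w => g w * f w)).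
  apply/integrableP; split; first exact/measurable_EFinP.
  exact: le_lt_trans H (ltry _).
split=> //; apply: le_trans (le_normr_Rintegral measurableT I) _.
rewrite -lee_fin /Rintegral fineK//.
by apply: fin_real; rewrite (le_lt_trans H (ltry _)) andbT (lt_le_trans (ltNyr 0))// integral_ge0.
Qed.

Lemma pairing_lin g a f f' : memLp P q g -> memLp P p f -> memLp P p f' ->
  pairing P g (fun w => a * f w + f' w) = a * pairing P g f + pairing P g f'.
Proof.
move=> mg mf mf'; have [I1 _] := pairing_hoelder mg mf; have [I2 _] := pairing_hoelder mg mf'.
have I3 : P.-integrable [set: Omega] (EFin \o (fun w => a * (g w * f w))).
  by have := integrableZl measurableT a I1; apply: eq_integrable.
rewrite /pairing -RintegralZl// -RintegralD//.
by apply: eq_Rintegral => w _; ring.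
Qed.

Lemma pairing_linl g a g' f : memLp P q g -> memLp P q g' -> memLp P p f ->
  pairing P (fun w => a * g w + g' w) f = a * pairing P g f + pairing P g' f.
Proof.
move=> mg mg' mf; have [I1 _] := pairing_hoelder mg mf; have [I2 _] := pairing_hoelder mg' mf.
have I3 : P.-integrable [set: Omega] (EFin \o (fun w => a * (g w * f w))).
  by have := integrableZl measurableT a I1; apply: eq_integrable.
rewrite /pairing -RintegralZl// -RintegralD//.
by apply: eq_Rintegral => w _; ring.
Qed.

Lemma pairing0 g : memLp P q g -> pairing P g (fun=> 0) = 0.
Proof.
move=> mg; have [z z0] := mem0 P (ltW p1).
have [_] := pairing_hoelder mg z; rewrite z0 mulr0 normr_le0 => /eqP.
exact.
Qed.

Lemma pairing0l f : memLp P p f -> pairing P (fun=> 0) f = 0.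
Proof.
move=> mf; have [z z0] := mem0 P (ltW conj_exp_gt1).
have [_] := pairing_hoelder z mf; rewrite z0 mul0r normr_le0 => /eqP.
exact.
Qed.

Lemma pairing_sub g f f' : memLp P q g -> memLp P p f -> memLp P p f' ->
  `|pairing P g f - pairing P g f'| <= nrm P q g * nrm P p (fun w => f w - f' w).
Proof.
move=> mg mf mf'; have [m _] := memLpB (ltW p1) mf mf'.
have [_] := pairing_hoelder mg m; congr (`|_| <= _).
have := pairing_lin (-1) mg mf' mf; rewrite mulN1r addrC => <-.
by congr pairing; apply/funext => w; ring.
Qed.

Lemma pairing_sum (I : eqType) (s : seq I) (c : I -> R) g (F : I -> Omega -> R) :
  memLp P q g -> (forall i, i \in s -> memLp P p (F i)) ->
  memLp P p (fun w => \sum_(i <- s) c i * F i w) /\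
  pairing P g (fun w => \sum_(i <- s) c i * F i w) = \sum_(i <- s) c i * pairing P g (F i).
Proof.
move=> mg; elim: s => [_|i s IH mF].
  rewrite big_nil (_ : (fun _ => _) = fun=> 0); last by apply/funext => w; rewrite big_nil.
  by split; [case: (mem0 P (ltW p1))|exact: pairing0].
rewrite big_cons (_ : (fun _ => _) = fun w => c i * F i w + \sum_(i <- s) c i * F i w).
  have [|m E] := IH; first by move=> j js; apply: mF; rewrite inE js orbT.
  have mi := mF i (mem_head _ _); split; first exact: (mem_lin (ltW p1)).
  by rewrite pairing_lin// E.
by apply/funext => w; rewrite big_cons.
Qed.

Lemma pairing_suml (I : eqType) (s : seq I) (c : I -> R) f (F : I -> Omega -> R) :
  memLp P p f -> (forall i, i \in s -> memLp P q (F i)) ->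
  memLp P q (fun w => \sum_(i <- s) c i * F i w) /\
  pairing P (fun w => \sum_(i <- s) c i * F i w) f = \sum_(i <- s) c i * pairing P (F i) f.
Proof.
have q1 := ltW conj_exp_gt1.
move=> mg; elim: s => [_|i s IH mF].
  rewrite big_nil (_ : (fun _ => _) = fun=> 0); last by apply/funext => w; rewrite big_nil.
  by split; [case: (mem0 P q1)|exact: pairing0l].
rewrite big_cons (_ : (fun _ => _) = fun w => c i * F i w + \sum_(i <- s) c i * F i w).
  have [|m E] := IH; first by move=> j js; apply: mF; rewrite inE js orbT.
  have mi := mF i (mem_head _ _); split; first exact: (mem_lin q1).
  by rewrite pairing_linl// E.
by apply/funext => w; rewrite big_cons.
Qed.

End Pairing.

(** * Haar sums: norms, coefficients, multipliers *)

Section HaarSums.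
Context (d : measure_display) (Omega : measurableType d) (R : realType).
Variables (P : probability Omega R) (h : nat -> nat -> nat -> Omega -> R).
Hypothesis hP : BRS_copy P h.
Implicit Types (c : nat -> seq bool -> R).

Local Notation e := (hh h).

Definition tf n (b : seq bool -> R) : Omega -> R := fun om => \sum_(w <- W n) b w * e n w om.

(** Runs over a list of trees instead of an initial segment, because the blocks live in the trees
    [mu n]. *)
Definition tsum (l : seq nat) c : Omega -> R := fun om => \sum_(n <- l) tf n (c n) om.

Lemma measurable_tf n b : measurable_fun [set: Omega] (tf n b).
Proof.
apply: measurable_sum => w; apply: measurable_funM => //; exact: measurable_hh hP _ _.
Qed.

Lemma measurable_tsum l c : measurable_fun [set: Omega] (tsum l c).
Proof. by apply: measurable_sum => n; exact: measurable_tf. Qed.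

Lemma tsum_int r l c : uniq l ->
  (\int[P]_om (`|tsum l c om| `^ r)%:E =
   (iterL (fun n => Mt n (c n)) l (fun x => `|x| `^ r) 0)%:E)%E.
Proof.
move=> ul.
have mF n : measurable_fun [set: Omega] (tf n (c n)) by exact: measurable_tf.
have FQ n a om : size a = n -> Qa h n a om -> tf n (c n) om = Mt n (c n) a.
  move=> an Q; rewrite -sum_Hw ?an//; apply: eq_big_seq => w; rewrite mem_W => wn.
  by rewrite (Qa_hh an wn Q).
have mPhi : measurable_fun [set: R] (fun x : R => `|x| `^ r).
  exact: (@measurableT_comp _ _ _ _ _ _ (@powR R ^~ r)).
rewrite -(transferT hP 0 mF FQ mPhi (fun x => powR_ge0 `|x| r) ul).
by apply: eq_integral => om _; rewrite add0r.
Qed.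

Lemma tsum_mem r l c : 0 < r -> uniq l -> memLp P r (tsum l c).
Proof.
move=> r0 ul; split; first exact: measurable_tsum.
pose I := iterL (fun n => Mt n (c n)) l (fun x => `|x| `^ r) 0.
have I0 : 0 <= I.
  rewrite -lee_fin -tsum_int//; apply: integral_ge0 => w _; by rewrite lee_fin powR_ge0.
apply: le_lt_trans (@Lpnorm_le _ _ _ P r (tsum l c) (I `^ r^-1) r0 (powR_ge0 _ _) _) (ltry _).
by rewrite tsum_int// -powRrM mulVf ?gt_eqF// powRr1.
Qed.

Lemma tsum_nrm_le r l l' c c' (K : R) : 0 < r -> 0 <= K -> uniq l -> uniq l' ->
  iterL (fun n => Mt n (c n)) l (fun x => `|x| `^ r) 0 <=
  K `^ r * iterL (fun n => Mt n (c' n)) l' (fun x => `|x| `^ r) 0 ->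
  nrm P r (tsum l c) <= K * nrm P r (tsum l' c').
Proof.
move=> r0 K0 ul ul' H; apply: nrm_le => //; [by rewrite mulr_ge0 ?nrm_ge0|exact: tsum_mem|].
rewrite tsum_int// lee_fin powRM ?nrm_ge0//; apply: le_trans H _.
rewrite ler_wpM2l ?powR_ge0// -lee_fin -tsum_int// memLp_powR//; exact: tsum_mem.
Qed.

Lemma spE N c : sp e N c = tsum (iota 0 N) c.
Proof.
apply/funext => om; rewrite /sp /tsum.
by rewrite -(big_mkord xpredT (fun n => tf n (c n) om)) /index_iota subn0.
Qed.

Definition emb n (b : seq bool -> R) : nat -> seq bool -> R :=
  fun n' w => if n' == n then b w else 0.

Lemma tfE n b : tf n b = tsum [:: n] (emb n b).
Proof. by apply/funext => om; rewrite /tsum big_seq1 /emb /tf eqxx. Qed.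

Lemma tf_sp n b (y : nat -> seq bool -> Omega -> R) :
  (fun om => \sum_(w <- W n) b w * y n w om) = sp y n.+1 (emb n b).
Proof.
apply/funext => om; rewrite /sp big_ord_recr /= [X in _ = X + _]big1 ?add0r.
  by apply: eq_bigr => w _; rewrite /emb eqxx.
move=> i _; rewrite big1// => w _; by rewrite /emb (ltn_eqF (ltn_ord i)) mul0r.
Qed.

Lemma tf_mem r n b : 0 < r -> memLp P r (tf n b).
Proof. by move=> r0; rewrite tfE; exact: tsum_mem. Qed.

Lemma tf_nrm_le r n b (K : R) : 0 < r -> 0 <= K ->
  avg n (fun x => `|Mt n b x| `^ r) <= K `^ r -> nrm P r (tf n b) <= K.
Proof.
move=> r0 K0 H; apply: nrm_le => //; first exact: tf_mem.
rewrite tfE tsum_int//= lee_fin; apply: le_trans H.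
rewrite le_eqVlt; apply/orP; left; apply/eqP; apply: eq_avg => x _.
by rewrite add0r; congr (`|_| `^ _); apply: eq_Mt => k _; rewrite /emb eqxx.
Qed.

Lemma tf_nrm_le1 r n b : 0 < r -> (forall x, size x = n -> `|Mt n b x| <= 1) ->
  nrm P r (tf n b) <= 1.
Proof.
move=> r0 H; apply: tf_nrm_le => //; rewrite powR1 -(avg_cst n 1); apply: le_avg => x xn.
rewrite [leRHS](_ : 1 = 1 `^ r); last by rewrite powR1.
by apply: ge0_ler_powR; rewrite ?nnegrE ?(ltW r0)// H.
Qed.

Definition dlt w : seq bool -> R := fun w' => (w' == w)%:R.

Lemma sum_dlt n w (F : seq bool -> R) : (size w < n)%N ->
  \sum_(w' <- W n) dlt w w' * F w' = F w.
Proof.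
move=> wn; rewrite (big_rem w) ?mem_W//= /dlt eqxx mul1r big_seq big1 ?addr0// => w'.
by rewrite mem_rem_uniq ?uniq_W// inE => /andP[/negbTE-> _]; rewrite mul0r.
Qed.

Lemma tf_dlt n w : (size w < n)%N -> tf n (dlt w) = e n w.
Proof. by move=> wn; apply/funext => om; rewrite /tf sum_dlt. Qed.

Lemma e_mem r n w : 0 < r -> (size w < n)%N -> memLp P r (e n w).
Proof. by move=> r0 wn; rewrite -tf_dlt//; exact: tf_mem. Qed.

Lemma e_nrm_le1 r n w : 0 < r -> (size w < n)%N -> nrm P r (e n w) <= 1.
Proof.
move=> r0 wn; rewrite -tf_dlt//; apply: tf_nrm_le1 => // x xn.
by rewrite -sum_Hw ?xn// sum_dlt// /Hw; case: ifP => _; rewrite ?normr_sgnb ?normr0.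
Qed.

Lemma sp_mem_r r N c : 0 < r -> memLp P r (sp e N c).
Proof. by move=> r0; rewrite spE; apply: tsum_mem => //; exact: iota_uniq. Qed.

Lemma sp_nrm_sum r N c : 1 <= r ->
  nrm P r (sp e N c) <= \sum_(n < N) \sum_(w <- W n) `|c n w|.
Proof.
move=> r1; have r0 : 0 < r by exact: lt_le_trans r1.
have H (s : seq (seq bool)) n : all (fun w => size w < n)%N s ->
    memLp P r (fun om => \sum_(w <- s) c n w * e n w om) /\
    nrm P r (fun om => \sum_(w <- s) c n w * e n w om) <= \sum_(w <- s) `|c n w|.
  elim: s => [_|w s IH /= /andP[wn sn]].
    rewrite big_nil (_ : (fun _ => _) = fun=> 0); last by apply/funext => om; rewrite big_nil.
    by have [z ->] := mem0 P r1.
  rewrite big_cons (_ : (fun _ => _) = fun om => c n w * e n w om + \sum_(w <- s) c n w * e n w om).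
    have [m b] := IH sn; have me := e_mem r0 wn; split; first exact: (mem_lin r1).
    apply: le_trans (nrm_lin r1 (c n w) me m) _; apply: lerD => //.
    by rewrite -[leRHS]mulr1 ler_wpM2l// e_nrm_le1.
  by apply/funext => om; rewrite big_cons.
elim: N => [|N IH].
  rewrite big_ord0 (_ : sp e 0 c = fun=> 0); last by apply/funext => om; rewrite /sp big_ord0.
  by have [_ ->] := mem0 P r1.
rewrite big_ord_recr /=.
rewrite (_ : sp e N.+1 c = fun om => sp e N c om + \sum_(w <- W N) c N w * e N w om).
  have [|m b] := H (W N) N; first by apply/allP => w; rewrite mem_W.
  have [_] := memLpD r1 (sp_mem_r N c r0) m => /le_trans; apply; exact: lerD.
by apply/funext => om; rewrite /sp big_ord_recr.
Qed.

Lemma sqr_int N c :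
  P.-integrable [set: Omega] (EFin \o (fun om => (sp e N c om) ^+ 2)) /\
  Rintegral P [set: Omega] (fun om => (sp e N c om) ^+ 2) =
    \sum_(n < N) ipt n (c n) (c n).
Proof.
have Phi2 : (fun x : R => `|x| `^ 2) = (fun x => x ^+ 2).
  by apply/funext => x; rewrite powR_mulrn// real_normK// num_real.
have E : (\int[P]_om ((sp e N c om) ^+ 2)%:E = (\sum_(n < N) ipt n (c n) (c n))%:E)%E.
  have := tsum_int 2 c (iota_uniq 0 N); rewrite Phi2 iterL_sqr expr0n add0r.
  rewrite -(big_mkord xpredT (fun n => ipt n (c n) (c n))) /index_iota subn0 => <-.
  apply: eq_integral => om _; rewrite spE; congr EFin.
  by have := congr1 (fun F : R -> R => F (tsum (iota 0 N) c om)) Phi2 => /= ->.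
split; last by rewrite /Rintegral E.
apply/integrableP; split.
  apply/measurable_EFinP; apply: measurable_funX; rewrite spE; exact: measurable_tsum.
rewrite (eq_integral (fun om => ((sp e N c om) ^+ 2)%:E)); first by rewrite E ltry.
by move=> om _ /=; rewrite ger0_norm// sqr_ge0.
Qed.

(** Polarization of [sqr_int], since [iterL] handles functions of a single sum only. *)
Lemma pairing_sp N c c' :
  pairing P (sp e N c) (sp e N c') = \sum_(n < N) ipt n (c n) (c' n).
Proof.
pose cp n w := c n w + c' n w; pose cm n w := c n w - c' n w.
have Ep : sp e N cp = fun om => sp e N c om + sp e N c' om.
  apply/funext => om; rewrite /sp -big_split; apply: eq_bigr => n _ /=.
  by rewrite -big_split; apply: eq_bigr => w _ /=; rewrite mulrDl.
have Em : sp e N cm = fun om => sp e N c om - sp e N c' om.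
  apply/funext => om; rewrite /sp -sumrB; apply: eq_bigr => n _ /=.
  by rewrite -sumrB; apply: eq_bigr => w _ /=; rewrite mulrBl.
have [Ip Rp] := sqr_int N cp; have [Im Rm] := sqr_int N cm.
have K : Rintegral P [set: Omega] (fun om => (sp e N cp om) ^+ 2 - (sp e N cm om) ^+ 2) =
   4 * pairing P (sp e N c) (sp e N c').
  have I : P.-integrable [set: Omega] (EFin \o (fun om => sp e N c om * sp e N c' om)).
    have J := integrableZl measurableT (4^-1) (integrableB measurableT Ip Im).
    apply: eq_integrable J => // om _ /=; rewrite -EFinB -EFinM Ep Em; congr EFin; by field.
  rewrite /pairing -RintegralZl//; apply: eq_Rintegral => om _; rewrite Ep Em; ring.
have : 4 * pairing P (sp e N c) (sp e N c') = 4 * \sum_(n < N) ipt n (c n) (c' n).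
  rewrite -K RintegralB// Rp Rm -sumrB mulr_sumr; apply: eq_bigr => n _.
  rewrite !iptE -sumrB mulr_sumr; apply: eq_bigr => w _; rewrite /cp /cm; ring.
by move/mulfI; apply; rewrite pnatr_eq0.
Qed.

Lemma coef_sp N c n w : (size w < n)%N ->
  pairing P (e n w) (sp e N c) = (n < N)%N%:R * c n w * 2 ^- size w.
Proof.
move=> wn; pose M := maxn N n.+1.
rewrite (sp_widen c e (leq_maxl N n.+1)) -{1}tf_dlt// /tf (tf_sp n (dlt w) e).
rewrite (sp_widen (emb n (dlt w)) e (leq_maxr N n.+1)) pairing_sp.
have nM : (n < maxn N n.+1)%N by rewrite leq_max ltnSn orbT.
rewrite (bigD1 (Ordinal nM))//= big1 ?addr0; last first.
  move=> i ni; rewrite iptE big1// => w' _; rewrite /emb.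
  by have /negbTE -> : nat_of_ord i != n by []; rewrite mulr0 mul0r mulr0.
rewrite iptE (eq_bigr (fun w' => dlt w w' * ((n < N)%N%:R * c n w' * 2 ^- size w'))).
  by rewrite sum_dlt.
by move=> w' _ /=; rewrite /emb eqxx ltnSn mul1r; ring.
Qed.

Lemma coef_tf n w m b : (size w < n)%N ->
  pairing P (e n w) (tf m b) = (n == m)%:R * b w * 2 ^- size w.
Proof.
move=> wn; rewrite /tf (tf_sp m b e) coef_sp// /emb; case: eqP => [->|_].
  by rewrite ltnSn.
by rewrite mulr0 !mul0r.
Qed.

Section Multiplier.
Variable p : R.
Hypothesis p1 : 1 < p.
Local Notation K := (cmul p).

Lemma multiplier_sign N c (s : nat -> seq bool -> R) : (forall n w, `|s n w| = 1) ->
  nrm P p (sp e N (fun n w => s n w * c n w)) <= K * nrm P p (sp e N c).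
Proof.
move: (p1) => p1' s1; rewrite !spE; apply: tsum_nrm_le; rewrite ?iota_uniq//; first lra.
  by have := cmul_ge1 p1; lra.
by apply: iterL_transform => // n w; rewrite normrM s1 mul1r.
Qed.

(** Entries in [-1, 1] are convex combinations of signs. The induction runs over a list of the
    entries that may fail to be signs and splits one of them at a time. *)
Lemma multiplier N c (s : nat -> seq bool -> R) : (forall n w, (size w < n)%N -> `|s n w| <= 1) ->
  nrm P p (sp e N (fun n w => s n w * c n w)) <= K * nrm P p (sp e N c).
Proof.
move=> s1; have p1' := ltW p1; have p0 : 0 < p by exact: lt_trans p1.
have H (L : seq (nat * seq bool)) : forall t : nat -> seq bool -> R,
   (forall n w, `|t n w| <= 1) -> (forall n w, (n, w) \notin L -> `|t n w| = 1) ->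
   nrm P p (sp e N (fun n w => t n w * c n w)) <= K * nrm P p (sp e N c).
  elim: L => [t _ t1|[m v] L IH t t1 tL]; first by apply: multiplier_sign => n w; exact: t1.
  pose up (z : R) n w := if (n == m) && (w == v) then z else t n w.
  have up1 z n w : `|z| = 1 -> `|up z n w| <= 1.
    by move=> z1; rewrite /up; case: ifP => _; rewrite ?z1.
  have upL z n w : `|z| = 1 -> (n, w) \notin L -> `|up z n w| = 1.
    move=> z1 nL; rewrite /up; case: ifPn => // nm; apply: tL.
    by rewrite inE negb_or nL andbT xpair_eqE.
  have N1 : `|(-1 : R)| = 1 by rewrite normrN1.
  have B1 := IH (up 1) (fun n w => up1 1 n w (normr1 R)) (fun n w => upL 1 n w (normr1 R)).
  have B2 := IH (up (-1)) (fun n w => up1 _ n w N1) (fun n w => upL _ n w N1).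
  pose x := t m v; have := t1 m v; rewrite -/x ler_norml => /andP[x1 x2].
  have E : sp e N (fun n w => t n w * c n w) = fun om =>
     (1 + x) / 2 * sp e N (fun n w => up 1 n w * c n w) om +
     ((1 - x) / 2 * sp e N (fun n w => up (-1) n w * c n w) om).
    apply/funext => om; rewrite /sp !mulr_sumr -big_split; apply: eq_bigr => n _ /=.
    rewrite !mulr_sumr -big_split; apply: eq_bigr => w _ /=; rewrite /up.
    case: ifP => [/andP[/eqP E1 /eqP E2]|_]; last by field.
    by rewrite E1 E2 -/x; field.
  have [m2 n2] := memLpZ p1' ((1 - x) / 2) (sp_mem_r N (fun n w => up (-1) n w * c n w) p0).
  rewrite E; apply: le_trans (nrm_lin p1' ((1 + x) / 2) (sp_mem_r N _ p0) m2) _.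
  rewrite n2 !ger0_norm; [|lra|lra].
  have C1 := ler_wpM2l (_ : 0 <= (1 + x) / 2) B1.
  have C2 := ler_wpM2l (_ : 0 <= (1 - x) / 2) B2.
  have D1 : 0 <= (1 + x) / 2 by lra.
  have D2 : 0 <= (1 - x) / 2 by lra.
  by move: (C1 D1) (C2 D2); nra.
pose L := [seq (n, w) | n <- iota 0 N, w <- W n].
pose t n w := if (n, w) \in L then s n w else 1.
have tE : sp e N (fun n w => s n w * c n w) = sp e N (fun n w => t n w * c n w).
  apply/funext => om; rewrite /sp; apply: eq_bigr => n _; apply: eq_big_seq => w wn.
  rewrite /t; suff -> : (nat_of_ord n, w) \in L by [].
  by apply/allpairsPdep; exists (nat_of_ord n), w; rewrite mem_iota ltn_ord.
rewrite tE; apply: (H L) => n w; rewrite /t; last by move/negbTE ->; rewrite normr1.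
case: ifP => [/allpairsPdep[n' [w' [_ wn [-> ->]]]]|_]; last by rewrite normr1.
by apply: s1; rewrite -mem_W.
Qed.

(** The norm is at most the sum of the moduli of the Haar coefficients, proved without expanding
    [u]. A coarse approximant [g] fixes [N]; a much finer [g'] has coefficients close to those of
    [u]; its truncation [Pg] to the trees below [N] is bounded termwise. *)
Lemma coef_bound (a : nat -> seq bool -> R) (S : R) u : cspan P p e u ->
  (forall n w, (size w < n)%N -> `|pairing P (e n w) u| <= a n w * 2 ^- size w) ->
  (forall N, \sum_(n < N) \sum_(w <- W n) a n w <= S) -> nrm P p u <= S.
Proof.
move=> Xu au aS; have p1' := ltW p1; have p0 : 0 < p by exact: lt_trans p1.
have q0 : 0 < conj_exp p by exact: lt_trans (conj_exp_gt1 p1).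
have mu := proj1 Xu; have K1 := cmul_ge1 p1.
apply/ler_addgt0Pr => eps e0.
(* The errors are [eta] for u - g, 2 K [eta] for g - Pg, truncation being a multiplier, and [eta]
   for the coefficients of [Pg]. *)
pose eta := eps / (2 + 2 * K).
have eta0 : 0 < eta by rewrite divr_gt0//; lra.
have [N [c Nc]] := proj2 Xu _ eta0.
pose CN : R := \sum_(n < N) \sum_(w <- W n) 2 ^+ size w.
have CN0 : 0 <= CN by apply: sumr_ge0 => n _; apply: sumr_ge0 => w _; rewrite exprn_ge0.
(* Reading a coefficient off a pairing costs 2^|w|; [CN] is the total cost over the first [N]
   trees. *)
pose eta' := eta / (CN + 1).
have CN1 : 0 < CN + 1 by lra.
have eta'0 : 0 < eta' by rewrite divr_gt0.
have eta'le : eta' <= eta by rewrite ler_pdivrMr// ler_peMr ?(ltW eta0)// lerDr.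
have [N' [c' Nc']] := proj2 Xu _ eta'0.
pose g := sp e N c; pose g' := sp e N' c'.
have mg : memLp P p g by exact: sp_mem_r.
have mg' : memLp P p g' by exact: sp_mem_r.
pose M := maxn N N'; pose cM n w := (n < N')%N%:R * c' n w.
pose tr n w := (n < N)%N%:R * c n w.
have gM : g = sp e M tr by exact: sp_widen (leq_maxl _ _).
have gM' : g' = sp e M cM by exact: sp_widen (leq_maxr _ _).
pose Pg := sp e N cM.
have mPg : memLp P p Pg by exact: sp_mem_r.
have b1 : nrm P p (fun w => g w - Pg w) <= K * nrm P p (fun w => g w - g' w).
  have E1 : (fun w => g w - g' w) = sp e M (fun n w => tr n w - cM n w).
    apply/funext => om; rewrite gM gM' /sp -sumrB; apply: eq_bigr => n _.
    by rewrite -sumrB; apply: eq_bigr => w _; rewrite mulrBl.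
  have E2 : (fun w => g w - Pg w) = sp e M (fun n w => (n < N)%N%:R * (tr n w - cM n w)).
    rewrite /Pg (sp_widen cM e (leq_maxl N N')) gM.
    apply/funext => om; rewrite /sp -sumrB; apply: eq_bigr => n _.
    rewrite -sumrB; apply: eq_bigr => w _; rewrite /tr.
    by case: (n < N)%N; rewrite ?mul1r ?mul0r ?subrr ?mulrBl.
  rewrite E1 E2; apply: multiplier => n w _; by case: (n < N)%N; rewrite ?normr1 ?normr0.
have b2 : nrm P p Pg <= S + eta.
  apply: le_trans (sp_nrm_sum N cM p1') _.
  apply: (@le_trans _ _ (\sum_(n < N) \sum_(w <- W n) (a n w + 2 ^+ size w * eta'))).
    apply: ler_sum => n _; rewrite big_seq [leRHS]big_seq; apply: ler_sum => w; rewrite mem_W => wn.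
    have me := e_mem q0 wn.
    have := pairing_sub p1 me mg' mu; rewrite [pairing P (e n w) g']coef_sp// -/(cM n w).
    rewrite nrm_distC => h1.
    have h2 : nrm P (conj_exp p) (e n w) * nrm P p (fun w => u w - g' w) <= eta'.
      by rewrite -[leRHS]mul1r ler_pM ?nrm_ge0 ?e_nrm_le1// ltW.
    have h3 := au n w wn.
    have h4 : `|cM n w * 2 ^- size w| <= a n w * 2 ^- size w + eta'.
      by have := ler_distD 0 (cM n w * 2 ^- size w) (pairing P (e n w) u);
         have := ler_normD (cM n w * 2 ^- size w - pairing P (e n w) u) (pairing P (e n w) u);
         rewrite subrK => h5 _; lra.
    have P2 : 0 < 2 ^- size w :> R by rewrite invr_gt0 exprn_gt0.
    rewrite -(ler_pM2r P2); move: h4; rewrite normrM (ger0_norm (ltW P2)) mulrDl.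
    by rewrite mulrAC mulfV ?expf_neq0// mul1r.
  under eq_bigr do rewrite big_split /= -mulr_suml.
  rewrite big_split /= -mulr_suml -/CN; apply: lerD; first exact: aS.
  rewrite /eta' mulrA ler_pdivrMr// mulrC ler_wpM2l ?(ltW eta0)//; lra.
have b3 := nrm_triangle p1' (g := u) mg mu mg'.
have b0 : nrm P p (fun w => g w - u w) < eta by rewrite nrm_distC.
have b4 := nrm_le_sub p1' mu mg; have b5 := nrm_le_sub p1' mg mPg.
have K0 : 0 <= K by lra.
have b6 : K * nrm P p (fun w => g w - g' w) <= K * (2 * eta).
  by apply: ler_wpM2l => //; apply: le_trans b3 _; rewrite -/g' in Nc'; lra.
have E : eta * (2 + 2 * K) = eps by rewrite /eta divfK// gt_eqF//; lra.
rewrite -/g in Nc; lra.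
Qed.

End Multiplier.

End HaarSums.

(** * Factorization of the identity *)

Lemma sum_window (R : realType) m lo N :
  \sum_(k < m) ((lo <= k < lo + N)%N)%:R <= N%:R :> R.
Proof.
rewrite -natr_sum ler_nat.
suff : (\sum_(k < m) (lo <= k < lo + N) <= minn N (m - lo))%N.
  by move/leq_trans; apply; exact: geq_minl.
elim: m => [|m IH]; first by rewrite big_ord0.
rewrite big_ord_recr /=; move: IH; set S := (\sum_(k < m) _)%N.
by case: (boolP (lo <= m < lo + N)%N) => /=; lia.
Qed.

Lemma iterL_mono (R : realType) F l (Phi Psi : R -> R) z : (forall x, Phi x <= Psi x) ->
  iterL F l Phi z <= iterL F l Psi z.
Proof. by move=> H; elim: l z => //= n l IH z; apply: le_avg => x _; exact: IH. Qed.

(** Jensen with mean-zero increments; this discards the trees that carry no block. *)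
Lemma iterL_ge (R : realType) (c : nat -> seq bool -> R) l Phi z : supline Phi ->
  Phi z <= iterL (fun n => Mt n (c n)) l Phi z.
Proof.
move=> sPhi; elim: l z => //= n l IH z.
apply: (@le_trans _ _ (avg n (fun x => Phi (z + Mt n (c n) x)))); last exact: le_avg.
have := @jensen_avg R Phi n (fun x => z + Mt n (c n) x) sPhi.
by rewrite avgD avg_cst avg_Mt addr0.
Qed.

(** * The operator, its blocks and the factorization *)

Section Core.
Context (d : measure_display) (Omega : measurableType d) (R : realType).
Variables (P : probability Omega R) (h : nat -> nat -> nat -> Omega -> R) (p : R).
Hypotheses (hP : BRS_copy P h) (p1 : 1 < p).

Local Notation e := (hh h).
Local Notation q := (conj_exp p).
Local Notation X := (cspan P p e).
Local Notation nrmp := (nrm P p).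
Local Notation mem := (memLp P p).

Let p1' : 1 <= p. Proof. exact: ltW. Qed.
Let p0 : 0 < p. Proof. exact: lt_trans p1. Qed.
Let q1 : 1 < q. Proof. exact: conj_exp_gt1. Qed.
Let q0 : 0 < q. Proof. exact: lt_trans q1. Qed.
Let me n w : (size w < n)%N -> mem (e n w). Proof. exact: e_mem. Qed.
Let mq n w : (size w < n)%N -> memLp P q (e n w). Proof. exact: e_mem. Qed.

Let Xm f : X f -> mem f. Proof. by case. Qed.

Lemma cspan_scale a f : X f -> X (fun w => a * f w).
Proof.
move=> Xf; have := cspan_lin p1' me a Xf (cspan0 p1' me).
by congr cspan; apply/funext => w; rewrite addr0.
Qed.

Lemma cspan_tf n b : X (tf h n b).
Proof. by rewrite /tf (tf_sp n b e); exact: cspan_sp. Qed.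

Lemma pairing_eq g f f' : memLp P q g -> mem f -> mem f' ->
  nrmp (fun w => f w - f' w) = 0 -> pairing P g f = pairing P g f'.
Proof.
move=> mg mf mf' E; have := pairing_sub p1 mg mf mf'.
by rewrite E mulr0 normr_le0 subr_eq0 => /eqP.
Qed.

Lemma pairing_scalel a g f : memLp P q g -> mem f ->
  pairing P (fun w => a * g w) f = a * pairing P g f.
Proof.
move=> mg mf; have [z _] := mem0 P (ltW q1).
have := pairing_linl p1 a mg z mf; rewrite (pairing0l p1 mf) addr0 => <-.
by congr pairing; apply/funext => w; rewrite addr0.
Qed.

Lemma pairing_spy g (y : nat -> seq bool -> Omega -> R) N c : memLp P q g ->
  (forall n w, (size w < n)%N -> mem (y n w)) ->
  pairing P g (sp y N c) = \sum_(n < N) \sum_(w <- W n) c n w * pairing P g (y n w).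
Proof.
move=> mg my; elim: N => [|N IH].
  rewrite big_ord0 (_ : sp y 0 c = fun=> 0); first exact: (pairing0 p1 mg).
  by apply/funext => om; rewrite /sp big_ord0.
have [|m E] := @pairing_sum _ _ _ P p p1 _ (W N) (c N) g (y N) mg.
  by move=> w; rewrite mem_W; exact: my.
rewrite big_ord_recr /= -IH -E -[X in X + _]mul1r.
have -> : sp y N.+1 c = fun om => 1 * sp y N c om + \sum_(w <- W N) c N w * y N w om.
  by apply/funext => om; rewrite /sp big_ord_recr mul1r.
by rewrite (pairing_lin p1)//; exact: (sp_mem p1').
Qed.

Lemma pairing_op_sp T C g N c : bounded_op P p X T C -> memLp P q g ->
  pairing P g (T (sp e N c)) =
  \sum_(n < N) \sum_(w <- W n) c n w * pairing P g (T (e n w)).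
Proof.
move=> bT mg; have Xy n w : (size w < n)%N -> X (T (e n w)).
  by move=> wn; apply: (op_X bT); exact: cspan_e.
have [|XS E] := op_sp p1' me bT N c Xy; first by move=> n w _; exact: nrm_subself.
rewrite -(pairing_spy N c mg (fun n w wn => Xm (Xy n w wn))).
apply: pairing_eq => //; last exact: Xm.
by apply/Xm/(op_X bT); exact: cspan_sp.
Qed.

(** Agreement on the Haar system extends to the closed span, so [g2] acts as the adjoint image of
    [g1] under [S] without a dual space. *)
Lemma pairing_extend S K g1 g2 : bounded_op P p X S K -> memLp P q g1 -> memLp P q g2 ->
  (forall n w, (size w < n)%N -> pairing P g1 (S (e n w)) = pairing P g2 (e n w)) ->
  forall f, X f -> pairing P g1 (S f) = pairing P g2 f.
Proof.
move=> bS m1 m2 H f Xf.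
have Hsp N c : pairing P g1 (S (sp e N c)) = pairing P g2 (sp e N c).
  rewrite (pairing_op_sp N c bS m1) (pairing_spy N c m2 me).
  apply: eq_bigr => n _; apply: eq_big_seq => w; rewrite mem_W => wn.
  by rewrite H.
apply/eqP; rewrite -subr_eq0 -normr_le0; apply/ler_addgt0Pr => eps e0; rewrite add0r.
pose A := nrm P q g1 * K + nrm P q g2.
have K0 := op_C0 bS.
have n1 := nrm_ge0 P q g1; have n2 := nrm_ge0 P q g2.
have A0 : 0 <= A by rewrite addr_ge0// mulr_ge0.
have A1 : 0 < A + 1 by lra.
have [N [c Nc]] := proj2 Xf _ (divr_gt0 e0 A1).
pose g := sp e N c; have Xg : X g by exact: cspan_sp.
have b1 := pairing_sub p1 m1 (Xm (op_X bS Xf)) (Xm (op_X bS Xg)).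
have b2 := pairing_sub p1 m2 (Xm Xf) (Xm Xg).
have b3 := op_sub p1' me bS Xf Xg.
have b4 := ler_wpM2l n1 b3.
rewrite -/g in Nc; rewrite Hsp -/g in b1.
have b5 := ler_normD (pairing P g1 (S f) - pairing P g2 g) (pairing P g2 g - pairing P g2 f).
rewrite addrA subrK in b5; rewrite distrC in b2.
have b6 : A * nrmp (fun w => f w - g w) <= A * (eps / (A + 1)).
  by apply: ler_wpM2l => //; exact: ltW.
have b7 : A * (eps / (A + 1)) <= eps.
  by rewrite mulrA ler_pdivrMr// mulrC ler_wpM2l ?(ltW e0)//; lra.
have E : A * nrmp (fun w => f w - g w) = nrm P q g1 * (K * nrmp (fun w => f w - g w)) +
   nrm P q g2 * nrmp (fun w => f w - g w) by rewrite /A; ring.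
lra.
Qed.

(** For [u] the modulus divided by N, which lies in [0, 1], u^r <= u <= tau + u^2 / tau. By
    orthogonality u^2 has mean at most 1/N, so the mean of u^r is at most tau + 1 / (N tau) <= 2 tau
    = eta^r once N >= tau^-2. *)
Lemma level_small (r eta : R) : 1 < r -> 0 < eta -> exists N0, forall m c lo N,
  (N0 <= N)%N -> (forall J, `|c J| <= 1) ->
  (forall J, ~~ (lo <= size J < lo + N)%N -> c J = 0) ->
  nrm P r (tf h m c) <= eta * N%:R.
Proof.
move=> r1 eta0; have r0 : 0 < r by exact: lt_trans r1.
pose tau := eta `^ r / 2.
have tau0 : 0 < tau by rewrite divr_gt0// powR_gt0.
exists (Num.bound (tau ^- 2)).+1 => m c lo N NN c1 c0.
have N0 : 0 < N%:R :> R by rewrite ltr0n (leq_trans _ NN).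
have Nt : tau ^- 2 <= N%:R.
  have h1 : tau ^- 2 < (Num.bound (tau ^- 2))%:R by apply: archi_boundP; rewrite invr_ge0 exprn_ge0// ltW.
  by apply: le_trans (ltW h1) _; rewrite ler_nat (leq_trans (leqnSn _) NN).
have cw J : `|c J| <= ((lo <= size J < lo + N)%N)%:R.
  by case: (boolP (lo <= size J < lo + N)%N) => Jw; [exact: c1|rewrite c0// normr0].
have sN x : size x = m -> `|Mt m c x| <= N%:R.
  move=> xm; apply: le_trans (sum_window R m lo N).
  apply: le_trans (ler_norm_sum _ _ _) _; apply: ler_sum => k _.
  rewrite normrM normr_sgnb mulr1; have := cw (take k x).
  by rewrite size_takel// xm ltnW.
have s2 : ipt m c c <= N%:R.
  apply: le_trans (sum_window R m lo N); apply: ler_sum => k _.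
  rewrite -(avg_cst k (((lo <= k < lo + N)%N)%:R)); apply: le_avg => x xk.
  have := cw x; rewrite xk -expr2 -real_normK ?num_real// => h1.
  have h2 := normr_ge0 (c x); have h3 := c1 x; nra.
apply: tf_nrm_le => //; first by rewrite mulr_ge0// ltW.
pose B x := N%:R `^ r * (tau + Mt m c x * Mt m c x / (N%:R ^+ 2 * tau)).
have N2 : 0 < N%:R ^+ 2 * tau :> R by rewrite mulr_gt0// exprn_gt0.
apply: (@le_trans _ _ (avg m B)).
  apply: le_avg => x xm; pose u := `|Mt m c x| / N%:R.
  have u0 : 0 <= u by rewrite divr_ge0// ltW.
  have u1 : u <= 1 by rewrite ler_pdivrMr// mul1r sN.
  have -> : `|Mt m c x| `^ r = N%:R `^ r * u `^ r.
    by rewrite -powRM ?(ltW N0)// /u mulrC divfK// gt_eqF.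
  rewrite /B ler_wpM2l ?powR_ge0//.
  have ur : u `^ r <= u.
    move: u0; rewrite le_eqVlt => /predU1P[<-|u0]; first by rewrite powR0 ?gt_eqF.
    by apply: ge1r_powR; rewrite ?u0 ?u1 ?(ltW r1).
  apply: le_trans ur _.
  have -> : Mt m c x * Mt m c x / (N%:R ^+ 2 * tau) = u ^+ 2 / tau.
    rewrite /u expr_div_n real_normK ?num_real// expr2; field.
    by rewrite !gt_eqF.
  rewrite -(ler_pM2r tau0) mulrDl divfK ?gt_eqF//.
  by have := sqr_ge0 (u - tau); nra.
rewrite /B avgZ avgD avg_cst avgZr avg_MtM0 powRM ?(ltW eta0) ?(ltW N0)// mulrC.
rewrite ler_wpM2r ?powR_ge0//.
have -> : eta `^ r = tau + tau by rewrite /tau; field.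
rewrite lerD2l ler_pdivrMr//; apply: le_trans s2 _.
have : 1 <= N%:R * tau ^+ 2.
  by rewrite -ler_pdivrMr ?exprn_gt0// mul1r.
by nra.
Qed.

Lemma unit_block_nrm r m b : 0 < r -> unit_block b -> nrm P r (tf h m b) <= 1.
Proof.
move=> r0 [b1 [k bk]]; apply: tf_nrm_le1 => // x xm.
have [km|km] := ltnP k m.
  by rewrite (Mt_level bk) ?xm// normrM normr_sgnb mulr1.
rewrite /Mt big1 ?normr0// => i _; rewrite bk ?mul0r//.
by rewrite size_takel ?xm 1?ltnW// neq_ltn (leq_trans (ltn_ord i) km).
Qed.

Section Matrix.
Variables (T : (Omega -> R) -> Omega -> R) (L : R).
Hypothesis bT : bounded_op P p X T L.

Definition mat m J m' J' : R := pairing P (e m J) (T (e m' J')).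

Lemma QE m b m' c : Q mat m b m' c = pairing P (tf h m b) (T (tf h m' c)).
Proof.
have mTf : mem (T (tf h m' c)) by apply/Xm/(op_X bT)/cspan_tf.
have [|_ ->] := @pairing_suml _ _ _ P p p1 _ (W m) b (T (tf h m' c)) (e m) mTf.
  by move=> w; rewrite mem_W; exact: mq.
apply: eq_big_seq => J; rewrite mem_W => Jm.
rewrite /tf (tf_sp m' c e) (pairing_op_sp _ _ bT (mq Jm)) big_ord_recr /= [X in _ = _ * (X + _)]big1.
  rewrite add0r mulr_sumr; apply: eq_bigr => J' _; rewrite /emb eqxx /mat; ring.
by move=> i _; rewrite big1// => w _; rewrite /emb (ltn_eqF (ltn_ord i)) mul0r.
Qed.

(** Hölder, with [level_small] in L_p when the long sum is under [T] and in L_q when it is the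
    functional. *)
Lemma tame_mat : tame mat.
Proof.
move=> eps e0; have L0 := op_C0 bT.
have L1 : 0 < L + 1 by lra.
have eta0 := divr_gt0 e0 L1.
have [Np HNp] := level_small p1 eta0; have [Nq HNq] := level_small q1 eta0.
exists (maxn Np Nq) => m' b' ub m c lo N; rewrite geq_max => /andP[N1 N2] c1 c0.
have np := HNp m c lo N N1 c1 c0; have nq := HNq m c lo N N2 c1 c0.
have le : L * (eps / (L + 1) * N%:R) <= eps * N%:R.
  rewrite mulrA ler_wpM2r// mulrA ler_pdivrMr// mulrC ler_wpM2l ?(ltW e0)//; lra.
have mt r k b : 0 < r -> memLp P r (tf h k b) by exact: tf_mem.
have hb b k := op_bound bT (cspan_tf k b).
rewrite !QE; split.
  have [_ H] := pairing_hoelder p1 (mt _ m' b' q0) (Xm (op_X bT (cspan_tf m c))).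
  apply: le_trans H _; apply: le_trans le.
  rewrite -[leRHS]mul1r ler_pM ?nrm_ge0 ?unit_block_nrm//.
  by apply: le_trans (hb _ _) _; rewrite ler_wpM2l.
have [_ H] := pairing_hoelder p1 (mt _ m c q0) (Xm (op_X bT (cspan_tf m' b'))).
apply: le_trans H _; apply: le_trans le; rewrite mulrC.
rewrite ler_pM ?nrm_ge0//; apply: le_trans (hb _ _) _.
by rewrite -[leRHS]mulr1 ler_wpM2l// unit_block_nrm.
Qed.

End Matrix.

Lemma extend_multiplier (s : nat -> seq bool -> R) (K : R) : 0 < K ->
  (forall n w, (size w < n)%N -> `|s n w| <= K) ->
  exists S, bounded_op P p X S (cmul p * K) /\
   forall n w, (size w < n)%N -> nrmp (fun om => S (e n w) om - s n w * e n w om) = 0.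
Proof.
move=> K0 sK; have c1 := cmul_ge1 p1.
apply: (extend_op p1' me (y := fun n w om => s n w * e n w om)).
- by rewrite mulr_ge0 ?(ltW K0)//; lra.
- by move=> n w wn; apply: cspan_scale; exact: cspan_e.
move=> N c; have E : sp (fun n w om => s n w * e n w om) N c =
    sp e N (fun n w => (s n w / K) * (K * c n w)).
  apply/funext => om; rewrite /sp; apply: eq_bigr => n _; apply: eq_bigr => w _.
  by field; rewrite gt_eqF.
rewrite E; apply: le_trans (multiplier hP p1 N _ _) _.
  by move=> n w wn; rewrite normrM normfV (gtr0_norm K0) ler_pdivrMr// mul1r sK.
have E2 : sp e N (fun n w => K * c n w) = fun om => K * sp e N c om.
  apply/funext => om; rewrite /sp mulr_sumr; apply: eq_bigr => n _.
  by rewrite mulr_sumr; apply: eq_bigr => w _; rewrite mulrA.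
rewrite E2; have [_ ->] := memLpZ p1' K (sp_mem_r hP N c p0).
by rewrite gtr0_norm// mulrA.
Qed.

Section BlockOps.
Variables (mu nu : nat -> nat) (beta : nat -> seq bool -> seq bool -> R)
  (kap : nat -> seq bool -> nat).
Hypothesis nuK : cancel mu nu.
Hypothesis sys : forall n w, (size w < n)%N -> bok (beta n) (kap n) (mu n) w.

Let mu_inj : injective mu. Proof. exact: can_inj nuK. Qed.

Lemma block_embedding : exists B, bounded_op P p X B 1 /\
  forall n w, (size w < n)%N -> nrmp (fun om => B (e n w) om - tf h (mu n) (beta n w) om) = 0.
Proof.
apply: (extend_op p1' me (y := fun n w => tf h (mu n) (beta n w))) => //.
  by move=> n w _; exact: cspan_tf.
(* The block sum, with its coefficients regrouped by the tree [m = mu n] that carries them. *)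
move=> N c; pose C m J := \sum_(w <- W (nu m)) c (nu m) w * beta (nu m) w J.
have E : sp (fun n w => tf h (mu n) (beta n w)) N c = tsum h (map mu (iota 0 N)) C.
  apply/funext => om; rewrite /tsum big_map /sp.
  rewrite -(big_mkord xpredT (fun n => \sum_(w <- W n) c n w * tf h (mu n) (beta n w) om)).
  rewrite /index_iota subn0; apply: eq_bigr => n _; rewrite /tf /C nuK.
  under [LHS]eq_bigr do rewrite mulr_sumr.
  rewrite exchange_big /=; apply: eq_bigr => J _; rewrite mulr_suml.
  by apply: eq_bigr => w _; rewrite mulrA.
rewrite E spE; apply: tsum_nrm_le => //; rewrite ?map_inj_uniq ?iota_uniq//.
rewrite powR1 mul1r le_eqVlt; apply/orP; left; apply/eqP.
elim: (iota 0 N) (0 : R) => //= n l IH z.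
under eq_avg do rewrite IH.
rewrite -(block_isometry (sys (n := n)) (fun t => iterL (fun n => Mt n (c n)) l (fun x => `|x| `^ p) (z + t)) (c n)).
by rewrite /C nuK.
Qed.

(** Tree-wise conditional expectation, defined on Haar functions only. It is contractive because
    trees outside the range of [mu] are removed by [iterL_ge] and the others are projected one at a
    time. *)
Lemma block_projector : exists A, bounded_op P p X A 1 /\
  forall n w f, (size w < n)%N -> X f ->
    pairing P (e n w) (A f) = pairing P (tf h (mu n) (beta n w)) f.
Proof.
(* Outside the range of [mu] the value of [nu] is meaningless, and [y] is set to 0. *)
pose used m := mu (nu m) == m.
(* The coefficient at [w] is the pairing of the block of [w] with the Haar function of [J], divided
   by 2^-|w|, the squared L_2 norm of the Haar function of [w]. *)
pose y m J := if used m then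
  tf h (nu m) (fun w => 2 ^+ size w * (2 ^- size J * beta (nu m) w J)) else fun=> 0.
have Xy m J : X (y m J).
  by rewrite /y; case: ifP => _; [exact: cspan_tf|exact: cspan0].
have [|A [bA AE]] := @extend_op _ _ _ P p p1' e me y 1 ler01 (fun m J _ => Xy m J).
- move=> M c; pose G n w := 2 ^+ size w * ipt (mu n) (c (mu n)) (beta n w).
  pose lu := [seq m <- iota 0 M | used m]; pose ln := [seq m <- iota 0 M | ~~ used m].
  pose l := map nu lu.
  have mul : map mu l = lu.
    rewrite /l -map_comp -[RHS]map_id; apply/eq_in_map => m.
    by rewrite mem_filter => /andP[/eqP].
  have E : sp y M c = tsum h l G.
    apply/funext => om; rewrite /tsum big_map big_filter /sp.
    rewrite -(big_mkord xpredT (fun m => \sum_(J <- W m) c m J * y m J om)).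
    rewrite /index_iota subn0 [RHS]big_mkcond /=; apply: eq_bigr => m _.
    rewrite /y; case: ifP => [um|_]; last by rewrite big1// => J _; rewrite mulr0.
    rewrite /tf /G (eqP um); under eq_bigr do rewrite mulr_sumr.
    rewrite exchange_big /=; apply: eq_bigr => w _; rewrite iptE mulr_sumr mulr_suml.
    by apply: eq_bigr => J _; ring.
  have E2 : sp e M c = tsum h (map mu l ++ ln) c.
    rewrite spE mul; apply/funext => om; rewrite /tsum; apply: perm_big.
    by rewrite perm_sym; have /permPl := perm_filterC used (iota 0 M); exact.
  have ul : uniq (map mu l ++ ln).
    rewrite mul (perm_uniq (_ : perm_eq _ (iota 0 M))) ?iota_uniq//.
    by have /permPl := perm_filterC used (iota 0 M); exact.
  rewrite E E2; apply: tsum_nrm_le => //.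
    by move: ul; rewrite cat_uniq => /andP[/map_uniq].
  rewrite powR1 mul1r iterL_cat.
  have sp_ : supline (fun x : R => `|x| `^ p) by exact: supline_powR.
  apply: (@le_trans _ _ (iterL (fun n => Mt n (c n)) (map mu l) (fun x => `|x| `^ p) 0)).
    elim: (l) (0 : R) => //= n l' IH z.
    apply: (@le_trans _ _ (avg n (fun x => iterL (fun n => Mt n (c n)) (map mu l')
       (fun x => `|x| `^ p) (z + Mt n (G n) x)))).
      by apply: le_avg => x _; exact: IH.
    (* The average over the remaining trees is convex in the current sum, so it can serve as [Psi]
       in [block_projection]. *)
    have sI : supline (fun t => iterL (fun n => Mt n (c n)) (map mu l') (fun x => `|x| `^ p) (z + t)).
      move=> t0; have [s sP] := supline_iterL (fun n => Mt n (c n)) (map mu l') sp_ (z + t0).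
      by exists s => t; have := sP (z + t); rewrite opprD addrACA subrr add0r.
    exact: (block_projection (sys (n := n)) (c (mu n)) sI).
  by apply: iterL_mono => x; exact: (@iterL_ge R c ln (fun x => `|x| `^ p) x sp_).
exists A; split=> // n w f wn Xf.
apply: (pairing_extend bA (mq wn) (tf_mem hP _ _ q0)) => // m J Jm.
have XA : X (A (e m J)) by apply: (op_X bA); exact: cspan_e.
rewrite (pairing_eq (mq wn) (Xm XA) (Xm (Xy m J)) (AE m J Jm)).
have -> : pairing P (tf h (mu n) (beta n w)) (e m J) = pairing P (e m J) (tf h (mu n) (beta n w)).
  by apply: eq_Rintegral => om _; rewrite mulrC.
rewrite (coef_tf hP _ _ Jm) /y; case: ifP => [um|um].
  have Emn : (m == mu n) = (n == nu m).
    by apply/eqP/eqP => [->|->]; [rewrite nuK|rewrite (eqP um)].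
  rewrite (coef_tf hP _ _ wn) Emn; case: eqP => [<-|_]; last by rewrite !mul0r.
  by field; rewrite !expf_neq0.
rewrite (pairing0 p1 (mq wn)).
have -> : (m == mu n) = false; last by rewrite !mul0r.
by apply/negbTE; apply: contraFneq um => ->; rewrite /used nuK.
Qed.

End BlockOps.

(** Tree [n] has fewer than 2^n nodes, so a weight 4^-n per node leaves a geometric series. *)
Lemma sum_W_quarter N : \sum_(n < N) \sum_(w <- W n) 4 ^- n <= 2 :> R.
Proof.
apply: (@le_trans _ _ (\sum_(n < N) 2 ^- n)).
  apply: ler_sum => n _; rewrite big_const_seq count_predT iter_addr_0 -[leLHS]mulr_natr.
  have -> : 4 ^- n = 2 ^- n * 2 ^- n :> R by rewrite -invfM -exprMn; congr (_ ^- _); ring.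
  rewrite -mulrA -[leRHS]mulr1 ler_wpM2l ?invr_ge0 ?exprn_ge0// mulrC ler_pdivrMr ?exprn_gt0//.
  by rewrite mul1r -natrX ler_nat -size_W.
suff : \sum_(n < N) 2 ^- n <= 2 - 2 * 2 ^- N :> R.
  by move/le_trans; apply; rewrite gerBl mulr_ge0// invr_ge0 exprn_ge0.
elim: N => [|N IH]; first by rewrite big_ord0 expr0 invr1 mulr1 subrr.
rewrite big_ord_recr /=; have -> : 2 ^- N.+1 = 2 ^- N / 2 :> R by rewrite exprS invfM mulrC.
by lra.
Qed.

Lemma factor_identity (T : (Omega -> R) -> Omega -> R) (C delta eps : R) :
  bounded_op P p X T C -> 0 < delta -> 0 < eps < 1 ->
  (forall n w, (size w < n)%N ->
     delta * 2 ^- size w <= `|pairing P (e n w) (T (e n w))|) ->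
  exists A B a b, [/\ bounded_op P p X A a, bounded_op P p X B b,
    forall f, X f -> A (T (B f)) = f %[ae P] &
    a * b = cmul p ^+ 2 / (delta * (1 - eps))].
Proof.
move=> bT d0 /andP[e0 e1] dT.
pose s n w : R := if 0 <= pairing P (e n w) (T (e n w)) then 1 else -1.
have s1 n w : `|s n w| <= 1 by rewrite /s; case: ifP => _; rewrite ?normrN normr1.
have [M [bM ME]] := extend_multiplier ltr01 (fun n w _ => s1 n w).
have bT' := op_comp p1' me bT bM.
have scT n w a : (size w < n)%N ->
    pairing P (e n w) (T (fun om => a * e n w om)) = a * pairing P (e n w) (T (e n w)).
  move=> wn; rewrite (sp_single e a wn) (pairing_op_sp _ _ bT (mq wn)).
  rewrite big_ord_recr /= big1 ?add0r.
    rewrite (big_rem w) ?mem_W//= !eqxx mul1r big_seq big1 ?addr0// => w'.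
    by rewrite mem_rem_uniq ?uniq_W// inE => /andP[/negbTE-> _]; rewrite !mul0r.
  by move=> i _; rewrite big1// => w' _; rewrite (ltn_eqF (ltn_ord i)) !mul0r.
have diagT' m J : (size J < m)%N -> delta * 2 ^- size J <= mat (T \o M) m J m J.
  move=> Jm; have Xe := cspan_e p1' me Jm; have XM := op_X bM Xe.
  have Xs := cspan_scale (s m J) Xe.
  have E := op_eq0 p1' me bT XM Xs (ME _ _ Jm).
  rewrite /mat /= (pairing_eq (mq Jm) (Xm (op_X bT XM)) (Xm (op_X bT Xs)) E) scT//.
  apply: le_trans (dT _ _ Jm) _; rewrite /s; case: ifPn => [h0|].
    by rewrite mul1r ger0_norm.
  by rewrite -ltNge => h0; rewrite ltr0_norm// mulN1r.
(* 64 to the minus max(n, n') is at most 8^-n 8^-n'. Of 8^-n, a factor 2^-n pays for the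
   normalization 2^|w| and 4^-n for the sum over nodes; each of the two sums costs 2, whence the 4,
   and [delta] cancels the bound on [dinv]. *)
pose tol n : R := eps * delta / 4 * 64 ^- n.
have tol0 n : 0 < tol n by rewrite mulr_gt0 ?invr_gt0 ?exprn_gt0// divr_gt0// mulr_gt0.
have [mu [beta [kap [mumono sys Qdiag Qoff]]]] := block_selection (tame_mat bT') diagT' tol0.
have mu_inj : injective mu.
  by move=> n n' E; have [lt|lt|//] := ltngtP n n'; have := mumono _ _ lt; rewrite E ltnn.
have /choice[nu nuP] : forall m, exists n, (exists n', mu n' = m) -> mu n = m.
  move=> m; have [[n' E]|ne] := pselect (exists n', mu n' = m); first by exists n'.
  by exists 0%N.
have nuK : cancel mu nu by move=> n; apply: mu_inj; apply: nuP; exists n.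
have [B [bB BE]] := block_embedding nuK sys.
have [A0 [bA0 A0E]] := block_projector nuK sys.
pose b n w := tf h (mu n) (beta n w).
have mb n w : memLp P q (b n w) by exact: tf_mem.
pose D n w := Q (mat (T \o M)) (mu n) (beta n w) (mu n) (beta n w).
(* The inverse of the normalized diagonal of A0 T' B. *)
pose dinv n w := 2 ^- size w / D n w.
have D0 n w : (size w < n)%N -> 0 < D n w.
  move=> wn; apply: lt_le_trans (Qdiag n w wn).
  by rewrite mulr_gt0 ?invr_gt0 ?exprn_gt0.
have dinv_le n w : (size w < n)%N -> `|dinv n w| <= delta^-1.
  move=> wn; have D0' := D0 n w wn.
  rewrite ger0_norm; last by rewrite divr_ge0 ?invr_ge0 ?exprn_ge0// ltW.
  by rewrite ler_pdivrMr// mulrC ler_pdivlMr// mulrC; exact: Qdiag.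
have di0 : 0 < delta^-1 by rewrite invr_gt0.
have [Di [bDi DiE]] := extend_multiplier di0 dinv_le.
have bV := op_comp p1' me bDi (op_comp p1' me bA0 (op_comp p1' me bT' bB)).
pose V := Di \o (A0 \o ((T \o M) \o B)).
have XB f := op_X bB (f := f).
have XTB f : X f -> X ((T \o M) (B f)) by move=> Xf; apply: (op_X bT'); exact: XB.
have pairV n w f : (size w < n)%N -> X f ->
    pairing P (e n w) (V f) = dinv n w * pairing P (b n w) ((T \o M) (B f)).
  move=> wn Xf; have XA := op_X bA0 (XTB _ Xf).
  have mde : memLp P q (fun om => dinv n w * e n w om).
    by have [] := memLpZ (ltW q1) (dinv n w) (mq wn).
  rewrite (pairing_extend (g2 := fun om => dinv n w * e n w om) bDi (mq wn) mde _ XA).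
    by rewrite pairing_scalel; [congr (_ * _); exact: A0E (XTB _ Xf)|exact: mq|exact: Xm].
  move=> m J Jm; have Xe := cspan_e p1' me Jm.
  have Xde := cspan_scale (dinv m J) Xe.
  rewrite (pairing_eq (mq wn) (Xm (op_X bDi Xe)) (Xm Xde) (DiE _ _ Jm)).
  rewrite (pairing_scalel _ (mq wn) (me Jm)).
  have -> : pairing P (e n w) (fun om => dinv m J * e m J om) = dinv m J * pairing P (e n w) (e m J).
    have [z _] := mem0 P p1'; have := pairing_lin p1 (dinv m J) (mq wn) (me Jm) z.
    rewrite (pairing0 p1 (mq wn)) addr0 => <-; congr pairing.
    by apply/funext => om; rewrite addr0.
  rewrite -(tf_dlt h Jm) (coef_tf hP _ _ wn) /dlt.
  case: eqP => [->|_]; last by rewrite !mul0r !mulr0.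
  by case: eqP => [->|_] //; rewrite mulr0 mul0r !mulr0.
have pairVe n w n' w' : (size w < n)%N -> (size w' < n')%N ->
    pairing P (e n' w') (V (e n w)) =
    dinv n' w' * Q (mat (T \o M)) (mu n') (beta n' w') (mu n) (beta n w).
  move=> wn wn'; have Xe := cspan_e p1' me wn; rewrite pairV// (QE bT').
  congr (_ * _); have Xb := cspan_tf (mu n) (beta n w).
  apply: pairing_eq => //; [exact/Xm/XTB|exact/Xm/(op_X bT' Xb)|].
  exact: (op_eq0 p1' me bT' (XB _ Xe) Xb (BE _ _ wn)).
(* On the diagonal, V and the identity agree exactly, by the choice of [dinv]. *)
have off n w n' w' : (size w < n)%N -> (size w' < n')%N ->
    `|pairing P (e n' w') (V (e n w)) - pairing P (e n' w') (e n w)| <=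
    eps / 4 * (8 ^- n * 8 ^- n').
  move=> wn wn'; rewrite pairVe// -[in X in _ - X](tf_dlt h wn) (coef_tf hP _ _ wn') /dlt.
  have [/eqP|ne] := eqVneq (n', w') (n, w).
    rewrite xpair_eqE => /andP[/eqP -> /eqP ->]; rewrite !eqxx !mul1r /dinv /D divfK.
      rewrite subrr normr0 !mulr_ge0 ?invr_ge0 ?exprn_ge0//; exact: ltW.
    by rewrite gt_eqF//; exact: D0.
  have -> : (n' == n)%:R * (w' == w)%:R = 0 :> R.
    by move: ne; rewrite xpair_eqE; case: eqP; case: eqP; rewrite ?mulr0 ?mul0r.
  rewrite mul0r subr0 normrM.
  have dl := dinv_le _ _ wn'; have Ql := Qoff _ _ _ _ wn' wn ne.
  apply: le_trans (ler_pM (normr_ge0 _) (normr_ge0 _) dl Ql) _.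
  have -> : delta^-1 * tol (maxn n' n) = eps / 4 * 64 ^- maxn n' n.
    by rewrite /tol; field; rewrite expf_neq0//= gt_eqF.
  rewrite ler_pM2l ?divr_gt0// -invfM lef_pV2 ?posrE ?mulr_gt0 ?exprn_gt0//.
  have -> : 64 = 8 * 8 :> R by ring.
  rewrite exprMn; apply: ler_pM; rewrite ?exprn_ge0// ler_weXn2l ?ler1n//.
    exact: leq_maxr.
  exact: leq_maxl.
have Vsp N c : nrmp (fun om => V (sp e N c) om - sp e N c om) <= eps * nrmp (sp e N c).
  pose f := sp e N c; rewrite -/f.
  have Xf : X f by exact: cspan_sp.
  have XVf : X (V f) := op_X bV Xf; have nf := nrm_ge0 P p f.
  have cb n w : (n < N)%N -> (size w < n)%N -> `|c n w| <= 2 ^+ size w * nrmp f.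
    move=> nN wn; have [_] := pairing_hoelder p1 (mq wn) (Xm Xf).
    rewrite (coef_sp hP N c wn) nN mul1r normrM.
    have P2 : 0 < 2 ^- size w :> R by rewrite invr_gt0 exprn_gt0.
    rewrite (gtr0_norm P2) => H; rewrite -(ler_pM2r P2); apply: le_trans H _.
    rewrite mulrAC mulfV ?expf_neq0//; apply: ler_wpM2r => //; exact: e_nrm_le1.
  apply: (coef_bound hP p1 (a := fun n w => nrmp f * (eps / 2) * 4 ^- n)
     (cspan_sub p1' me XVf Xf)); last first.
    move=> K; under eq_bigr do rewrite -mulr_sumr.
    rewrite -mulr_sumr; have := sum_W_quarter K; set S := \sum_(n < K) _ => S2.
    have : 0 <= nrmp f * (eps / 2) by rewrite mulr_ge0//; lra.
    by move=> g0; have := ler_wpM2l g0 S2; lra.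
  move=> n' w' wn'.
  have -> : pairing P (e n' w') (fun om => (V f) om - f om) =
      pairing P (e n' w') (V f) - pairing P (e n' w') f.
    have := pairing_lin p1 (-1) (mq wn') (Xm Xf) (Xm XVf).
    rewrite mulN1r addrC => <-; congr pairing; apply/funext => om; by ring.
  rewrite (pairing_op_sp N c bV (mq wn')) (pairing_spy N c (mq wn') me) -sumrB.
  apply: (@le_trans _ _ (\sum_(n < N) \sum_(w <- W n) (nrmp f * (eps / 4) * 8 ^- n') * 4 ^- n)).
    apply: le_trans (ler_norm_sum _ _ _) _; apply: ler_sum => n _.
    rewrite -sumrB; apply: le_trans (ler_norm_sum _ _ _) _.
    rewrite big_seq [leRHS]big_seq; apply: ler_sum => w; rewrite mem_W => wn.
    rewrite -mulrBr normrM.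
    apply: le_trans (ler_pM (normr_ge0 _) (normr_ge0 _) (cb _ _ (ltn_ord n) wn) (off _ _ _ _ wn wn')) _.
    have -> : 8 ^- n = 2 ^- n * 4 ^- n :> R.
      by rewrite -invfM -exprMn; congr (_ ^- _); ring.
    have P4 : 0 <= nrmp f * (eps / 4) * 8 ^- n' * 4 ^- n.
      by rewrite !mulr_ge0 ?invr_ge0 ?exprn_ge0// ltW.
    have P1 : 2 ^+ size w * 2 ^- n <= 1 :> R.
      by rewrite ler_pdivrMr ?exprn_gt0// mul1r ler_weXn2l ?ler1n// ltnW.
    have -> : 2 ^+ size w * nrmp f * (eps / 4 * (2 ^- n * 4 ^- n * 8 ^- n')) =
      (2 ^+ size w * 2 ^- n) * (nrmp f * (eps / 4) * 8 ^- n' * 4 ^- n) by ring.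
    by rewrite -[leRHS]mul1r ler_wpM2r.
  under eq_bigr do rewrite -mulr_sumr.
  rewrite -mulr_sumr; have := sum_W_quarter N; set S := \sum_(n < N) _ => S2.
  have g0 : 0 <= nrmp f * (eps / 4) * 8 ^- n'.
    by rewrite !mulr_ge0 ?invr_ge0 ?exprn_ge0// ltW.
  apply: le_trans (ler_wpM2l g0 S2) _.
  have E8 : 8 ^- n' = 4 ^- n' * 2 ^- n' :> R.
    by rewrite -invfM -exprMn; congr (_ ^- _); ring.
  have -> : nrmp f * (eps / 4) * 8 ^- n' * 2 = nrmp f * (eps / 2) * 4 ^- n' * 2 ^- n'.
    by rewrite E8; field; rewrite !expf_neq0.
  rewrite ler_wpM2l//; first by rewrite !mulr_ge0 ?invr_ge0 ?exprn_ge0// ltW.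
  by rewrite lef_pV2 ?posrE ?exprn_gt0// ler_weXn2l ?ler1n// ltnW.
(* From finite sums to all of [X], using that V is already known to be bounded. *)
have Vf f : X f -> nrmp (fun om => V f om - f om) <= eps * nrmp f.
  move=> Xf; apply/ler_addgt0Pr => eta eta0.
  have CV0 := op_C0 bV; set CV := (_ * _) in bV CV0.
  have c0 : 0 < CV + 1 + eps by lra.
  have [N [c Nc]] := proj2 Xf _ (divr_gt0 eta0 c0).
  pose g := sp e N c; have Xg : X g by exact: cspan_sp.
  rewrite -/g in Nc; set z := nrmp (fun w => f w - g w) in Nc.
  have zle : z * (CV + 1 + eps) <= eta by rewrite -ler_pdivlMr// ltW.
  have XVf : X (V f) := op_X bV Xf; have XVg : X (V g) := op_X bV Xg.
  have b1 := nrm_triangle p1' (g := V g) (Xm XVf) (Xm XVg) (Xm Xf).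
  have b2 := nrm_triangle p1' (g := g) (Xm XVg) (Xm Xg) (Xm Xf).
  have b3 : nrmp (fun w => V f w - V g w) <= CV * nrmp (fun w => f w - g w) := op_sub p1' me bV Xf Xg.
  have b4 := Vsp N c.
  have b5 := nrm_le_sub p1' (Xm Xg) (Xm Xf).
  have b6 : nrmp (fun w => g w - f w) = z by rewrite nrm_distC.
  rewrite b6 in b2 b5; rewrite -/z in b3; rewrite -/g in b4.
  have b7 := ler_wpM2l (ltW e0) b5.
  apply: le_trans b1 _.
  apply: (@le_trans _ _ (CV * z + (eps * (z + nrmp f) + z))); first by lra.
  by lra.
have e01 : 0 <= eps < 1 by rewrite (ltW e0).
have [S [bS SE]] := inverse_op p1' me bV e01 Vf.
(* [Di] contributes [cmul p / delta], [M] contributes [cmul p] and [S] contributes 1 / (1 - eps);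
   [A0] and [B] have bound 1. *)
exists (S \o (Di \o A0)), (M \o B), ((1 - eps)^-1 * (cmul p * delta^-1 * 1)), (cmul p * 1 * 1).
split.
- exact: (op_comp p1' me bS (op_comp p1' me bDi bA0)).
- exact: (op_comp p1' me bM bB).
- move=> f Xf; have XVf := op_X bV Xf.
  by apply: (nrm_sub_ae p1' (Xm (op_X bS XVf)) (Xm Xf)); exact: SE.
- by field; rewrite !gt_eqF//; lra.
Qed.

Lemma haar_span_sp g : haar_span h g -> exists N c, g = sp e N c.
Proof.
move=> [s [c [sD ->]]]; elim: s sD => [_|t s IH sD].
  by exists 0%N, (fun _ _ => 0); apply/funext => om; rewrite big_nil /sp big_ord0.
have [|N [c' E]] := IH; first by move=> t' ts; apply: sD; rewrite inE ts orbT.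
have [_ [kn jk]] := sD t (mem_head _ _).
have [w wk wj] := decode jk.
have wn : (size w < t.1.1)%N by rewrite wk.
pose c1 n' w' := ((n' == t.1.1) && (w' == w))%:R * c t.
have [M [c'' E']] := @sp_lin_ex _ Omega R 1 t.1.1.+1 c1 N c'.
exists M, c''; rewrite -E' -E -(sp_single e (c t) wn); apply/funext => om.
by rewrite big_cons mul1r /hh wk wj.
Qed.

Lemma sp_haar_span N c : haar_span h (sp e N c).
Proof.
have /choice[dec decP] : forall kj : nat * nat, exists w, (kj.2 < 2 ^ kj.1)%N ->
    size w = kj.1 /\ code w = kj.2.
  move=> [k j]; have [jk|_] := ltnP j (2 ^ k); last by exists [::].
  by have [w wk wj] := decode jk; exists w.
have decK w : dec (size w, code w) = w.
  by have [h1 h2] := decP (size w, code w) (code_lt w); exact: code_inj.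
pose s := [seq (n, size w, code w) | n <- iota 0 N, w <- W n].
exists s, (fun t => c t.1.1 (dec (t.1.2, t.2))); split.
  move=> t /allpairsPdep[n [w [_ ]]]; rewrite mem_W => wn -> /=.
  by split; [exact: leq_ltn_trans wn|split=> //; exact: code_lt].
apply/funext => om; rewrite /s big_allpairs_dep /sp.
rewrite -(big_mkord xpredT (fun n => \sum_(w <- W n) c n w * e n w om)) /index_iota subn0.
by apply: eq_bigr => n _; apply: eq_bigr => w _ /=; rewrite decK.
Qed.

Lemma Rp0wE : Rp0w P p h = X.
Proof.
apply/seteqP; split=> f.
  move=> [mf ff af]; split; first by split.
  move=> eps e0; have [g [gs gP]] := af _ e0; have [N [c E]] := haar_span_sp gs.
  have [m _] := memLpB p1' (conj mf ff) (sp_mem_r hP N c p0).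
  by exists N, c; rewrite -lte_fin -(nrmE m) -E.
move=> [[mf ff] af]; split=> // eps e0; have [N [c H]] := af _ e0.
exists (sp e N c); split; first exact: sp_haar_span.
have [m _] := memLpB p1' (conj mf ff) (sp_mem_r hP N c p0).
by rewrite (nrmE m) lte_fin.
Qed.

End Core.

Theorem mainTheorem10 (R : realType) (d : measure_display)
  (Omega : measurableType d) (P : probability Omega R)
  (h : nat -> nat -> nat -> Omega -> R) (p : R)
  (T : (Omega -> R) -> (Omega -> R)) (C delta : R) :
  1 < p ->
  BRS_copy P h ->
  bounded_op P p (Rp0w P p h) T C ->
  0 < delta ->
  (forall n k j, Dw n k j ->
     delta <= `| (dlen R k)^-1 *
                 Rintegral P [set: Omega] (fun w => h n k j w * T (h n k j) w) |) ->
  forall eps : R, 0 < eps < 1 ->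
  exists (A B : (Omega -> R) -> (Omega -> R)) (a b : R),
    [/\ bounded_op P p (Rp0w P p h) A a,
        bounded_op P p (Rp0w P p h) B b,
        (forall f, Rp0w P p h f -> A (T (B f)) = f %[ae P])
      & a * b <= 2 * (pstar p - 1) ^+ 4 / (delta * (1 - eps))
                 * (pstar p / 2) `^ (3 / 2)].
Proof.
move=> p1 hP bT d0 dT eps eI; rewrite (Rp0wE hP p1) in bT *.
have dT' n w : (size w < n)%N ->
    delta * 2 ^- size w <= `|pairing P (hh h n w) (T (hh h n w))|.
  move=> wn; have D : Dw n (size w) (code w).
    by split; [exact: leq_ltn_trans wn|split=> //; exact: code_lt].
  have := dT _ _ _ D; rewrite /dlen invrK normrM ger0_norm ?exprn_ge0// => H.
  by rewrite ler_pdivrMr ?exprn_gt0// mulrC.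
have [A [B [a [b [bA bB AB ab]]]]] := factor_identity hP p1 bT d0 eI dT'.
exists A, B, a, b; split=> //; rewrite ab.
have -> : cmul p ^+ 2 = 2 * (pstar p - 1) ^+ 4.
  by rewrite /cmul exprMn sqrt2_sqr -exprM.
have ps := pstar_ge p1; case/andP: eI => e0 e1.
rewrite -[leLHS]mulr1; apply: ler_wpM2l.
  rewrite divr_ge0 ?mulr_ge0 ?exprn_ge0 ?(ltW d0)//; lra.
(* Since p* / 2 >= 1, its powers increase with the exponent. *)
rewrite [leLHS](_ : 1 = (pstar p / 2) `^ 0); last by rewrite powRr0.
apply: ler_powR; lra.
Qed.
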